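(* Let $a\in\mathbb{R}$ and suppose that $\{\lambda_i,\varphi_i(a)\}_{i=1}^N$ is the interior spectral data at $a$ of some pair $(\omega,v)$, and that there are exactly $k\ge1$ indices $i$ with $\varphi_i(a)=0$. Then there are infinitely many pairs $(\tilde\omega,\tilde v)$ whose interior spectral data $\{\tilde\lambda_i,\tilde\varphi_i(a)\}_{i=1}^N$ at $a$ satisfies $$\tilde\lambda_i=\lambda_i,\qquad |\tilde\varphi_i(a)|=|\varphi_i(a)|,\qquad i=1,\dots,N. \quad( * )$$ Let $\mathcal{G}\subset\mathbb{R}^{2N}$ be the set of the spectral data of all pairs $(\tilde\omega,\tilde v)$ satisfying $( * )$. Then: (i) if $\alpha=\beta=0$, then $\mathcal{G}$ is a collection of $2^{N-2k-2}$ disjoint manifolds, each of dimension $k$; (ii) if $\alpha=0$, $\beta\ne0$, then $\mathcal{G}$ is a collection of $2^{N-2k-1}$ disjoint manifolds, each of dimension $k$; (iii) if $\alpha\ne0$, then $\mathcal{G}$ is a collection of $2^{N-2k}$ disjoint manifolds, each of dimension $k$.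
   Context: A pair $(\omega,v)$ means: for some $n\in\mathbb{N}$, $n\ge 1$, and real points $x_1<\dots<x_n$, $\omega=\sum_{i=1}^n\omega_i\delta_{x_i}$ and $v=\sum_{i=1}^n v_i\delta_{x_i}$ with $\omega_i\in\mathbb{R}$, $v_i\ge 0$ and $|\omega_i|+v_i>0$ ($\delta_x$ is the Dirac measure at $x$). The number $n$, the points and the weights may differ from pair to pair. For $z\in\mathbb{C}$ consider $-f''+\frac14 f=z\omega f+z^2vf$ on $\mathbb{R}$, meaning: $f$ is continuous, $-f''+\frac14 f=0$ on $\mathbb{R}\setminus\{x_1,\dots,x_n\}$, and $f'(x_i-)=f'(x_i+)+z\omega_if(x_i)+z^2v_if(x_i)$ for every $i$. An eigenvalue is a $z$ for which there is a nontrivial bounded solution. The eigenvalues form a finite set of nonzero real numbers $\lambda_1<\dots<\lambda_N$. For $z\in\mathbb{C}$, $\phi_\pm(z,\cdot)$ are the solutions with $\phi_\pm(z,x)=e^{\mp x/2}$ for all $x$ near $\pm\infty$. For an eigenvalue $\lambda$ put $\gamma_\lambda^2:=\int_{\mathbb{R}}|\phi_+(\lambda,x)|^2d\omega(x)+2\lambda\int_{\mathbb{R}}|\phi_+(\lambda,x)|^2dv(x)$; one has $\lambda\gamma_\lambda^2>0$. The normalized eigenfunctions are $\varphi_i(x)=\phi_+(\lambda_i,x)/\sqrt{\lambda_i\gamma_{\lambda_i}^2}$. For $a\in\mathbb{R}$, the family $\{\lambda_i,\varphi_i(a)\}_{i=1}^N$ is called the interior spectral data of $(\omega,v)$ at $a$;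 quantities with a tilde are the analogous ones for $(\tilde\omega,\tilde v)$ (which, in $( * )$, has exactly $N$ eigenvalues). Put $\alpha:=1-\sum_{i=1}^N|\varphi_i(a)|^2$ and $\beta:=-\sum_{i=1}^N\lambda_i|\varphi_i(a)|^2$. The spectral data of a pair is the vector $(\lambda_1,\dots,\lambda_N,\lambda_1\gamma_{\lambda_1}^2,\dots,\lambda_N\gamma_{\lambda_N}^2)\in\mathbb{R}^{2N}$. ''A collection of $m$ disjoint manifolds, each of dimension $k$'' means that the set has exactly $m$ connected components, each a manifold of dimension $k$. *)

(* Defs.v *)
From HB Require Import structures.
From mathcomp Require Import all_boot all_order all_algebra.
From mathcomp Require Import all_classical all_reals all_analysis.
From mathcomp Require Import complex.

Set Implicit Arguments.
Unset Strict Implicit.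
Unset Printing Implicit Defensive.

Import Order.TTheory GRing.Theory Num.Theory.
Import numFieldNormedType.Exports.

Local Open Scope classical_set_scope.
Local Open Scope ring_scope.
Local Open Scope complex_scope.

(* A pair (omega, v) of finitely supported real measures, in its unique normal
   form: omega = \sum_i om i * delta_(pt i), v = \sum_i vv i * delta_(pt i).
   Distinct records are distinct pairs of measures. *)
Record dirac_pair (R : realType) := DiracPair {
  npt : nat;
  pt : 'I_npt -> R;
  om : 'I_npt -> R;
  vv : 'I_npt -> R;
  npt_gt0 : (0 < npt)%N;
  pt_incr : forall i j : 'I_npt, (i < j)%N -> pt i < pt j;
  vv_ge0 : forall i, 0 <= vv i;
  weight_gt0 : forall i, 0 < `|om i| + vv i }.

Arguments pt {R} d i.
Arguments om {R} d i.
Arguments vv {R} d i.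

Section Complex_valued.
Variable R : realType.
Implicit Types (f : R -> R[i]) (x : R) (l z : R[i]).

(* Modulus as an element of R (the library norm `|z| lives in R[i]). *)
Definition cmod z : R := complex.Re `|z|.

(* MathComp-Analysis has no R-normed module structure on R[i]; for functions of
   a real variable, limits and derivatives are taken componentwise. *)
Definition cvgC (F : set_system R) f l : Prop :=
  (complex.Re (f t) @[t --> F] --> complex.Re l)
  /\ (complex.Im (f t) @[t --> F] --> complex.Im l).

Definition continuousC f : Prop := forall x, cvgC (nbhs x) f (f x).

Definition derivableC f x : Prop :=
  derivable (fun t => complex.Re (f t)) x 1
  /\ derivable (fun t => complex.Im (f t)) x 1.

Definition derivC f : R -> R[i] := fun x =>
  derive1 (fun t => complex.Re (f t)) x +i* derive1 (fun t => complex.Im (f t)) x.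

End Complex_valued.

Section Spectral_problem.
Variables (R : realType) (P : dirac_pair R).

(* f solves -f'' + f/4 = z omega f + z^2 v f; fl and fr are the one-sided
   limits f'(x_i-) and f'(x_i+). *)
Definition is_solution (z : R[i]) (f : R -> R[i]) : Prop :=
  [/\ continuousC f,
      forall x : R, (forall i, x != pt P i) ->
        [/\ derivableC f x, derivableC (derivC f) x
          & - derivC (derivC f) x + 4^-1 * f x = 0]
    & forall i, exists fl fr : R[i],
        [/\ cvgC ((pt P i)^'-) (derivC f) fl,
            cvgC ((pt P i)^'+) (derivC f) fr
          & fl = fr + z * (om P i)%:C * f (pt P i)
                 + z ^+ 2 * (vv P i)%:C * f (pt P i)]].

Definition is_eigenvalue (z : R[i]) : Prop :=
  exists f : R -> R[i],
    [/\ is_solution z f, exists x, f x != 0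
      & exists M : R, forall x, cmod (f x) <= M].

(* lam_0 < ... < lam_(N-1) are exactly the (complex) eigenvalues. *)
Definition is_spectrum (N : nat) (lam : 'I_N -> R) : Prop :=
  (forall i j : 'I_N, (i < j)%N -> lam i < lam j)
  /\ (forall z : R[i], is_eigenvalue z <-> exists i, z = (lam i)%:C).

(* The solution equal to exp(-x/2) near +oo; it exists and is unique, so the
   default value of xget is never used. *)
Definition phi_plus (z : R[i]) : R -> R[i] :=
  xget (fun=> 0) [set f | is_solution z f
    /\ \forall x \near +oo, f x = (expR (- x / 2))%:C].

(* gamma_lam^2; the integrals against omega and v are finite sums. *)
Definition gamma2 (lam : R) : R :=
  \sum_(i < npt P) om P i * cmod (phi_plus lam%:C (pt P i)) ^+ 2
  + 2 * lam * \sum_(i < npt P) vv P i * cmod (phi_plus lam%:C (pt P i)) ^+ 2.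

Definition eigenfunction (lam : R) (x : R) : R[i] :=
  phi_plus lam%:C x / (Num.sqrt (lam * gamma2 lam))%:C.

Definition is_interior_data (a : R) (N : nat)
    (lam : 'I_N -> R) (phi : 'I_N -> R[i]) : Prop :=
  is_spectrum lam /\ forall i, phi i = eigenfunction (lam i) a.

Definition is_spectral_data (N : nat) (s : 'rV[R]_(N + N)) : Prop :=
  exists lam : 'I_N -> R, is_spectrum lam
    /\ s = row_mx (\row_i lam i) (\row_i (lam i * gamma2 (lam i))).

End Spectral_problem.

Section Same_interior_data.
Variables (R : realType) (a : R) (N : nat).
Variables (lam : 'I_N -> R) (phi : 'I_N -> R[i]).

Definition isospectral_pairs : set (dirac_pair R) :=
  [set Q | exists (lam' : 'I_N -> R) (phi' : 'I_N -> R[i]),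
     is_interior_data Q a lam' phi'
     /\ forall i, lam' i = lam i /\ cmod (phi' i) = cmod (phi i)].

Definition isospectral_data : set 'rV[R]_(N + N) :=
  [set s | exists2 Q, isospectral_pairs Q & is_spectral_data Q s].

Definition interior_alpha : R := 1 - \sum_(i < N) cmod (phi i) ^+ 2.
Definition interior_beta : R := - \sum_(i < N) lam i * cmod (phi i) ^+ 2.

End Same_interior_data.

(* Topological k-manifold (without boundary), for a subset of R^n with the
   subspace topology; being Hausdorff and second countable is automatic there. *)
Definition is_manifold (R : realType) (n k : nat) (M : set 'rV[R]_n) : Prop :=
  forall p, M p ->
    exists (U : set 'rV[R]_n) (V : set 'rV[R]_k)
           (f : 'rV[R]_n -> 'rV[R]_k) (g : 'rV[R]_k -> 'rV[R]_n),
      [/\ open U, U p & open V]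
      /\ [/\ set_bij (M `&` U) V f,
             forall x, (M `&` U) x -> g (f x) = x,
             {within M `&` U, continuous f}
           & {within V, continuous g}].

Definition is_manifold_collection (R : realType) (n m k : nat)
    (G : set 'rV[R]_n) : Prop :=
  ([set connected_component G x | x in G] #= `I_m)%card
  /\ forall x, G x -> is_manifold k (connected_component G x).

(* Main.v *)
Require Import Defs.
From HB Require Import structures.
From mathcomp Require Import all_boot all_order all_algebra.
From mathcomp Require Import all_classical all_reals all_analysis.
From mathcomp Require Import complex ring lra zify.
Import Order.TTheory GRing.Theory Num.Theory.
Import numFieldNormedType.Exports.

(** Between the points of the support a solution is [A e^{x/2} + B e^{-x/2}],
    and crossing a mass acts on [(A, B)] by a unimodular matrix that is
    polynomial in [z] ([cross]).  So the decaying solutions [phi_-] and [phi_+]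
    are polynomials in [z], and the coefficient [W] of [e^{x/2}] in [phi_-]
    beyond the last mass is their Wronskian.  The eigenvalues are the zeros of
    [W]; they are simple, because [W' (lambda)] is a nonzero multiple of
    [gamma^2] ([christoffel_darboux]) and [lambda gamma^2 > 0] by an energy
    identity ([energy_gt0]).

    Put [p = e^{a/2} phi_+(., a)] and [q = e^{-a/2} phi_-(., a)].  These are
    polynomials with value [1] at [0].  At an eigenvalue the two solutions are
    proportional, which gives
      [q = - lambda W' mu p]  and  [phi_i(a)^2 = mu p^2]
    with [mu = e^{-a} / (lambda gamma^2)] ([direct_spectral]).  Hence [p q]
    takes at every eigenvalue the value [- lambda W' phi_i(a)^2], so the
    product [g = p q] is the same for all pairs with the given data.  The Green
    function on the diagonal is [g / W], and [z g / W] is a Herglotz function: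
    after the [k] common factors are cancelled its zeros are real and simple.
    At the [k] eigenvalues with [phi_i(a) = 0] both [p] and [q] vanish.  The
    other zeros of [g], none of them an eigenvalue, are distributed between [p]
    and [q].  Their number is [N - 2k] minus the order at which the Green
    function vanishes at infinity; its first two coefficients there are
    [alpha] and [beta] ([zeros_count]).

    A pair of measures thus determines a subset of these zeros, those of [p],
    and the subset determines [lambda_i gamma_i^2] at every eigenvalue with
    [phi_i(a) <> 0].  Conversely, let a subset and arbitrary positive values of
    [lambda_i gamma_i^2] at the [k] remaining eigenvalues be given.  The inverse
    spectral theorem ([inverse_spectral]) yields measures with these spectral
    data, obtained by splitting off the masses one after the other from the
    right, with a Herglotz function at each step.  That the polynomial [p] of
    these measures belongs to the given subset follows from a uniqueness
    statement ([interior_unique]): the polynomials [p] that are possible for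
    given spectral data and given [a] satisfy orthogonality relations from
    which the squared norm of the difference of two of them is at most [0].
    The same statement shows that different subsets force different values.

    So the set of spectral data is a disjoint union, over all subsets, of
    orthants of dimension [k] in which the other coordinates are constant and
    take finitely many values overall.  These orthants are the connected
    components ([slices_manifold_collection]). *)

Set Implicit Arguments.
Unset Strict Implicit.
Unset Printing Implicit Defensive.

Local Open Scope ring_scope.
Local Open Scope complex_scope.

(** * Rational Herglotz functions *)

Section Lagrange.
Variable R : fieldType.
Implicit Types (f D : {poly R}) (rs : seq R) (r c : R).

Definition cofactor_at c rs r := c *: \prod_(s <- rem r rs) ('X - s%:P).

Lemma cofactor_atE c rs r : r \in rs ->
  c *: \prod_(s <- rs) ('X - s%:P) = cofactor_at c rs r * ('X - r%:P).
Proof.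
move=> rrs; rewrite /cofactor_at (perm_big _ (perm_to_rem rrs)) big_cons.
by rewrite mulrC scalerAr.
Qed.

Lemma cofactor_at_other c rs r s : r \in rs -> s \in rs -> s != r ->
  (cofactor_at c rs r).[s] = 0.
Proof.
move=> rrs srs sr; have := cofactor_atE c rrs.
move=> /(congr1 (fun p => p.[s])); rewrite hornerZ hornerM hornerXsubC.
have /eqP -> : root (\prod_(s <- rs) ('X - s%:P)) s by rewrite root_prod_XsubC.
by rewrite mulr0 => /esym/eqP; rewrite mulf_eq0 subr_eq0 (negbTE sr) orbF => /eqP.
Qed.

Lemma cofactor_at_self c rs r : r \in rs ->
  (cofactor_at c rs r).[r] = (c *: \prod_(s <- rs) ('X - s%:P))^`().[r].
Proof.
move=> rrs; rewrite (cofactor_atE c rrs) derivM derivXsubC mulr1 hornerD.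
by rewrite hornerM hornerXsubC subrr mulr0 add0r.
Qed.

Lemma deriv_split_neq0 c rs r : c != 0 -> uniq rs -> r \in rs ->
  (c *: \prod_(s <- rs) ('X - s%:P))^`().[r] != 0.
Proof.
move=> c0 u rrs; rewrite -cofactor_at_self // hornerZ mulf_neq0 //.
rewrite -/(root _ _) root_prod_XsubC mem_rem_uniq // inE eqxx.
by [].
Qed.

Lemma lagrange_cofactor f c rs : c != 0 -> uniq rs -> (size f <= size rs)%N ->
  let D := c *: \prod_(s <- rs) ('X - s%:P) in
  f = \sum_(r <- rs) (f.[r] / D^`().[r]) *: cofactor_at c rs r.
Proof.
move=> c0 u sf D; apply/eqP; rewrite -subr_eq0; apply/eqP.
apply: (roots_geq_poly_eq0 (rs := rs)) => //; last first.
  rewrite (leq_trans (size_polyD _ _)) // geq_max sf size_polyN.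
  apply: (leq_trans (size_sum _ _ _)); rewrite big_seq.
  apply: (big_ind (fun n => n <= size rs)%N) => [|m n|r rrs] //.
    by move=> Hm Hn; rewrite geq_max Hm.
  apply: (leq_trans (size_scale_leq _ _)).
  apply: (leq_trans (size_scale_leq _ _)).
  by rewrite size_prod_XsubC size_rem // prednK //; case: (rs) rrs.
apply/allP => r rrs; apply/eqP; rewrite !hornerE horner_sum.
rewrite (bigD1_seq r) //= big_seq_cond big1 => [|s /andP[srs sr]].
  rewrite addr0 hornerZ cofactor_at_self // divfK ?subrr //.
  exact: deriv_split_neq0.
by rewrite hornerZ cofactor_at_other ?mulr0 // eq_sym.
Qed.

(** Comparing the top coefficients in the interpolation formula: this is the
    residue theorem for [f / D], whose residue at infinity is the right-hand side. *)
Lemma sum_residues f c rs : c != 0 -> uniq rs -> (size f <= size rs)%N ->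
  \sum_(r <- rs) f.[r] / (c *: \prod_(s <- rs) ('X - s%:P))^`().[r]
  = f`_(size rs).-1 / c.
Proof.
move=> c0 u sf; rewrite {2}(lagrange_cofactor c0 u sf) coef_sum mulr_suml.
rewrite big_seq [RHS]big_seq; apply: eq_bigr => r rrs; rewrite !coefZ.
have := monic_prod_XsubC (rem r rs) predT id => /monicP.
rewrite lead_coefE size_prod_XsubC /= size_rem // => ->.
by rewrite mulr1 mulfK.
Qed.

Lemma uniq_simple_roots rs :
  (forall r, r \in rs -> (\prod_(s <- rs) ('X - s%:P))^`().[r] != 0) -> uniq rs.
Proof.
elim: rs => [//|x rs IH] H /=; apply/andP; split.
  apply/negP => xrs; have := H x (mem_head _ _).
  rewrite big_cons derivM derivXsubC !hornerE subrr mul0r addr0 -/(root _ _).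
  by rewrite root_prod_XsubC xrs.
apply: IH => r rrs; have := H r; rewrite inE rrs orbT => /(_ isT).
rewrite big_cons derivM derivXsubC !hornerE.
have /eqP -> : root (\prod_(s <- rs) ('X - s%:P)) r by rewrite root_prod_XsubC.
by rewrite add0r mulf_eq0 negb_or => /andP[].
Qed.

End Lagrange.

Section ComplexParts.
Variable R : rcfType.
Implicit Types u v z : R[i].

Lemma Re_add u v : complex.Re (u + v) = complex.Re u + complex.Re v.
Proof. by case: u v => a b [c d]. Qed.

Lemma Im_add u v : complex.Im (u + v) = complex.Im u + complex.Im v.
Proof. by case: u v => a b [c d]. Qed.

Lemma Re_opp u : complex.Re (- u) = - complex.Re u.
Proof. by case: u. Qed.

Lemma Im_opp u : complex.Im (- u) = - complex.Im u.
Proof. by case: u. Qed.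

Lemma Re_sum (I : Type) (r : seq I) (p : pred I) (F : I -> R[i]) :
  complex.Re (\sum_(i <- r | p i) F i) = \sum_(i <- r | p i) complex.Re (F i).
Proof. by apply: (big_morph (@complex.Re R)) => // u v; exact: Re_add. Qed.

Lemma Im_sum (I : Type) (r : seq I) (p : pred I) (F : I -> R[i]) :
  complex.Im (\sum_(i <- r | p i) F i) = \sum_(i <- r | p i) complex.Im (F i).
Proof. by apply: (big_morph (@complex.Im R)) => // u v; exact: Im_add. Qed.

Lemma Re_mulC z (r : R) : complex.Re (z * r%:C) = complex.Re z * r.
Proof. by case: z => a b /=; rewrite mulr0 subr0. Qed.

Lemma Im_mulC z (r : R) : complex.Im (z * r%:C) = complex.Im z * r.
Proof. by case: z => a b /=; rewrite mulr0 add0r. Qed.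

Lemma complex_ext u v :
  complex.Re u = complex.Re v -> complex.Im u = complex.Im v -> u = v.
Proof. by case: u v => a b [c d] /= -> ->. Qed.

Lemma real_complexM (a b : R) : a%:C * b%:C = (a * b)%:C.
Proof. by rewrite rmorphM. Qed.

End ComplexParts.

Section HermiteBiehler.
Variable R : rcfType.
Implicit Types (D E : {poly R}) (rs : seq R) (z : R[i]).

Definition toC (p : {poly R}) : {poly R[i]} := map_poly (real_complex R) p.

Lemma real_roots_split E : E != 0 ->
  (forall z, root (toC E) z -> complex.Im z = 0) ->
  exists rs, E = lead_coef E *: \prod_(r <- rs) ('X - r%:P).
Proof.
move=> E0 H.
have [zs Ez] := closed_field_poly_normal (toC E).
exists (map (@complex.Re R) zs).
apply: (map_poly_inj (real_complex R)).
rewrite -/(toC E) Ez -!mul_polyC rmorphM /= map_polyC /= -/(toC E) lead_coef_map.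
rewrite rmorph_prod big_map; congr (_ * _); rewrite big_seq [RHS]big_seq.
apply: eq_bigr => z zz; rewrite rmorphB /= map_polyX map_polyC /=.
congr ('X - _%:P); have /H : root (toC E) z.
  rewrite Ez rootZ ?root_prod_XsubC // lead_coef_eq0 /toC map_poly_eq0 //.
by case: z zz => x y /= _ ->.
Qed.

(** [E / D = v z + w + \sum_r nu_r / (r - z)] with [v >= 0] and all [nu_r > 0]:
    the sign at the roots of [D] says that [nu_r = - E(r) / D'(r)] is positive, the
    last two clauses that the polynomial part is linear with [v >= 0]. *)
Definition herglotz E D :=
  [/\ D != 0,
      exists2 rs, uniq rs & D = lead_coef D *: \prod_(r <- rs) ('X - r%:P),
      forall r, root D r -> E.[r] * D^`().[r] < 0,
      (size E <= (size D).+1)%N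
    & 0 <= E`_(size D) * lead_coef D].

(** Both coefficients of the polynomial part are split off from the top; the
    remainder is interpolated at the roots of [D]. *)
Lemma herglotz_expansion E D : herglotz E D ->
  exists rs v w (nu : R -> R),
   [/\ [/\ uniq rs, lead_coef D != 0 &
        D = lead_coef D *: \prod_(r <- rs) ('X - r%:P)],
    0 <= v, forall r, r \in rs -> 0 < nu r
    & E = (v *: 'X + w%:P) * D - \sum_(r <- rs) nu r *: cofactor_at (lead_coef D) rs r].
Proof.
case=> D0 [rs u ED] neg sE lc; set c := lead_coef D.
have c0 : c != 0 by rewrite lead_coef_eq0.
have sD : size D = (size rs).+1.
  by rewrite ED size_scale ?lead_coef_eq0 // size_prod_XsubC.
pose v := E`_(size D) / c.
pose E1 := E - v *: 'X * D.
pose w := E1`_(size rs) / c.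
pose E2 := E1 - w%:P * D.
have cD : D`_(size rs) = c by rewrite /c lead_coefE sD.
have sE1 : (size E1 <= size D)%N.
  apply/leq_sizeP => j sj; rewrite /E1 coefB -scalerAl coefZ coefXM.
  have [->|] := eqVneq j (size D).
    by rewrite sD /= cD /v sD divfK // subrr.
  move=> jD; have jD1 : (size D < j)%N by rewrite ltn_neqAle eq_sym jD.
  rewrite nth_default ?(leq_trans sE) // sub0r; case: j {sj jD} jD1 => //= j jD.
  by rewrite nth_default ?mulr0 ?oppr0.
have sE2 : (size E2 <= size rs)%N.
  apply/leq_sizeP => j sj; rewrite /E2 coefB mul_polyC coefZ.
  have [->|] := eqVneq j (size rs); first by rewrite cD /w divfK // subrr.
  move=> jD; have jD1 : (size D <= j)%N by rewrite sD ltn_neqAle eq_sym jD.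
  by rewrite !nth_default ?mulr0 ?subrr // (leq_trans sE1).
have E2r r : root D r -> E2.[r] = E.[r].
  by move=> /eqP Dr; rewrite /E2 /E1 !hornerE Dr !mulr0 !subr0.
exists rs, v, w, (fun r => - (E.[r] / D^`().[r])); split => //.
- rewrite /v; move: lc; rewrite -/c => lc.
  have -> : E`_(size D) / c = E`_(size D) * c / c ^+ 2 by field.
  by rewrite divr_ge0 // sqr_ge0.
- move=> r rrs; have rD : root D r.
    by rewrite ED rootZ ?lead_coef_eq0 // root_prod_XsubC.
  have Dr : D^`().[r] != 0 by rewrite ED deriv_split_neq0 // lead_coef_eq0.
  rewrite oppr_gt0 -(pmulr_llt0 (x := D^`().[r] ^+ 2)) ?expr2.
    by rewrite mulrA divfK // neg.
  by rewrite -expr2 exprn_even_gt0.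
- have := lagrange_cofactor c0 u sE2; rewrite -ED /= => E2E.
  rewrite [LHS](_ : E = (v *: 'X + w%:P) * D + E2); last first.
    by rewrite /E2 /E1 mulrDl; ring.
  congr (_ + _); rewrite {1}E2E -sumrN big_seq [RHS]big_seq.
  apply: eq_bigr => r rrs.
  have rD : root D r by rewrite ED rootZ ?lead_coef_eq0 // root_prod_XsubC.
  by rewrite (E2r _ rD) scaleNr opprK.
Qed.

(** [E' D - E D'] is [v D^2] plus a positive combination of squares of
    cofactors, no two of which vanish together. *)
Lemma herglotz_wronskian E D : herglotz E D -> (1 < size E)%N ->
  forall x, root E x -> 0 < E^`().[x] * D.[x].
Proof.
move=> hED sE x xE; have [D0 _ neg _ _] := hED.
have Dx : D.[x] != 0.
  apply/negP => /neg; rewrite (eqP xE) mul0r ltxx.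
  by [].
have [rs [v [w [nu [[u c0 ED] v0 nu0 EE]]]]] := herglotz_expansion hED.
set c := lead_coef D in c0 ED EE.
have key : E^`() * D - E * D^`() = v *: D ^+ 2
    + \sum_(r <- rs) nu r *: cofactor_at c rs r ^+ 2.
  have -> : \sum_(r <- rs) nu r *: cofactor_at c rs r ^+ 2 =
     (\sum_(r <- rs) nu r *: cofactor_at c rs r) * D^`()
     - (\sum_(r <- rs) nu r *: cofactor_at c rs r)^`() * D.
    rewrite raddf_sum /= !mulr_suml -sumrB big_seq [RHS]big_seq.
    apply: eq_bigr => r rrs.
    have ED' : D = cofactor_at c rs r * ('X - r%:P) by rewrite -(cofactor_atE c rrs).
    rewrite ED' derivZ derivM derivXsubC -!mul_polyC; ring.
  rewrite [E]EE derivB derivM derivD derivZ derivX derivC addr0 -!mul_polyC; ring.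
have := congr1 (fun p => p.[x]) key.
rewrite hornerD hornerN hornerD hornerZ horner_exp !hornerM (eqP xE) mul0r subr0 => ->.
have sumE : (\sum_(r <- rs) nu r *: cofactor_at c rs r ^+ 2).[x] =
  \sum_(r <- rs) nu r * (cofactor_at c rs r).[x] ^+ 2.
  by rewrite horner_sum; apply: eq_bigr => r _; rewrite !hornerE.
rewrite sumE.
have sum0 : 0 <= \sum_(r <- rs) nu r * (cofactor_at c rs r).[x] ^+ 2.
  rewrite big_seq sumr_ge0 // => r rrs.
  by rewrite mulr_ge0 ?sqr_ge0 // ltW ?nu0.
case: rs u ED nu0 EE key sumE sum0 => [|r rs] u ED nu0 EE _ _ sum0.
  rewrite big_nil addr0 mulr_gt0 ?exprn_even_gt0 //=.
  rewrite lt_neqAle v0 andbT eq_sym; apply/eqP => v00.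
  move: sE; rewrite EE v00 scale0r add0r big_nil subr0 ED big_nil -mul_polyC mulr1.
  by rewrite -rmorphM /= size_polyC; case: eqP.
apply: ltr_wpDl; first by rewrite mulr_ge0 ?sqr_ge0.
rewrite big_cons; apply: ltr_pwDl.
  rewrite mulr_gt0 ?nu0 ?mem_head // exprn_even_gt0 //=.
  apply/negP => /eqP cx; case/negP: Dx.
  by rewrite ED (cofactor_atE c (mem_head _ _)) hornerM cx mul0r.
rewrite big_seq sumr_ge0 // => s srs; rewrite mulr_ge0 ?sqr_ge0 // ltW ?nu0 //.
by rewrite inE srs orbT.
Qed.


(** Off the real axis the imaginary part of [E / D] has the sign of [Im z]. *)
Lemma herglotz_roots_real E D : herglotz E D -> E != 0 ->
  forall z, root (toC E) z -> complex.Im z = 0.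
Proof.
move=> hED E0 z zE; apply/eqP; apply: contraT => Iz.
have [rs [v [w [nu [[u c0 ED] v0 nu0 EE]]]]] := herglotz_expansion hED.
set c := lead_coef D in c0 ED EE.
have zr r : z - r%:C != 0.
  apply/eqP => /eqP; rewrite subr_eq0 => /eqP zr.
  by move: Iz; rewrite zr /= eqxx.
pose q r := nu r / ((complex.Re z - r) ^+ 2 + complex.Im z ^+ 2).
have q0 r : r \in rs -> 0 < q r.
  move=> /nu0 n0; rewrite divr_gt0 // ltr_wpDl ?sqr_ge0 //.
  by rewrite exprn_even_gt0.
have Dz : (toC D).[z] != 0.
  rewrite /toC ED -mul_polyC rmorphM rmorph_prod /= map_polyC hornerM hornerC.
  rewrite mulf_neq0 ?fmorph_eq0 // horner_prod; rewrite prodf_seq_neq0; apply/allP => r rrs /=.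
  by rewrite rmorphB /= map_polyX map_polyC !hornerE zr.
have key : (v%:C * z + w%:C) + \sum_(r <- rs) (nu r)%:C / (r%:C - z) = 0.
  apply: (mulfI Dz); rewrite mulr0 -[RHS](eqP zE) EE /toC.
  rewrite rmorphB rmorphM rmorphD rmorph_sum /= -mul_polyC rmorphM /=.
  rewrite !map_polyC map_polyX /= hornerD hornerN hornerM !hornerE.
  rewrite mulrDr mulrC; congr (_ + _).
  rewrite horner_sum mulr_sumr -sumrN big_seq [RHS]big_seq.
  apply: eq_bigr => r rrs; rewrite -mul_polyC rmorphM /= map_polyC hornerM hornerC /=.
  rewrite {1}ED (cofactor_atE c rrs) rmorphM rmorphB /= map_polyX map_polyC.
  rewrite hornerM !hornerE /=.
  have -> : r%:C - z = - (z - r%:C) by rewrite opprB.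
  have h := zr r; set Q := _.[z]; set x := z - _ in h *; field.
  exact: h.
have Imq r : complex.Im ((nu r)%:C / (r%:C - z)) = complex.Im z * q r.
  rewrite /q; case: z {zE key q0 q Dz} Iz zr => x y /= y0 zr; field.
  by rewrite gt_eqF // ltr_wpDl ?sqr_ge0 // exprn_even_gt0.
have := congr1 (@complex.Im R) key; rewrite Im_add Im_sum.
under eq_bigr do rewrite Imq.
have -> : complex.Im (v%:C * z + w%:C) = complex.Im z * v.
  by case: (z) => x y /=; ring.
rewrite -mulr_sumr -mulrDr /= => /eqP; rewrite mulf_eq0 (negbTE Iz) /=.
case: rs u ED nu0 EE key q0 => [|r rs] u ED nu0 EE key q0.
  rewrite big_nil addr0 => /eqP v00; move: zE.
  rewrite EE v00 scale0r add0r big_nil subr0 /toC rmorphM /= map_polyC rootM rootC.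
  rewrite fmorph_eq0 rootE (negbTE Dz) orbF => /eqP w0.
  by move: E0; rewrite EE v00 w0 scale0r add0r big_nil subr0 mul0r eqxx.
rewrite gt_eqF // big_cons ltr_wpDl // ltr_pwDl ?q0 ?mem_head //.
by rewrite big_seq sumr_ge0 // => s srs; rewrite ltW // q0 // inE srs orbT.
Qed.

(** The class is closed under [f -> -1/f]: zeros of [f] are real by the sign
    of its imaginary part and simple because its derivative is positive. *)
Lemma herglotz_inv E D : herglotz E D -> E != 0 -> herglotz (- D) E.
Proof.
move=> hED E0; have [D0 _ neg sE lc] := hED.
have [rs [v [w [nu [[u c0 ED] v0 nu0 EE]]]]] := herglotz_expansion hED.
set c := lead_coef D in c0 ED EE.
have [qs Eq] := real_roots_split E0 (herglotz_roots_real hED E0).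
have e0 : lead_coef E != 0 by rewrite lead_coef_eq0.
have wr x : root E x -> 0 < E^`().[x] * D.[x].
  move=> xE; apply: herglotz_wronskian => //; rewrite ltnNge.
  by apply/negP => /size1_polyC Ec; move: xE E0; rewrite Ec rootC polyC_eq0 => ->.
have sD : size D = (size rs).+1.
  by rewrite ED size_scale // size_prod_XsubC.
have low : (size E < size D)%N -> size D = (size E).+1 /\ lead_coef E * c < 0.
  move=> sED.
  have vw : v *: 'X + w%:P = 0.
    apply/eqP; apply: contraTT sED => vw0; rewrite -leqNgt.
    have sS : (size (\sum_(r <- rs) nu r *: cofactor_at c rs r)%R < size D)%N.
      rewrite sD ltnS; apply: (leq_trans (size_sum _ _ _)); rewrite big_seq.
      apply: (big_ind (fun n => n <= size rs)%N) => [|m n|r rrs] //.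
        by move=> Hm Hn; rewrite geq_max Hm.
      apply: (leq_trans (size_scale_leq _ _)).
      apply: (leq_trans (size_scale_leq _ _)).
      by rewrite size_prod_XsubC size_rem // prednK //; case: (rs) rrs.
    have sM : (size D <= size ((v *: 'X + w%:P) * D)%R)%N.
      rewrite size_mul //; move: vw0; rewrite -size_poly_gt0 => /prednK <-.
      by rewrite addSn leq_addl.
    by rewrite EE size_polyDl ?size_polyN // (leq_trans sS).
  have EE' : E = - \sum_(r <- rs) nu r *: cofactor_at c rs r by rewrite EE vw mul0r sub0r.
  have rs0 : rs != [::].
    by apply: contraNneq E0 => rs0; rewrite EE' rs0 big_nil oppr0.
  have top : E`_(size rs).-1 = - (\sum_(r <- rs) nu r) * c.
    rewrite EE' coefN coef_sum mulNr mulr_suml; congr (- _).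
    rewrite big_seq [RHS]big_seq; apply: eq_bigr => r rrs; rewrite !coefZ.
    have := monic_prod_XsubC (rem r rs) predT id => /monicP.
    by rewrite lead_coefE size_prod_XsubC /= size_rem // => ->; rewrite mulr1.
  have nu_gt0 : 0 < \sum_(r <- rs) nu r.
    case: (rs) rs0 nu0 => // r s _ nu0; rewrite big_cons ltr_pwDl ?nu0 ?mem_head //.
    by rewrite big_seq sumr_ge0 // => t ts; rewrite ltW // nu0 // inE ts orbT.
  have sEr : size E = size rs.
    apply/eqP; rewrite eqn_leq -ltnS -sD sED /=.
    have : (size rs).-1 \in gtn (size E).
      rewrite inE ltnNge; apply/negP => /leq_sizeP /(_ _ (leqnn _)) /eqP.
      by rewrite top mulf_eq0 oppr_eq0 (gt_eqF nu_gt0) (negbTE c0).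
    by rewrite inE; case: (rs) rs0.
  rewrite sD sEr lead_coefE sEr top; split=> //.
  rewrite -mulrA mulNr oppr_lt0 mulr_gt0 // -expr2 exprn_even_gt0 //=.
split=> //.
- exists qs => //; apply: uniq_simple_roots => x xqs.
  have xE : root E x by rewrite Eq rootZ // root_prod_XsubC.
  have := wr x xE; rewrite {1}Eq derivZ hornerZ => h.
  by apply/negP => /eqP d0; move: h; rewrite d0 mulr0 mul0r ltxx.
- by move=> x /wr; rewrite hornerN mulNr oppr_lt0 mulrC.
- by rewrite size_polyN; case: (ltnP (size E) (size D)) => [/low[-> _]//|/leqW].
- case: (ltnP (size E) (size D)) => [/low[sDE]|h].
    rewrite coefN {1}[_`_(size E)](_ : _ = c); last by rewrite /c lead_coefE sDE.
    by move=> h; rewrite mulNr oppr_ge0 mulrC ltW.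
  by rewrite coefN nth_default // oppr0 mul0r.
Qed.

End HermiteBiehler.

(** * Transfer across point masses and its inverse problem *)

(** Effect of a mass on the solution [A e^{x/2} + B e^{-x/2}], encoded as
    [s = (A, B)].  The mass sits at [log y], its strength is [w], and [y'] is the
    inverse of [y].  Since [F] is [e^{-x/2}] times the value of the solution there,
    the drop of the derivative is [w F e^{x/2}]. *)
Definition cross (K : pzRingType) (y y' w : K) (s : K * K) : K * K :=
  let F := s.1 + y' * s.2 in (s.1 - w * F, s.2 + w * y * F).

Section Inverse.
Variable R : rcfType.
Implicit Types (l : seq (R * R * R)) (t : R * R * R).

(** A mass at [log y] with weights [om] and [v] is encoded as [(y, om, v)]. *)
Definition wpoly t : {poly R} := t.1.2 *: 'X + t.2 *: 'X ^+ 2.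
Definition pcross (s : {poly R} * {poly R}) t :=
  cross t.1.1%:P (t.1.1^-1)%:P (wpoly t) s.
Definition pchain s l := foldl pcross s l.

Definition admissible l :=
  pairwise (fun t u => t.1.1 < u.1.1) l
  && all (fun t => [&& 0 < t.1.1, 0 <= t.2 & 0 < `|t.1.2| + t.2]) l.

Lemma horner_split_root (P : {poly R}) (rs : seq R) : P != 0 ->
  P = lead_coef P *: \prod_(r <- rs) ('X - r%:P) -> forall r, root P r = (r \in rs).
Proof. by move=> P0 -> r; rewrite rootZ ?lead_coef_eq0 // root_prod_XsubC. Qed.

(** Induction from the right.  If [y] is the exponential of the last point then
    [b / W] tends to [- y] at infinity, so the value [F = W + b / y] at that point
    has lower degree than [W].  The hypothesis makes [X F / W] a Herglotz function,
    hence so is [- W / (X F)]: the linear part [v X + om] of this function gives the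
    weights of the last mass, with [v >= 0], and the remainder [A'] is the
    polynomial [W] of the shorter chain.  Inverting once more shows that the
    hypotheses hold for the shorter chain. *)
Lemma inverse_chain N (W b : {poly R}) (rs : seq R) :
  size W = N.+1 -> W.[0] = 1 -> b.[0] = 0 -> (size b <= size W)%N -> uniq rs ->
  W = lead_coef W *: \prod_(r <- rs) ('X - r%:P) ->
  (forall r, root W r -> r * b.[r] * W^`().[r] < 0) ->
  exists l, [/\ pchain (1, 0) l = (W, b), admissible l &
     forall t, t \in l -> t.1.1 <= - (b`_N / W`_N)].
Proof.
have [n] := ubnP N; elim: n N W b rs => // n IH N W b rs Nn sW W0 b0 sb u EW neg.
have Wn0 : W != 0 by rewrite -size_poly_eq0 sW.
have sN : size rs = N.
  by apply: succn_inj; rewrite -sW EW size_scale ?lead_coef_eq0 // size_prod_XsubC.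
have lW : lead_coef W = W`_N by rewrite lead_coefE sW.
have WN0 : W`_N != 0 by rewrite -lW lead_coef_eq0.
case: (posnP N) => [N0|N0].
  exists [::]; split => //=.
  have /size1_polyC -> : (size W <= 1)%N by rewrite sW N0.
  have /size1_polyC -> : (size b <= 1)%N by rewrite (leq_trans sb) // sW N0.
  by rewrite -!horner_coef0 W0 b0.
pose y := - (b`_N / W`_N).
(* By partial fractions [b / (X W)] is a sum of terms [mu_r / (r - X)] with
   [mu_r > 0], and [y] is the sum of the [mu_r]. *)
have y0 : 0 < y.
  have /factor_theorem [b1 Eb] : root b 0 by rewrite rootE b0.
  rewrite subr0 in Eb.
  have sb1 : (size b1 <= size rs)%N.
    have [->|b10] := eqVneq b1 0; first by rewrite size_poly0.
    by move: sb; rewrite Eb size_mulX // sW sN.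
  have := sum_residues (c := lead_coef W) _ u sb1; rewrite lead_coef_eq0 -EW => /(_ Wn0).
  have -> : b1`_(size rs).-1 = b`_N by rewrite Eb coefMX sN; case: (N) N0.
  rewrite lW /y => <-; rewrite -sumrN.
  have pos r : r \in rs -> 0 < - (b1.[r] / W^`().[r]).
    move=> rrs; have rW : root W r by rewrite (horner_split_root Wn0 EW).
    have := neg r rW; rewrite Eb hornerM hornerX => h.
    have W'0 : W^`().[r] != 0 by apply: contraTneq h => ->; rewrite mulr0 ltxx.
    have r0 : r != 0 by apply: contraTneq h => ->; rewrite !mul0r ltxx.
    rewrite oppr_gt0 -(pmulr_llt0 (x := (r * W^`().[r]) ^+ 2)); last first.
      by rewrite exprn_even_gt0 //= mulf_neq0.
    by rewrite [X in X < 0](_ : _ = r * (b1.[r] * r) * W^`().[r]) //; field.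
  case: (rs) sN pos => [/= sN|r s _ pos]; first by rewrite -sN in N0.
  rewrite big_cons ltr_pwDl ?pos ?mem_head // big_seq sumr_ge0 // => x xs.
  by rewrite ltW // pos // inE xs orbT.
have yn0 : y != 0 by rewrite gt_eqF.
pose F := W + (y^-1)%:P * b.
have F0 : F.[0] = 1 by rewrite /F hornerD hornerM W0 b0 mulr0 addr0.
have Fn0 : F != 0 by apply: contra_eq_neq F0 => ->; rewrite horner0 eq_sym oner_eq0.
have sF : (size F <= N)%N.
  apply/leq_sizeP => j; rewrite leq_eqVlt => /predU1P[<-|Nj].
    rewrite /F coefD coefCM (_ : b`_N = - (y * W`_N)); last by rewrite /y; field.
    by rewrite mulrN mulKf // subrr.
  by rewrite /F coefD coefCM !nth_default ?mulr0 ?addr0 ?(leq_trans sb) // sW.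
have XFn0 : 'X * F != 0 by rewrite mulf_neq0 ?polyX_eq0.
have sXF : size ('X * F) = (size F).+1 by rewrite mulrC size_mulX.
have h1 : herglotz ('X * F) W.
  split => //; first by exists rs.
  - move=> r rW; rewrite hornerM hornerX /F hornerD hornerM hornerC (eqP rW) add0r.
    rewrite (_ : _ * _ = y^-1 * (r * b.[r] * W^`().[r])); last by ring.
    by rewrite pmulr_rlt0 ?invr_gt0 // neg.
  - by rewrite sXF ltnS sW (leq_trans sF).
  - rewrite nth_default ?mul0r // sXF sW ltnS //.
have h2 := herglotz_inv h1 XFn0.
have [_ [qs uq Eq] neg2 sz2 lc2] := h2.
set D2 := 'X * F in XFn0 sXF h1 h2 Eq neg2 sz2 lc2.
have lD2 : lead_coef D2 != 0 by rewrite lead_coef_eq0.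
(* [A'] is the remainder of [W] modulo [D2]; the quotient has degree at most 1
   and is read off from the top coefficients. *)
pose v := - W`_(size D2) / lead_coef D2.
pose om := - (W + v *: 'X * D2)`_(size F) / lead_coef D2.
pose w := om *: 'X + v *: 'X ^+ 2.
pose A' := W + w * F.
have EA' : A' = W + (v *: 'X + om%:P) * D2.
  by rewrite /A' /w /D2 -!mul_polyC; ring.
have cD2 : D2`_(size F) = lead_coef D2 by rewrite lead_coefE sXF.
have v0 : 0 <= v.
  have -> : v = (- W)`_(size D2) * lead_coef D2 / lead_coef D2 ^+ 2.
    by rewrite coefN /v; field.
  by rewrite divr_ge0 // sqr_ge0.
have sA : (size A' <= size F)%N.
  apply/leq_sizeP => j; rewrite EA' leq_eqVlt => /predU1P[<-|].
    rewrite mulrDl addrA coefD mul_polyC coefZ cD2 /om.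
    by field.
  rewrite -sXF leq_eqVlt => /predU1P[<-|Dj].
    rewrite mulrDl addrA !coefD -scalerAl coefZ coefXM mul_polyC coefZ sXF /=.
    rewrite cD2 [D2`_(_.+1)]nth_default ?sXF // mulr0 addr0 -sXF /v.
    by field.
  rewrite mulrDl addrA !coefD -scalerAl coefZ coefXM mul_polyC coefZ.
  have W_ : W`_j = 0 by rewrite nth_default // (leq_trans _ Dj) // -size_polyN.
  case: j Dj W_ => // j; rewrite ltnS => Dj W_ /=.
  by rewrite W_ !nth_default ?mulr0 ?addr0 // leqW.
have A0 : A'.[0] = 1.
  rewrite /A' hornerD hornerM W0 /w hornerD !hornerZ hornerX horner_exp hornerX.
  by rewrite expr0n /= !mulr0 addr0 mul0r addr0.
have An0 : A' != 0 by apply: contra_eq_neq A0 => ->; rewrite horner0 eq_sym oner_eq0.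
have h3 : herglotz (- A') D2.
  split => //; first by exists qs.
  - move=> r rD; have := neg2 r rD; rewrite EA' !hornerN hornerD hornerM (eqP rD).
    by rewrite mulr0 addr0.
  - by rewrite size_polyN sXF (leq_trans sA) // leqW.
  - by rewrite coefN nth_default ?oppr0 ?mul0r // sXF leqW.
have h4 : herglotz (- D2) (- A') by apply: herglotz_inv; rewrite ?oppr_eq0.
have [_ [ps up Ep] neg4 sz4 lc4] := h4.
have sAF : size A' = size F.
  by apply/eqP; rewrite eqn_leq sA /= -ltnS -sXF -(size_polyN A') -(size_polyN D2).
pose B' := y%:P * (F - A').
pose d := (size F).-1.
have sFd : size F = d.+1 by rewrite /d prednK // size_poly_gt0.
have lA : A'`_d = lead_coef A' by rewrite lead_coefE sAF.
have lF : F`_d = lead_coef F by rewrite lead_coefE.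
have FA : 0 < F`_d / A'`_d.
  have h : 0 <= F`_d * A'`_d.
    move: lc4; rewrite size_polyN lead_coefN mulrN coefN mulNr opprK sAF.
    by rewrite -lA sFd /D2 coefXM.
  have -> : F`_d / A'`_d = F`_d * A'`_d / A'`_d ^+ 2.
    by field; rewrite lA lead_coef_eq0.
  rewrite divr_gt0 //; last by rewrite exprn_even_gt0 //= lA lead_coef_eq0.
  by rewrite lt_neqAle h andbT eq_sym mulf_neq0 // ?lA ?lF lead_coef_eq0.
have [l' [cl adm ly]] : exists l, [/\ pchain (1, 0) l = (A', B'), admissible l &
     forall t, t \in l -> t.1.1 <= - (B'`_d / A'`_d)].
  apply: (IH d A' B' ps) => //.
  - by rewrite -ltnS (leq_trans _ Nn) // ltnS -sFd.
  - by rewrite sAF.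
  - by rewrite /B' hornerM hornerD hornerN F0 A0 subrr mulr0.
  - rewrite /B' mul_polyC (leq_trans (size_scale_leq _ _)) //.
    by rewrite (leq_trans (size_polyD _ _)) // geq_max size_polyN sAF leqnn.
  - by apply: oppr_inj; rewrite {1}Ep lead_coefN scaleNr.
  - move=> r rA; have := neg4 r; rewrite rootE hornerN oppr_eq0 => /(_ rA).
    rewrite derivN !hornerN mulrNN /D2 hornerM hornerX => h.
    rewrite /B' hornerM hornerC hornerD hornerN (eqP rA) subr0.
    rewrite (_ : _ * _ * _ = y * (r * F.[r] * A'^`().[r])); last by ring.
    by rewrite pmulr_rlt0.
have ylt : - (B'`_d / A'`_d) < y.
  rewrite /B' coefCM coefB.
  rewrite (_ : - _ = y - y * (F`_d / A'`_d)); last first.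
    by field; rewrite lA lead_coef_eq0.
  by rewrite ltrBlDr ltrDl mulr_gt0.
exists (rcons l' (y, om, v)); split.
- rewrite /pchain foldl_rcons -/(pchain _ _) cl /pcross /cross /= /wpoly /= -/w.
  have FE : A' + (y^-1)%:P * B' = F.
    by rewrite /B' mulrA -polyCM mulVf // mul1r addrC subrK.
  rewrite FE; congr (_, _); first by rewrite /A' addrK.
  have yy : y%:P * (y^-1)%:P = 1 :> {poly R} by rewrite -polyCM mulfV.
  have -> : B' + w * y%:P * F = y%:P * (F - W) by rewrite /B' /A'; ring.
  by rewrite /F addrAC subrr add0r mulrA yy mul1r.
- move: adm; rewrite /admissible pairwise_rcons all_rcons => /andP[-> ->] /=.
  rewrite y0 v0 !andbT /=; apply/andP; split.
    by apply/allP => t /ly h /=; rewrite (le_lt_trans h).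
  rewrite lt_neqAle addr_ge0 // andbT eq_sym paddr_eq0 // normr_eq0.
  apply/negP => /andP[/eqP om0 /eqP v00].
  have : A' = W by rewrite EA' om0 v00 scale0r add0r mul0r addr0.
  by move/(congr1 (size \o val)) => /=; rewrite sAF sW => sFW; rewrite sFW ltnn in sF.
- move=> t; rewrite mem_rcons inE => /predU1P[->//|/ly h].
  exact: ltW (le_lt_trans h ylt).
Qed.

End Inverse.

(** * Pairs of polynomials seen from an interior point *)

Section Characteristic.
Variables (R : rcfType) (N : nat) (lam : 'I_N -> R).
Hypothesis lam_inj : injective lam.
Hypothesis lam0 : forall i, lam i != 0.
Hypothesis N0 : (0 < N)%N.

(** The Wronskian, normalised by the value [1] at [0]. *)
Definition charpoly : {poly R} := \prod_(i < N) (1 - (lam i)^-1 *: 'X).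
Local Notation W := charpoly.
Definition lamseq := [seq lam i | i : 'I_N].

Lemma lamseq_uniq : uniq lamseq.
Proof. by rewrite map_inj_uniq ?enum_uniq. Qed.

Lemma size_lamseq : size lamseq = N.
Proof. by rewrite size_map size_enum_ord. Qed.

Lemma big_lamseq (T : Type) (idx : T) (op : Monoid.com_law idx) (F : R -> T) :
  \big[op/idx]_(r <- lamseq) F r = \big[op/idx]_(i < N) F (lam i).
Proof. by rewrite big_map big_enum. Qed.

Lemma charpoly_split :
  W = (\prod_(i < N) - (lam i)^-1) *: \prod_(r <- lamseq) ('X - r%:P).
Proof.
rewrite big_lamseq -scaler_prod; apply: eq_bigr => i _.
by rewrite scalerBr scaleNr -mul_polyC scaleNr -mul_polyC -polyCM mulVf // opprK addrC.
Qed.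

Lemma charpoly_lead_neq0 : \prod_(i < N) - (lam i)^-1 != 0.
Proof. by apply/prodf_neq0 => i _; rewrite oppr_eq0 invr_eq0. Qed.

Lemma size_charpoly : size W = N.+1.
Proof.
by rewrite charpoly_split size_scale ?charpoly_lead_neq0 // size_prod_XsubC size_lamseq.
Qed.

Lemma charpoly_coefN : W`_N = \prod_(i < N) - (lam i)^-1.
Proof.
have := monic_prod_XsubC lamseq predT id => /monicP.
rewrite lead_coefE size_prod_XsubC size_lamseq /= => h.
by rewrite charpoly_split coefZ h mulr1.
Qed.

Lemma charpoly_lead : lead_coef W = W`_N.
Proof. by rewrite lead_coefE size_charpoly. Qed.

Lemma charpoly_coefN_neq0 : W`_N != 0.
Proof. by rewrite charpoly_coefN charpoly_lead_neq0. Qed.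

Lemma charpoly_root r : root W r = (r \in lamseq).
Proof.
by rewrite charpoly_split rootZ ?charpoly_lead_neq0 // root_prod_XsubC.
Qed.

Lemma charpoly_lam i : W.[lam i] = 0.
Proof. by apply/eqP; rewrite -rootE charpoly_root map_f ?mem_enum. Qed.

Lemma charpoly0 : W.[0] = 1.
Proof.
by rewrite horner_prod big1 // => i _; rewrite hornerD hornerN hornerZ hornerX hornerC mulr0 subr0.
Qed.

Lemma charpoly_deriv i : W^`().[lam i] != 0.
Proof.
rewrite charpoly_split deriv_split_neq0 ?charpoly_lead_neq0 ?lamseq_uniq //.
by rewrite map_f ?mem_enum.
Qed.

Lemma charpoly_unique (V : {poly R}) : size V = N.+1 -> V.[0] = 1 ->
  (forall i, V.[lam i] = 0) -> V = W.
Proof.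
move=> sV V0 Vl; apply/eqP; rewrite -subr_eq0; apply/eqP.
apply: (roots_geq_poly_eq0 (rs := 0 :: lamseq)).
- rewrite /= rootE hornerD hornerN V0 charpoly0 subrr eqxx /=.
  apply/allP => r /mapP[i _ ->].
  by rewrite rootE hornerD hornerN Vl charpoly_lam subrr.
- rewrite /= lamseq_uniq andbT; apply/negP => /mapP[i _ h].
  by have := lam0 i; rewrite -h eqxx.
- rewrite /= size_lamseq (leq_trans (size_polyD _ _)) // size_polyN geq_max.
  by rewrite sV size_charpoly leqnn.
Qed.

Lemma sum_residues_lam (f : {poly R}) : (size f <= N)%N ->
  \sum_(i < N) f.[lam i] / W^`().[lam i] = f`_N.-1 / W`_N.
Proof.
move=> sf; have := @sum_residues _ f _ _ charpoly_lead_neq0 lamseq_uniq.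
by rewrite size_lamseq -charpoly_split big_lamseq -charpoly_coefN; apply.
Qed.

(** Residue theorem for [f / (z W)]. *)
Lemma sum_residues0 (f : {poly R}) : (size f <= N.+1)%N ->
  \sum_(i < N) f.[lam i] / (lam i * W^`().[lam i]) = f`_N / W`_N - f.[0].
Proof.
move=> sf.
have /factor_theorem [g Eg] : root (f - f.[0] *: W) 0.
  by rewrite rootE hornerD hornerN hornerZ charpoly0 mulr1 subrr.
rewrite subr0 in Eg.
have sg : (size g <= N)%N.
  have [->|g0] := eqVneq g 0; first by rewrite size_poly0.
  rewrite -ltnS -(size_mulX g0) -Eg (leq_trans (size_polyD _ _)) // geq_max sf.
  by rewrite size_polyN (leq_trans (size_scale_leq _ _)) // size_charpoly.
transitivity (\sum_(i < N) g.[lam i] / W^`().[lam i]).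
  apply: eq_bigr => i _; have := congr1 (fun p => p.[lam i]) Eg.
  rewrite hornerD hornerN hornerZ charpoly_lam mulr0 subr0 hornerM hornerX => ->.
  by field; rewrite charpoly_deriv lam0.
rewrite (sum_residues_lam sg) (_ : g`_N.-1 = (f - f.[0] *: W)`_N); last first.
  by rewrite Eg coefMX; case: (N) N0.
by rewrite coefB coefZ mulrBl mulfK ?charpoly_coefN_neq0.
Qed.

Section Interior.
Variable mu : 'I_N -> R.
Hypothesis mu_gt0 : forall i, 0 < mu i.

(** What the solutions that decay at plus and minus infinity look like from an
    interior point [a], up to factors [e^{a/2}] and [e^{-a/2}].  The last clause
    says that they are proportional at the eigenvalues, where [mu] are the spectral
    weights multiplied by [e^{-a}]; the sign clause says that the limit at infinity
    of the Green function [p q / W] is nonnegative.  The number [n] bounds the degree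
    of [p] and need not be attained. *)
Definition interior_pair n (p q : {poly R}) :=
  [/\ [/\ (n <= N)%N, (size p <= n.+1)%N & (size q <= (N - n).+1)%N],
      p.[0] = 1, q.[0] = 1, 0 <= p`_n * q`_(N - n) * W`_N
    & forall i, q.[lam i] = - (lam i * W^`().[lam i]) * mu i * p.[lam i]].

Lemma size_interior_mul m n (p q : {poly R}) : (size p <= m.+1)%N -> (size q <= n.+1)%N ->
  (size (p * q)%R <= (m + n).+1)%N.
Proof.
move=> sp sq; apply: (leq_trans (size_polyMleq _ _)).
by have := leq_add sp sq; rewrite addSn addnS; case: (_ + _)%N.
Qed.

Lemma coef_interior_mul m n (p q : {poly R}) : (size p <= m.+1)%N -> (size q <= n.+1)%N ->
  (p * q)`_(m + n) = p`_m * q`_n.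
Proof.
move=> sp sq; rewrite coefM.
have mlt : (m < (m + n).+1)%N by rewrite ltnS leq_addr.
rewrite (bigD1 (Ordinal mlt)) //= addKn big1 ?addr0 // => j jm.
have [jl|jg] := ltnP j m; last first.
  have {}jg : (m < j)%N by rewrite ltn_neqAle jg andbT eq_sym.
  by rewrite [p`_j]nth_default ?mul0r // (leq_trans sp).
by rewrite [q`_(_ - _)]nth_default ?mulr0 // (leq_trans sq) // ltn_subRL ltn_add2r.
Qed.

(** With respect to the weights [mu] the polynomial [p] reproduces the value at
    [0] on polynomials of smaller degree: this is the residue theorem for
    [q h / (z W)]. *)
Lemma interior_orthogonal n p q h : interior_pair n p q ->
  (size (q * h)%R <= N.+1)%N ->
  \sum_(i < N) mu i * (p * h).[lam i] = h.[0] - (q * h)`_N / W`_N.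
Proof.
move=> [_ p0 q0 _ pq] sqh; rewrite -opprB.
rewrite -[h.[0]]mul1r -q0 -hornerM -sum_residues0 // -sumrN; apply: eq_bigr => i _.
rewrite !hornerM pq; field.
by rewrite charpoly_deriv lam0.
Qed.

(** By orthogonality the squared [mu]-norm of [p - p'] is [- (P - P') (Q - Q')]
    or, if [n] and [m] differ, [- P Q - P' Q'], where capitals denote the scaled top
    coefficients, with [P Q] and [P' Q'] nonnegative.  In the first case moreover
    [P Q' = P' Q], so the product is nonnegative by the inequality of arithmetic and
    geometric means. *)
Lemma interior_unique n m p q p' q' :
  interior_pair n p q -> interior_pair m p' q' -> p = p'.
Proof.
wlog nm : n m p q p' q' / (m <= n)%N.
  move=> wl h h'; case: (leqP m n) => [mn|/ltnW mn].
    exact: (wl n m p q p' q').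
  by rewrite (wl m n p' q' p q).
move=> h h'; have [[nN sp sq] p0 q0 pos pq] := h.
have [[mN sp' sq'] p0' q0' pos' pq'] := h'.
have lN := charpoly_coefN_neq0.
have lN2 : 0 < W`_N ^+ 2 by rewrite exprn_even_gt0.
have hpp := interior_orthogonal (h := p) h.
have hpp' := interior_orthogonal (h := p') h.
have hp'p' := interior_orthogonal (h := p') h'.
have hp'p := interior_orthogonal (h := p) h'.
have nK : (N - n + n = N)%N by rewrite subnK.
have mK : (N - m + m = N)%N by rewrite subnK.
have S1 := size_interior_mul sq sp; rewrite nK in S1.
have S2 := size_interior_mul sq' sp'; rewrite mK in S2.
have S3 : (size (q * p')%R <= N.+1)%N.
  apply: leq_trans (size_interior_mul sq sp') _.
  by rewrite ltnS -[leqRHS]nK leq_add2l.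
have C1 := coef_interior_mul sq sp; rewrite nK in C1.
have C2 := coef_interior_mul sq' sp'; rewrite mK in C2.
have {hpp}E1 := hpp S1; have {hpp'}E2 := hpp' S3; have {hp'p'}E3 := hp'p' S2.
rewrite C1 p0 in E1; rewrite p0' in E2; rewrite C2 p0' in E3.
have sumE : \sum_(i < N) mu i * ((p - p').[lam i]) ^+ 2 =
   \sum_(i < N) mu i * (p * p).[lam i] + \sum_(i < N) mu i * (p' * p').[lam i]
   - 2 * \sum_(i < N) mu i * (p * p').[lam i].
  rewrite mulr_sumr -sumrN -!big_split /=; apply: eq_bigr => i _.
  by rewrite !hornerM hornerD hornerN; ring.
have sum_le0 : \sum_(i < N) mu i * ((p - p').[lam i]) ^+ 2 <= 0.
  rewrite sumE E1 E2 E3.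
  set P := p`_n; set Q := q`_(N - n); set P' := p'`_m; set Q' := q'`_(N - m).
  rewrite -/P -/Q -/P' -/Q' in pos pos'.
  have a0 : 0 <= Q * P / W`_N.
    have -> : Q * P / W`_N = P * Q * W`_N / W`_N ^+ 2 by field.
    by rewrite divr_ge0 // ltW.
  have a0' : 0 <= Q' * P' / W`_N.
    have -> : Q' * P' / W`_N = P' * Q' * W`_N / W`_N ^+ 2 by field.
    by rewrite divr_ge0 // ltW.
  move: nm; rewrite leq_eqVlt => /predU1P[mn|mn].
    subst m.
    have C3 := coef_interior_mul sq sp'; rewrite nK in C3.
    have C4 := coef_interior_mul sq' sp; rewrite nK in C4.
    have S4 := size_interior_mul sq' sp; rewrite nK in S4.
    have E4 := hp'p S4; rewrite C4 p0 in E4; rewrite C3 in E2.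
    have : \sum_(i < N) mu i * (p' * p).[lam i] = \sum_(i < N) mu i * (p * p').[lam i].
      by apply: eq_bigr => i _; rewrite mulrC [p * _]mulrC mulrC.
    rewrite E4 E2 C3 -/P -/Q -/P' -/Q' => /eqP; rewrite -subr_eq0 => /eqP X.
    have {}X : Q * P' / W`_N = Q' * P / W`_N by lra.
    have X2 : (Q * P' / W`_N) ^+ 2 = (Q * P / W`_N) * (Q' * P' / W`_N).
      by rewrite expr2 {2}X; ring.
    move: X2 a0 a0'; set a := Q * P / _; set a' := Q' * P' / _; set x := Q * P' / _.
    move=> X2 a0 a0'; have : x <= (a + a') / 2.
      have [x0|x0] := ltP 0 x; last by apply: (le_trans x0); lra.
      rewrite -(ler_pXn2r (n := 2)) ?nnegrE ?(ltW x0) //; last by lra.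
      rewrite X2 -subr_ge0 (_ : _ - _ = ((a - a') / 2) ^+ 2) ?sqr_ge0 //.
      by field.
    by lra.
  rewrite [(q * p')`_N]nth_default; last first.
    apply: leq_trans (size_interior_mul sq sp') _.
    by rewrite -[leqRHS]nK -addnS leq_add2l.
  by rewrite mul0r; lra.
have sum_eq0 : \sum_(i < N) mu i * ((p - p').[lam i]) ^+ 2 = 0.
  apply/eqP; rewrite eq_le sum_le0 sumr_ge0 // => i _.
  by rewrite mulr_ge0 ?sqr_ge0 // ltW.
have pl i : (p - p').[lam i] = 0.
  have /psumr_eq0P : forall j : 'I_N, true -> 0 <= mu j * ((p - p').[lam j]) ^+ 2.
    by move=> j _; rewrite mulr_ge0 ?sqr_ge0 // ltW.
  move=> /(_ sum_eq0) /(_ i isT) /eqP.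
  by rewrite mulf_eq0 gt_eqF //= sqrf_eq0 => /eqP.
apply/eqP; rewrite -subr_eq0; apply/eqP.
apply: (roots_geq_poly_eq0 (rs := 0 :: lamseq)).
- rewrite /= rootE hornerD hornerN p0 p0' subrr eqxx /=.
  by apply/allP => r /mapP[i _ ->]; rewrite rootE pl.
- rewrite /= lamseq_uniq andbT; apply/negP => /mapP[i _ e].
  by have := lam0 i; rewrite -e eqxx.
- rewrite /= size_lamseq (leq_trans (size_polyD _ _)) // size_polyN geq_max.
  by rewrite (leq_trans sp) // (leq_trans sp').
Qed.

End Interior.
End Characteristic.

(** * The transfer chain of a pair of measures *)

Section Cross.
Variable K : comPzRingType.
Implicit Types (y w : K) (s t : K * K).

(** The Wronskian of two solutions. *)
Definition det s t := s.1 * t.2 - s.2 * t.1.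

Lemma cross_det y y' w s t : y * y' = 1 ->
  det (cross y y' w s) (cross y y' w t) = det s t.
Proof.
move=> yy; rewrite /det /cross /=.
transitivity (s.1 * t.2 - s.2 * t.1 + (y * y' - 1) * w * (s.1 * t.2 - s.2 * t.1)).
  ring.
by rewrite yy subrr !mul0r addr0.
Qed.

Lemma cross_value y y' w s : y * y' = 1 ->
  (cross y y' w s).1 + y' * (cross y y' w s).2 = s.1 + y' * s.2.
Proof.
move=> yy; rewrite /cross /=.
transitivity (s.1 + y' * s.2 + (y * y' - 1) * w * (s.1 + y' * s.2)); first ring.
by rewrite yy subrr !mul0r addr0.
Qed.

Lemma crossK y y' w s : y * y' = 1 -> cross y y' (- w) (cross y y' w s) = s.
Proof.
move=> yy; rewrite {1}/cross cross_value // /cross /=.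
by case: s => s1 s2 /=; congr (_, _); ring.
Qed.

Lemma crossKN y y' w s : y * y' = 1 -> cross y y' w (cross y y' (- w) s) = s.
Proof. by move=> yy; rewrite -{1}[w]opprK crossK. Qed.

End Cross.

Section Direct.
Variable R : rcfType.
Implicit Types (l : seq (R * R * R)) (t : R * R * R) (s : {poly R} * {poly R}).

Definition pcross_inv t s := cross t.1.1%:P (t.1.1^-1)%:P (- wpoly t) s.
Definition rchain s l := foldr pcross_inv s l.

Definition positive l := all (fun t => 0 < t.1.1) l.

Lemma polyC_inv (y : R) : 0 < y -> y%:P * (y^-1)%:P = 1 :> {poly R}.
Proof. by move=> y0; rewrite -polyCM mulfV // gt_eqF. Qed.

Lemma admissible_positive l : admissible l -> positive l.
Proof. by case/andP => _ /allP h; apply/allP => t /h /and3P[]. Qed.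

Lemma pchainK l s : positive l -> rchain (pchain s l) l = s.
Proof.
elim: l s => //= t l IH s /andP[t0 lp]; rewrite /pchain /= -/(pchain _ _) IH //.
by rewrite /pcross_inv /pcross crossK // polyC_inv.
Qed.

Lemma rchainK l s : positive l -> pchain (rchain s l) l = s.
Proof.
elim: l s => //= t l IH s /andP[t0 lp].
by rewrite /pcross_inv /pcross crossKN ?polyC_inv // -/(pchain _ _) IH.
Qed.

Lemma pchain_det l s s' : positive l -> det (pchain s l) (pchain s' l) = det s s'.
Proof.
elim: l s s' => //= u l IH s s' /andP[u0 lp]; rewrite IH // /pcross cross_det //.
exact: polyC_inv.
Qed.

(** A solution is determined linearly by its coefficients beyond the last mass. *)
Lemma rchain_lin s l :
  rchain s l = (s.1 * (rchain (1, 0) l).1 + s.2 * (rchain (0, 1) l).1,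
                s.1 * (rchain (1, 0) l).2 + s.2 * (rchain (0, 1) l).2).
Proof.
elim: l => [|t l IH] /=; first by case: s => a b /=; rewrite !mulr1 !mulr0 addr0 add0r.
by rewrite IH /pcross_inv /cross /=; congr (_, _); ring.
Qed.

Lemma wpoly0 t : (wpoly t).[0] = 0.
Proof. by rewrite /wpoly hornerD !hornerZ horner_exp hornerX expr0n !mulr0 addr0. Qed.

Lemma pchain_at0 l s : ((pchain s l).1.[0], (pchain s l).2.[0]) = (s.1.[0], s.2.[0]).
Proof.
elim: l s => //= t l IH s; rewrite IH /pcross /cross /=.
rewrite hornerD hornerN hornerM wpoly0 mul0r subr0.
by rewrite hornerD !hornerM wpoly0 !mul0r addr0.
Qed.

Lemma rchain_at0 l s : ((rchain s l).1.[0], (rchain s l).2.[0]) = (s.1.[0], s.2.[0]).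
Proof.
elim: l => //= t l [E1 E2]; rewrite /pcross_inv /cross /=.
have w0 : (- wpoly t).[0] = 0 by rewrite hornerN wpoly0 oppr0.
by congr (_, _); rewrite hornerD ?hornerN !hornerM w0 !mul0r ?oppr0 addr0.
Qed.

Lemma wpoly_lead t : 0 < `|t.1.2| + t.2 -> 0 <= t.2 ->
  exists e c, [/\ (0 < e)%N, c != 0, (size (wpoly t) <= e.+1)%N & (wpoly t)`_e = c].
Proof.
move=> t0 v0; have [v00|v00] := eqVneq t.2 0.
  exists 1%N, t.1.2; split => //.
  - by apply: contraTneq t0 => ->; rewrite v00 normr0 addr0 ltxx.
  - by rewrite /wpoly v00 scale0r addr0 (leq_trans (size_scale_leq _ _)) // size_polyX.
  - by rewrite /wpoly v00 scale0r addr0 coefZ coefX mulr1.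
exists 2, t.2; split => //.
- rewrite /wpoly (leq_trans (size_polyD _ _)) // geq_max.
  rewrite (leq_trans (size_scale_leq _ _)) ?size_polyX //=.
  by rewrite (leq_trans (size_scale_leq _ _)) ?size_polyXn.
- by rewrite /wpoly coefD !coefZ coefX coefXn mulr0 add0r mulr1.
Qed.

(** A mass raises the degree by that of its strength, and the top-degree part of
    the solution behind it vanishes at the mass: the top coefficients are [c] and
    [- y c]. *)
Lemma cross_lead (A B : {poly R}) (y w' c g : R) d e (w : {poly R}) :
  (size w <= e.+1)%N -> w`_e = w' -> (0 < e)%N ->
  (size A <= d.+1)%N -> (size B <= d.+1)%N ->
  (A + (y^-1)%:P * B)`_d = g -> c = - w' * g ->
  let s := cross y%:P (y^-1)%:P w (A, B) in
  [/\ (size s.1 <= (e + d).+1)%N, (size s.2 <= (e + d).+1)%N,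
      s.1`_(e + d) = c & s.2`_(e + d) = - y * c].
Proof.
move=> sw we e0 sA sB Fg -> /=; set F := A + _ in Fg *.
have sF : (size F <= d.+1)%N.
  rewrite /F (leq_trans (size_polyD _ _)) // geq_max sA mul_polyC.
  by rewrite (leq_trans (size_scale_leq _ _)).
have swF := size_interior_mul sw sF.
have cwF := coef_interior_mul sw sF.
have dle : (d.+1 <= e + d)%N by rewrite -add1n leq_add2r.
split.
- rewrite (leq_trans (size_polyD _ _)) // geq_max size_polyN swF andbT.
  by rewrite (leq_trans sA) // leqW.
- rewrite (leq_trans (size_polyD _ _)) // geq_max (leq_trans sB (leqW dle)) /=.
  by rewrite mulrAC mulrC mul_polyC (leq_trans (size_scale_leq _ _)).
- by rewrite coefB cwF we Fg nth_default ?sub0r ?mulNr // (leq_trans sA).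
- rewrite coefD mulrAC mulrC mul_polyC coefZ cwF we Fg nth_default ?add0r.
    by ring.
  by rewrite (leq_trans sB).
Qed.

(** [Y] is the exponential of the last point, or [0] for the empty chain; then
    the top coefficient [c (1 - Y / y)] of the value at the next point is nonzero. *)
Lemma pchain_lead l : admissible l ->
  exists d c Y, let s := pchain (1, 0) l in
  [/\ [/\ c != 0, 0 <= Y & forall x, 0 < x -> (forall t, t \in l -> t.1.1 < x) -> Y < x],
      (size s.1 <= d.+1)%N, (size s.2 <= d.+1)%N, s.1`_d = c & s.2`_d = - Y * c].
Proof.
elim/last_ind: l => [_|l t IH].
  exists 0%N, 1, 0; rewrite /=; split;
    rewrite ?size_poly1 ?size_poly0 ?coef1 ?coef0 ?oppr0 ?mul0r //=.
rewrite /admissible pairwise_rcons all_rcons.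
move=> /andP[/andP[/allP lt pw] /andP[/and3P[y0 v0 w0] al]].
have [|d [c [Y [[c0 Y0 Yx] sA sB cA cB]]]] := IH; first by apply/andP.
have [e [w' [e0 w'0 sw we]]] := wpoly_lead w0 v0.
have Yt : Y < t.1.1 by apply: Yx => // u /lt.
exists (e + d)%N, (- w' * (c * (1 - Y / t.1.1))), t.1.1.
rewrite /pchain foldl_rcons -/(pchain _ _) /pcross.
case: (pchain (1, 0) l) sA sB cA cB => A B /= sA sB cA cB.
have [] := @cross_lead A B t.1.1 w' _ (c * (1 - Y / t.1.1)) d e (wpoly t) sw we e0 sA sB _ erefl.
  by rewrite coefD coefCM cA cB; ring.
move=> h1 h2 h3 h4; split => //; split.
- rewrite mulf_neq0 ?oppr_eq0 // mulf_neq0 // subr_eq0 eq_sym.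
  by rewrite lt_eqF // ltr_pdivrMr // mul1r.
- exact: ltW.
- by move=> x x0; apply; rewrite mem_rcons mem_head.
Qed.

(** Mirror image of the preceding statement; [Y] is the inverse of the
    exponential of the first point, or [0] for the empty chain. *)
Lemma rchain_lead l : admissible l ->
  exists d c Y, let s := rchain (0, 1) l in
  [/\ c != 0 /\ (Y = 0 \/ exists2 t, t \in l & Y = t.1.1^-1),
      (size s.1 <= d.+1)%N, (size s.2 <= d.+1)%N, s.2`_d = c & s.1`_d = - Y * c].
Proof.
elim: l => [_|t l IH].
  exists 0%N, 1, 0; rewrite /=; split;
    rewrite ?size_poly1 ?size_poly0 ?coef1 ?coef0 ?oppr0 ?mul0r //=.
  by split; [rewrite oner_eq0|left].
rewrite /admissible /=.
move=> /andP[/andP[/allP lt pw] /andP[/and3P[y0 v0 w0] al]].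
have [|d [c [Y [[c0 Yx] sA sB cB cA]]]] := IH; first by apply/andP.
have [e [w' [e0 w'0 sw we]]] := wpoly_lead w0 v0.
have tn0 : t.1.1 != 0 by rewrite gt_eqF.
have Yt : Y * t.1.1 < 1.
  case: Yx => [->|[u /[dup] ul /lt tu ->]]; first by rewrite mul0r ltr01.
  by rewrite mulrC ltr_pdivrMr ?mul1r // (lt_trans y0).
exists (e + d)%N, (- t.1.1 * (w' * (c * (t.1.1^-1 - Y)))), t.1.1^-1.
rewrite /pcross_inv; case: (rchain (0, 1) l) sA sB cA cB => A B /= sA sB cA cB.
have sw' : (size (- wpoly t)%R <= e.+1)%N by rewrite size_polyN.
have [] := @cross_lead A B t.1.1 (- w') _ (c * (t.1.1^-1 - Y)) d e _ sw' _ e0 sA sB _ erefl.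
- by rewrite coefN we.
- by rewrite coefD coefCM cA cB; ring.
move=> h1 h2 h3 h4; split => //.
- split; last by right; exists t; rewrite ?mem_head.
  rewrite mulf_neq0 ?oppr_eq0 // mulf_neq0 // mulf_neq0 // subr_eq0 eq_sym.
  by rewrite lt_eqF // -(ltr_pM2r y0) mulVf.
- by rewrite h4; ring.
- by rewrite h3; field.
Qed.

(** With [Y] and [1 / Y'] the exponentials of the neighbouring points of the
    support, the limit of the Green function at [log x] is
    [(1 - Y / x) (1 - x Y') / (1 - Y Y')]. *)
Lemma split_lead l1 l2 x : admissible l1 -> admissible l2 -> 0 < x ->
  (forall t, t \in l1 -> t.1.1 < x) -> (forall t, t \in l2 -> x <= t.1.1) ->
  let A := (pchain (1, 0) l1).1 in let B := (pchain (1, 0) l1).2 in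
  let C := (rchain (0, 1) l2).1 in let D := (rchain (0, 1) l2).2 in
  let p := D + x%:P * C in let q := A + (x^-1)%:P * B in
  let W := D * A - C * B in
  exists m n, [/\ size W = (m + n).+1, (size p <= n.+1)%N, (size q <= m.+1)%N
    & 0 <= p`_n * q`_m * W`_(m + n)].
Proof.
move=> a1 a2 x0 h1 h2.
have [m [c [Y [[c0 Y0 Yx] sA sB cA cB]]]] := pchain_lead a1.
have [n [c' [Y' [[c'0 Yx'] sC sD cD cC]]]] := rchain_lead a2.
have {}Yx : Y < x by apply: Yx.
have [Y'0 Y'x] : 0 <= Y' /\ Y' * x <= 1.
  case: Yx' => [->|[t tl ->]]; first by rewrite mul0r ler01.
  have t0 : 0 < t.1.1 by apply: lt_le_trans (h2 _ tl).
  by rewrite invr_ge0 ltW // mulrC ler_pdivrMr // mul1r h2.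
case: (pchain (1, 0) l1) sA sB cA cB => A B /= sA sB cA cB.
case: (rchain (0, 1) l2) sC sD cC cD => C D /= sC sD cC cD.
set p := D + _; set q := A + _; set W := D * A - C * B.
have W_ : W`_(m + n) = c * c' * (1 - Y * Y').
  rewrite /W coefB addnC !coef_interior_mul // cA cB cC cD; ring.
have YY' : Y * Y' < 1.
  have [->|Y'n] := eqVneq Y' 0; first by rewrite mulr0.
  apply: lt_le_trans Y'x; rewrite [Y * _]mulrC ltr_pM2l //.
  by rewrite lt_neqAle eq_sym Y'n.
have W_0 : W`_(m + n) != 0 by rewrite W_ !mulf_neq0 // subr_eq0 eq_sym lt_eqF.
exists m, n; split.
- apply/eqP; rewrite eqn_leq; apply/andP; split.
    rewrite addnC (leq_trans (size_polyD _ _)) // geq_max size_polyN.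
    by rewrite !size_interior_mul.
  by rewrite ltnNge; apply: contra W_0 => /leq_sizeP ->.
- rewrite (leq_trans (size_polyD _ _)) // geq_max sD mul_polyC.
  by rewrite (leq_trans (size_scale_leq _ _)).
- rewrite (leq_trans (size_polyD _ _)) // geq_max sA mul_polyC.
  by rewrite (leq_trans (size_scale_leq _ _)).
- rewrite W_ /p /q !coefD !coefCM cA cB cC cD.
  have -> : (c' + x * (- Y' * c')) * (c + x^-1 * (- Y * c)) * (c * c' * (1 - Y * Y'))
   = (c * c') ^+ 2 * ((1 - Y' * x) * ((x - Y) / x) * (1 - Y * Y')).
    by field; rewrite gt_eqF.
  rewrite mulr_ge0 ?sqr_ge0 // mulr_ge0 //; last by rewrite subr_ge0 ltW.
  by rewrite mulr_ge0 ?subr_ge0 // divr_ge0 ?subr_ge0 // ltW.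
Qed.

Definition nth_mass l i := nth (0, 0, 0) l i.
Definition mass_value st l i : {poly R} :=
  let s := st in s.1 + ((nth_mass l i).1.1^-1)%:P * s.2.
(** Value of the solution decaying at minus infinity at the [i]-th point [x], up
    to the factor [e^{x/2}]. *)
Definition left_value l i := mass_value (pchain (1, 0) (take i l)) l i.
Definition right_value l i := mass_value (rchain (0, 1) (drop i l)) l i.

Lemma nth_mass_rcons l t i : (i < size l)%N -> nth_mass (rcons l t) i = nth_mass l i.
Proof. by move=> il; rewrite /nth_mass nth_rcons il. Qed.

Lemma left_value_rcons l t i : (i < size l)%N -> left_value (rcons l t) i = left_value l i.
Proof.
move=> il; rewrite /left_value /mass_value nth_mass_rcons //.
by rewrite -cats1 takel_cat // ltnW.
Qed.

Lemma left_value_last l t : left_value (rcons l t) (size l) =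
   (pchain (1, 0) l).1 + (t.1.1^-1)%:P * (pchain (1, 0) l).2.
Proof.
rewrite /left_value /mass_value /nth_mass nth_rcons ltnn eqxx.
by rewrite -cats1 take_size_cat.
Qed.

(** The Wronskian of a solution with its derivative in [z] changes at each mass
    by the squared value times the derivative of the strength. *)
Lemma christoffel_darboux l : positive l ->
  (pchain (1, 0) l).1 * (pchain (1, 0) l).2^`() -
  (pchain (1, 0) l).1^`() * (pchain (1, 0) l).2 =
  \sum_(0 <= i < size l)
    (nth_mass l i).1.1%:P * left_value l i ^+ 2 * (wpoly (nth_mass l i))^`().
Proof.
elim/last_ind: l => [_|l t IH]; first by rewrite big_nil /= !derivC mul0r mulr0 subrr.
rewrite /positive all_rcons => /andP[t0 lp]; rewrite size_rcons big_nat_recr //=.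
under eq_big_nat => i /andP[_ il] do rewrite nth_mass_rcons // left_value_rcons //.
rewrite -IH // left_value_last /nth_mass nth_rcons ltnn eqxx.
rewrite /pchain foldl_rcons -/(pchain _ _) /pcross.
case: (pchain (1, 0) l) => A B; rewrite /cross /=.
have yy := polyC_inv t0; set y := t.1.1%:P in yy *; set z := (t.1.1^-1)%:P in yy *.
have dy : y^`() = 0 by rewrite derivC.
have dz : z^`() = 0 by rewrite derivC.
move: (wpoly t) y z yy dy dz => w y z yy dy dz.
rewrite !(derivD, derivN, derivM) dy dz !(mulr0, mul0r, addr0, add0r).
set w' := w^`(); set A' := A^`(); set B' := B^`().
apply/eqP; rewrite -subr_eq0; apply/eqP.
transitivity ((y * z - 1) * (w * (A * B' - A' * B) - w' * (A + z * B) * B));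
  last by rewrite yy subrr mul0r.
ring.
Qed.

(** The left side is [f f'] plus the contribution of the masses, that is the
    integral of [f'^2 + f^2 / 4] up to [log x]. *)
Lemma energy_gt0 l (r : R) x : admissible l -> 0 < x -> (forall t, t \in l -> t.1.1 <= x) ->
  0 < ((pchain (1, 0) l).1.[r] ^+ 2 * x - (pchain (1, 0) l).2.[r] ^+ 2 / x) / 2
     + \sum_(0 <= i < size l)
        (wpoly (nth_mass l i)).[r] * (nth_mass l i).1.1 * (left_value l i).[r] ^+ 2.
Proof.
elim/last_ind: l x => [x _ x0 _|l t IH x].
  by rewrite big_nil /= !hornerE expr0n mul0r subr0 expr1n mul1r; lra.
move=> adm x0 lx; have tx : t.1.1 <= x by apply: lx; rewrite mem_rcons mem_head.
move: adm; rewrite /admissible pairwise_rcons all_rcons.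
move=> /andP[/andP[/allP lt pw] /andP[/and3P[y0 v0 w0] al]].
have al' : admissible l by apply/andP.
have := IH _ al' y0 (fun u ul => ltW (lt u ul)).
rewrite size_rcons [in X in _ -> X]big_nat_recr //= .
under [in X in _ -> X]eq_big_nat => i /andP[_ il]
  do rewrite nth_mass_rcons // left_value_rcons //.
rewrite left_value_last /nth_mass nth_rcons ltnn eqxx.
rewrite /pchain foldl_rcons -/(pchain _ _) /pcross.
case: (pchain (1, 0) l) => A B; rewrite /cross /=.
set S := \sum_(0 <= i < _) _; move: (wpoly t) => wt.
rewrite !(hornerD, hornerN, hornerM, hornerC).
set a := A.[r]; set b := B.[r]; set y := t.1.1 in y0 tx *; set w := wt.[r].
move=> h; pose a' := a - w * (a + y^-1 * b); pose b' := b + w * y * (a + y^-1 * b).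
rewrite -/a' -/b'.
have h1 : (a' ^+ 2 * y - b' ^+ 2 / y) / 2 + (S + w * y * (a + y^-1 * b) ^+ 2) =
   (a ^+ 2 * y - b ^+ 2 / y) / 2 + S.
  by rewrite /a' /b'; field; rewrite gt_eqF.
rewrite -h1 in h; apply: (lt_le_trans h); rewrite lerD2r ler_pM2r ?invr_gt0 //.
apply: lerB; first by rewrite ler_wpM2l ?sqr_ge0.
by rewrite ler_wpM2l ?sqr_ge0 // lef_pV2.
Qed.

Lemma pchain_cat s l1 l2 : pchain s (l1 ++ l2) = pchain (pchain s l1) l2.
Proof. exact: foldl_cat. Qed.

Lemma eigen_proportional l1 l2 (r : R) : positive l2 ->
  let W := (pchain (1, 0) (l1 ++ l2)).1 in let b := (pchain (1, 0) (l1 ++ l2)).2 in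
  W.[r] = 0 ->
  (pchain (1, 0) l1).1.[r] = b.[r] * (rchain (0, 1) l2).1.[r]
  /\ (pchain (1, 0) l1).2.[r] = b.[r] * (rchain (0, 1) l2).2.[r].
Proof.
move=> p2 W b Wr.
have := pchainK (pchain (1, 0) l1) p2; rewrite -pchain_cat rchain_lin -/W -/b.
by case: (pchain (1, 0) l1) => A B [<- <-]; rewrite !hornerD !hornerM Wr !mul0r !add0r.
Qed.

Lemma wronskian_split l1 l2 : positive l2 ->
  (pchain (1, 0) (l1 ++ l2)).1 =
  (rchain (0, 1) l2).2 * (pchain (1, 0) l1).1
  - (rchain (0, 1) l2).1 * (pchain (1, 0) l1).2.
Proof.
move=> p2; have := pchain_det (pchain (1, 0) l1) (rchain (0, 1) l2) p2.
rewrite -pchain_cat rchainK // /det /= mulr1 mulr0 subr0 => ->.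
by rewrite mulrC [in X in _ - X]mulrC.
Qed.

(** [g] is [gamma^2].  The formula for [W'] is the Christoffel-Darboux formula at
    a zero of [W], where the left solution is [b] times the right one.  The sign
    comes from the energy beyond the last mass, where [f f' <= 0]; adding
    [r^2] times the integral of [f^2] against [v] turns the energy into [r g]. *)
Lemma chain_eigen l (r : R) : admissible l -> (pchain (1, 0) l).1.[r] = 0 ->
  let g := \sum_(0 <= i < size l) ((nth_mass l i).1.2 + 2 * r * (nth_mass l i).2)
             * ((nth_mass l i).1.1 * (right_value l i).[r] ^+ 2) in
  [/\ (pchain (1, 0) l).2.[r] != 0,
      (pchain (1, 0) l).1^`().[r] = - (pchain (1, 0) l).2.[r] * g & 0 < r * g].
Proof.
move=> adm Wr g; have lp := admissible_positive adm.
set b := (pchain (1, 0) l).2.[r].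
have prop i : (i < size l)%N -> (left_value l i).[r] = b * (right_value l i).[r].
  move=> il; have pd : positive (drop i l).
    by apply/allP => t /mem_drop; exact: (allP lp).
  have := @eigen_proportional (take i l) (drop i l) r pd.
  rewrite cat_take_drop => /(_ Wr) [h1 h2].
  rewrite /left_value /right_value /mass_value !hornerD !hornerM !hornerC h1 h2 -/b.
  by ring.
(* A point beyond all masses. *)
have [x x0 lx] : exists2 x : R, 0 < x & forall t, t \in l -> t.1.1 <= x.
  exists (1 + \sum_(t <- l) `|t.1.1|).
    by rewrite ltr_pwDl // sumr_ge0.
  move=> t tl; rewrite (le_trans (ler_norm _)) // (big_rem t) //= addrCA lerDl.
  by rewrite addr_ge0 ?ler01 // sumr_ge0.
have wE t : (wpoly t).[r] = r * (t.1.2 + r * t.2).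
  by rewrite /wpoly hornerD !hornerZ horner_exp hornerX; ring.
have en := energy_gt0 r adm x0 lx.
rewrite Wr expr0n mul0r sub0r -/b in en.
have b2 : 0 <= b ^+ 2 / x by rewrite divr_ge0 ?sqr_ge0 // ltW.
set S := \sum_(0 <= i < size l) _ in en.
have S0 : 0 < S by move: en b2; set u := b ^+ 2 / x; lra.
pose G := \sum_(0 <= i < size l) (wpoly (nth_mass l i)).[r]
   * ((nth_mass l i).1.1 * (right_value l i).[r] ^+ 2).
have SG : S = b ^+ 2 * G.
  rewrite /S /G mulr_sumr !big_nat; apply: eq_bigr => i /andP[_ il].
  by rewrite prop //; ring.
have b0 : b != 0 by apply: contraTneq S0 => b0; rewrite SG b0 expr0n mul0r ltxx.
have G0 : 0 < G by move: S0; rewrite SG pmulr_rgt0 // exprn_even_gt0.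
split => //.
- have := congr1 (fun p => p.[r]) (christoffel_darboux lp).
  rewrite hornerD hornerN !hornerM Wr mul0r sub0r -/b => /eqP.
  rewrite horner_sum eqr_oppLR => /eqP h; apply: (mulIf b0); rewrite h /g.
  rewrite mulNr mulNr mulr_sumr mulr_suml; congr (- _).
  rewrite !big_nat; apply: eq_bigr => i /andP[_ il].
  rewrite hornerM hornerM horner_exp hornerC prop //.
  have -> : (wpoly (nth_mass l i))^`().[r] =
     (nth_mass l i).1.2 + 2 * r * (nth_mass l i).2.
    rewrite /wpoly derivD !derivZ derivXn derivX hornerD !hornerZ hornerC /= expr1.
    by rewrite hornerMn hornerX; ring.
  by ring.
- rewrite (_ : r * g = G + r ^+ 2 * \sum_(0 <= i < size l) (nth_mass l i).2
       * ((nth_mass l i).1.1 * (right_value l i).[r] ^+ 2)); last first.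
    rewrite /g /G !mulr_sumr -big_split /=; apply: eq_bigr => i _.
    by rewrite wE; ring.
  apply: ltr_pwDl => //; rewrite mulr_ge0 ?sqr_ge0 // big_nat sumr_ge0 // => i /andP[_ il].
  have il' : nth_mass l i \in l by rewrite mem_nth.
  case/andP: adm => _ /allP /(_ _ il') /and3P[y0 v0 _].
  by rewrite mulr_ge0 // mulr_ge0 ?sqr_ge0 // ltW.
Qed.

End Direct.

(** * Distributing the zeros of the Green function *)

Section LinearFactors.
Variable R : fieldType.
Implicit Types (I : finType) (z : R).

Definition lin z : {poly R} := 1 - z^-1 *: 'X.

Lemma linE z : z != 0 -> lin z = - z^-1 *: ('X - z%:P).
Proof.
move=> z0; rewrite /lin scalerBr scaleNr -mul_polyC scaleNr -mul_polyC -polyCM.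
by rewrite mulVf // opprK addrC.
Qed.

Lemma lin_at0 z : (lin z).[0] = 1.
Proof. by rewrite /lin hornerD hornerN hornerZ hornerX hornerC mulr0 subr0. Qed.

Lemma prod_lin_at0 I (A : {pred I}) (F : I -> R) : (\prod_(i in A) lin (F i)).[0] = 1.
Proof. by rewrite horner_prod big1 // => i _; rewrite lin_at0. Qed.

Lemma prod_lin_split I (A : {pred I}) (F : I -> R) : (forall i, F i != 0) ->
  exists2 c, c != 0 & \prod_(i in A) lin (F i) = c *: \prod_(i in A) ('X - (F i)%:P).
Proof.
move=> F0; exists (\prod_(i in A) - (F i)^-1).
  by apply/prodf_neq0 => i _; rewrite oppr_eq0 invr_eq0.
by rewrite -scaler_prod; apply: eq_bigr => i _; rewrite linE.
Qed.

Lemma size_prod_lin I (A : {pred I}) (F : I -> R) : (forall i, F i != 0) ->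
  size (\prod_(i in A) lin (F i)) = #|A|.+1.
Proof.
move=> F0; have [c c0 ->] := prod_lin_split A F0.
by rewrite size_scale // -big_enum size_prod_XsubC cardE.
Qed.

Lemma prod_lin_neq0 I (A : {pred I}) (F : I -> R) : (forall i, F i != 0) ->
  \prod_(i in A) lin (F i) != 0.
Proof. by move=> F0; rewrite -size_poly_eq0 size_prod_lin. Qed.

Lemma root_prod_lin I (A : {pred I}) (F : I -> R) x : (forall i, F i != 0) ->
  root (\prod_(i in A) lin (F i)) x = [exists i in A, F i == x].
Proof.
move=> F0; have [c c0 ->] := prod_lin_split A F0; rewrite rootZ // -big_enum.
rewrite -(big_map F predT (fun z => 'X - z%:P)) root_prod_XsubC.
apply/mapP/existsP => [[j jA ->]|[j /andP[jA /eqP <-]]].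
  by exists j; rewrite eqxx andbT -mem_enum.
by exists j; rewrite ?mem_enum.
Qed.

(** Unique factorisation; the normalisation at [0] removes the constant. *)
Lemma dvd_prod_lin I (F : I -> R) (p q : {poly R}) : (forall i, F i != 0) ->
  p.[0] = 1 -> p * q = \prod_i lin (F i) ->
  exists A : {set I}, p = \prod_(i in A) lin (F i).
Proof.
move=> F0 p0 pq; have [c c0 Ec] := prod_lin_split predT F0.
have pd : p %| \prod_(i <- index_enum I) ('X - (F i)%:P).
  rewrite -(dvdpZr _ _ c0) (_ : _ *: _ = \prod_i lin (F i)); last by rewrite Ec.
  by rewrite -pq dvdp_mulIl.
have [m pm] := dvdp_prod_XsubC pd.
pose A := [set i in mask m (index_enum I)]; exists A.
have [d d0 Ed] := prod_lin_split A F0.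
have mE : \prod_(i <- mask m (index_enum I)) ('X - (F i)%:P) = \prod_(i in A) ('X - (F i)%:P).
  rewrite big_uniq ?mask_uniq ?index_enum_uniq //=.
  by apply: eq_bigl => i; rewrite inE.
move: pm; rewrite mE => /eqpP[[u v] /= /andP[u0 v0] E].
have {}E : p = (u^-1 * v * d^-1) *: \prod_(i in A) lin (F i).
  rewrite Ed scalerA divfK // -scalerA -E scalerA mulVf // scale1r.
  by [].
move: p0; rewrite E hornerZ prod_lin_at0 mulr1 => ->.
by rewrite scale1r.
Qed.

Lemma dvd_roots I (A : {set I}) (F : I -> R) (p : {poly R}) :
  injective F -> (forall i, F i != 0) -> (forall i, i \in A -> p.[F i] = 0) ->
  exists q, p = (\prod_(i in A) lin (F i)) * q.
Proof.
move=> inj F0 H; have [c c0 ->] := prod_lin_split A F0.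
have [||q ->] := @uniq_roots_prod_XsubC _ p [seq F i | i <- enum A].
- by apply/allP => y /mapP[j + ->]; rewrite mem_enum => /H Fj; apply/eqP.
- by rewrite uniq_rootsE map_inj_uniq ?enum_uniq.
exists (c^-1 *: q); rewrite big_map big_enum /= -scalerAl -scalerAr scalerA.
by rewrite mulfV // scale1r mulrC.
Qed.

End LinearFactors.

Section Factorizations.
Variables (R : rcfType) (N : nat) (lam : 'I_N -> R).
Hypothesis lam_inj : injective lam.
Hypothesis lam0 : forall i, lam i != 0.
Hypothesis N0 : (0 < N)%N.
Local Notation W := (charpoly lam).
(** [x i] is the squared modulus of the [i]-th normalised eigenfunction at the
    interior point, [K] the set of shared eigenvalues. *)
Variable x : 'I_N -> R.
Let K := [set i | x i == 0].
Local Notation k := #|K|.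

Definition green_coef0 := 1 - \sum_(i < N) x i.
Definition green_coef1 := - \sum_(i < N) lam i * x i.

Variables (mu0 : 'I_N -> R) (n0 : nat) (p0 q0 : {poly R}).
Hypothesis mu0_gt0 : forall i, 0 < mu0 i.
Hypothesis ip0 : interior_pair lam mu0 n0 p0 q0.
Hypothesis xE : forall i, x i = mu0 i * p0.[lam i] ^+ 2.

Let g0 := p0 * q0.
Let nK := \prod_(i in K) lin (lam i).
Let nC := \prod_(i in ~: K) lin (lam i).

Lemma interior_mul mu n p q : interior_pair lam mu n p q ->
  [/\ (size (p * q)%R <= N.+1)%N, (p * q).[0] = 1, 0 <= (p * q)`_N * W`_N
    & forall i, (p * q).[lam i] = - (lam i * W^`().[lam i]) * (mu i * p.[lam i] ^+ 2)].
Proof.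
move=> [[nN sp sq] p1 q1 pos pq]; split.
- by have := size_interior_mul sp sq; rewrite subnKC.
- by rewrite hornerM p1 q1 mulr1.
- by have := coef_interior_mul sp sq; rewrite subnKC // => ->.
- by move=> i; rewrite hornerM pq; ring.
Qed.

Lemma x_ge0 i : 0 <= x i.
Proof. by rewrite xE mulr_ge0 ?sqr_ge0 // ltW. Qed.

Lemma g0_lam i : g0.[lam i] = - (lam i * W^`().[lam i]) * x i.
Proof. by have [_ _ _ ->] := interior_mul ip0; rewrite xE. Qed.

Lemma charpolyE : W = nK * nC.
Proof.
rewrite /charpoly (bigID (mem K)) /=; congr (_ * _); apply: eq_bigl => i.
by rewrite finset.in_setC.
Qed.

(** The [N + 1] nodes are the eigenvalues and [0]. *)
Lemma poly_interpolation (f g : {poly R}) : (size f <= N.+1)%N -> (size g <= N.+1)%N ->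
  f.[0] = g.[0] -> (forall i, f.[lam i] = g.[lam i]) -> f = g.
Proof.
move=> sf sg e0 el; apply/eqP; rewrite -subr_eq0; apply/eqP.
apply: (roots_geq_poly_eq0 (rs := 0 :: lamseq lam)).
- rewrite /= rootE hornerD hornerN e0 subrr eqxx /=.
  apply/allP => r /mapP[i _ ->].
  by rewrite rootE hornerD hornerN el subrr.
- rewrite /= lamseq_uniq // andbT; apply/negP => /mapP[i _ h].
  by have := lam0 i; rewrite -h eqxx.
- by rewrite /= size_lamseq (leq_trans (size_polyD _ _)) // size_polyN geq_max sf sg.
Qed.

(** [p q] is prescribed at the eigenvalues and at [0]. *)
Lemma interior_mulE mu n p q : interior_pair lam mu n p q ->
  (forall i, x i = mu i * p.[lam i] ^+ 2) -> p * q = g0.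
Proof.
move=> ip xE'; have [s1 z1 _ l1] := interior_mul ip; have [s2 z2 _ _] := interior_mul ip0.
apply: poly_interpolation => //; first by rewrite z1 z2.
by move=> i; rewrite l1 -xE' g0_lam.
Qed.

Lemma interior_factor mu n p q : (forall i, 0 < mu i) -> interior_pair lam mu n p q ->
  (forall i, x i = mu i * p.[lam i] ^+ 2) ->
  exists p1 q1, [/\ p = nK * p1, q = nK * q1, p1.[0] = 1 & nK ^+ 2 * (p1 * q1) = g0].
Proof.
move=> mu_gt0 ip xE'; have [_ pz qz _ pq] := ip.
have pK i : i \in K -> p.[lam i] = 0.
  rewrite inE xE' mulf_eq0 gt_eqF //= sqrf_eq0 => /eqP.
  by [].
have [p1 Ep] := dvd_roots lam_inj lam0 pK.
have [q1 Eq] : exists q1, q = nK * q1.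
  by apply: dvd_roots => // i iK; rewrite pq pK // mulr0.
exists p1, q1; split => //.
  by move: pz; rewrite Ep hornerM prod_lin_at0 mul1r.
by rewrite -(interior_mulE ip xE') Ep Eq -/nK; ring.
Qed.

Lemma card_shared_le : (k <= N)%N.
Proof. by have := max_card (mem K); rewrite card_ord. Qed.

Lemma size_cofactors : size nK = k.+1 /\ size nC = (N - k).+1.
Proof.
rewrite /nK /nC !size_prod_lin //; split => //.
by congr _.+1; apply: (@addnI k); rewrite subnKC ?card_shared_le // cardsC card_ord.
Qed.

(** After one factor [nK] is cancelled in [z g0 / W] a Herglotz function [E / nC]
    is left, so [E = X nK g2] has simple real roots.  The bound on [size Z] holds
    because a Herglotz function decays at most like [1 / z]. *)
Lemma zeros_between : exists Z : seq R,
  [/\ uniq Z, forall z, z \in Z -> z != 0,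
      g0 = nK ^+ 2 * \prod_(j < size Z) lin (tnth (in_tuple Z) j)
    & (N <= 2 * k + size Z + 2)%N].
Proof.
have [p1 [q1 [_ _ _ g2E]]] := interior_factor mu0_gt0 ip0 xE.
set g2 := p1 * q1 in g2E; pose E := 'X * nK * g2.
have [sg g00 gpos _] := interior_mul ip0; rewrite -/g0 in sg g00 gpos.
have [sK sC] := size_cofactors.
have nK0 : nK != 0 by exact: prod_lin_neq0.
have nC0 : nC != 0 by exact: prod_lin_neq0.
have g0n0 : g0 != 0 by apply: contra_eq_neq g00 => ->; rewrite horner0 eq_sym oner_eq0.
have g2n0 : g2 != 0 by apply: contraNneq g0n0 => g20; rewrite -g2E g20 mulr0.
have En0 : E != 0 by rewrite /E; do 2 (apply: mulf_neq0 => //); rewrite polyX_eq0.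
(* Coefficients and values of [E] are obtained from those of [g0] through this
   identity, since [nK] is nonzero at the remaining eigenvalues. *)
have nKE : nK * E = 'X * g0 by rewrite /E -g2E; ring.
have lamC i : i \in ~: K -> nK.[lam i] != 0.
  move=> iK; rewrite -rootE root_prod_lin //; apply/existsP => -[j /andP[jK /eqP /lam_inj ji]].
  by move: iK; rewrite inE -ji jK.
have nK_k : nK`_k = lead_coef nK by rewrite lead_coefE sK.
have nC_k : nC`_(N - k) = lead_coef nC by rewrite lead_coefE sC.
have sE : (size E <= (N - k).+2)%N.
  have := size_mul nK0 En0; rewrite nKE sK addSn /= mulrC size_mulX // => h.
  by rewrite -(leq_add2l k) -h !addnS subnKC ?card_shared_le // ltnS.
have WN : W`_N = nK`_k * nC`_(N - k).
  have := @coef_interior_mul R k (N - k) nK nC; rewrite sK sC !leqnn subnKC ?card_shared_le //.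
  by rewrite -charpolyE; apply.
have gN : nK`_k * E`_(N - k).+1 = g0`_N.
  have := @coef_interior_mul R k (N - k).+1 nK E; rewrite sK leqnn sE => /(_ isT isT) <-.
  by rewrite nKE addnS subnKC ?card_shared_le // coefXM.
have h : herglotz E nC.
  have [c c0 Ec] := prod_lin_split (~: K) lam0.
  have lc : lead_coef nC = c.
    by rewrite /nC Ec lead_coefZ (monicP (monic_prod _ _)) ?mulr1 // => i _; exact: monicXsubC.
  split => //.
  - exists [seq lam i | i <- enum (~: K)]; first by rewrite map_inj_uniq ?enum_uniq.
    by rewrite lc big_map big_enum /= -Ec.
  - move=> r; rewrite root_prod_lin // => /existsP[i /andP[iK /eqP <-]].
    have W' : W^`().[lam i] = nK.[lam i] * nC^`().[lam i].
      rewrite charpolyE derivM hornerD !hornerM.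
      have -> : nC.[lam i] = 0.
        by apply/eqP; rewrite -rootE root_prod_lin //; apply/existsP; exists i; rewrite iK eqxx.
      by rewrite mulr0 add0r.
    have W'0 := charpoly_deriv lam_inj lam0 i; rewrite W' mulf_eq0 negb_or in W'0.
    have [_ nC'0] := andP W'0.
    have : nK.[lam i] * E.[lam i] = nK.[lam i] * (- (lam i ^+ 2 * x i) * nC^`().[lam i]).
      rewrite -hornerM nKE hornerM hornerX g0_lam W'.
      by set u := nK.[lam i]; set v := nC^`().[lam i]; move: u v (lam i) (x i) => u v a b; ring.
    move/(mulfI (lamC i iK)) => ->.
    have xi : 0 < x i by rewrite lt_neqAle x_ge0 andbT eq_sym; move: iK; rewrite !inE.
    rewrite [X in X < 0](_ : _ = - ((lam i * nC^`().[lam i]) ^+ 2 * x i)); last first.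
      by set v := nC^`().[lam i]; move: v (lam i) (x i) => v a b; ring.
    by rewrite oppr_lt0 mulr_gt0 // exprn_even_gt0 //= mulf_neq0.
  - by rewrite sC.
  - rewrite sC -nC_k.
    have kn0 : nK`_k != 0 by rewrite nK_k lead_coef_eq0.
    rewrite [X in 0 <= X](_ : _ = g0`_N * W`_N / nK`_k ^+ 2); last by rewrite -gN WN; field.
    by rewrite divr_ge0 // sqr_ge0.
have [_ [es ues EE] _ szC _] := herglotz_inv h En0.
have E0 e : e \in es -> E.[e] = 0.
  by move=> ee; apply/eqP; rewrite -rootE EE rootZ ?lead_coef_eq0 // root_prod_XsubC.
have rtE e : root E e = (e \in es) by rewrite (horner_split_root En0 EE).
pose rsK := 0 :: [seq lam i | i <- enum K].
pose Z := [seq e <- es | e \notin rsK].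
have rsK_uniq : uniq rsK.
  rewrite /= map_inj_uniq ?enum_uniq // andbT; apply/negP => /mapP[i _ h0].
  by have := lam0 i; rewrite -h0 eqxx.
have perm_es : perm_eq es (rsK ++ Z).
  apply: uniq_perm => //.
    rewrite cat_uniq rsK_uniq filter_uniq // andbT; apply/hasPn => e.
    by rewrite mem_filter => /andP[].
  move=> e; rewrite mem_cat mem_filter; case: (boolP (e \in rsK)) => //= eK.
  rewrite -rtE /E !rootM; move: eK; rewrite inE => /predU1P[->|/mapP[i iK ->]].
    by rewrite rootX eqxx.
  rewrite mem_enum in iK; apply/orP; left; apply/orP; right.
  by rewrite root_prod_lin //; apply/existsP; exists i; rewrite iK eqxx.
have uZ : uniq Z by rewrite filter_uniq.
have Z0 z : z \in Z -> z != 0.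
  by rewrite mem_filter inE negb_or => /andP[/andP[]].
have [c c0 EcK] := prod_lin_split K lam0.
have g2Z : g2 = (lead_coef E * c^-1) *: \prod_(z <- Z) ('X - z%:P).
  have XK0 : 'X * nK != 0 by rewrite mulf_neq0 ?polyX_eq0.
  apply: (mulfI XK0); rewrite -[LHS]/E {1}EE (perm_big _ perm_es) big_cat big_cons /=.
  rewrite subr0 big_map big_enum /= /nK EcK -!mul_polyC polyCM.
  have cc : c%:P * (c^-1)%:P = 1 :> {poly R} by rewrite -polyCM mulfV.
  set A := \prod_(i in K) _; set B := \prod_(z <- Z) _.
  transitivity ((lead_coef E)%:P * ('X * A * B) * (c%:P * (c^-1)%:P)); last by ring.
  by rewrite cc mulr1.
pose F (j : 'I_(size Z)) := tnth (in_tuple Z) j.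
have F0 j : F j != 0 by apply: Z0; exact: mem_tnth.
have [d d0 Ed] := prod_lin_split predT F0.
have bigZ : \prod_(z <- Z) ('X - z%:P) = \prod_j ('X - (F j)%:P).
  by rewrite (big_tnth _ _ Z).
have g2F : g2 = \prod_(j < size Z) lin (F j).
  have -> : \prod_(j < size Z) lin (F j) = d *: \prod_j ('X - (F j)%:P) by exact: Ed.
  have : g2 = (lead_coef E / c / d) *: \prod_j lin (F j).
    have -> : \prod_(j < size Z) lin (F j) = d *: \prod_j ('X - (F j)%:P) by exact: Ed.
    by rewrite scalerA divfK // g2Z bigZ.
  move=> g2E'; have g20 : g2.[0] = 1.
    have := congr1 (fun p => p.[0]) g2E; rewrite /g0 hornerM horner_exp prod_lin_at0.
    by rewrite expr1n mul1r => ->.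
  move: g20; rewrite g2E' hornerZ.
  have -> : (\prod_j lin (F j)).[0] = 1 by exact: (prod_lin_at0 predT).
  rewrite mulr1 => ->; rewrite scale1r; exact: Ed.
exists Z; split => //; first by rewrite -g2E g2F.
have sZ : size E = (1 + k + size Z).+1.
  rewrite EE size_scale ?lead_coef_eq0 // size_prod_XsubC (perm_size perm_es).
  by rewrite size_cat /= size_map -cardE add1n.
move: szC; rewrite size_polyN sC sZ; have := card_shared_le.
by move: (#|K|) (size Z) => c' d'; clear; lia.
Qed.


Section Subsets.
Variable Z : seq R.
Hypothesis Z_uniq : uniq Z.
Hypothesis Z0 : forall z, z \in Z -> z != 0.
Hypothesis g0Z : g0 = nK ^+ 2 * \prod_(j < size Z) lin (tnth (in_tuple Z) j).
Hypothesis Z_large : (N <= 2 * k + size Z + 2)%N.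
Local Notation zero j := (tnth (in_tuple Z) j).
Implicit Types A : {set 'I_(size Z)}.

(** The choice of [A] decides which of the zeros that are not shared lie to the
    right of the interior point. *)
Definition subfactor A : {poly R} :=
  (\prod_(i in K) lin (lam i)) * \prod_(j in A) lin (zero j).

Lemma zero_neq0 j : zero j != 0.
Proof. by apply: Z0; exact: mem_tnth. Qed.

Lemma size_g0 : size g0 = (2 * k + size Z).+1.
Proof.
have nK0 : nK != 0 by exact: prod_lin_neq0.
have sZ := size_prod_lin predT zero_neq0.
have Zn0 : \prod_(j < size Z) lin (zero j) != 0 by exact: (prod_lin_neq0 predT zero_neq0).
have sZ' : size (\prod_(j < size Z) lin (zero j)) = (size Z).+1.
  by rewrite [LHS]sZ card_ord.
have [sK _] := size_cofactors.
rewrite g0Z size_mul ?expf_neq0 // sZ' expr2 size_mul // sK.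
by rewrite !addnS /= !addSn /= mul2n -addnn.
Qed.

Lemma subfactorM A : subfactor A * subfactor (~: A) = g0.
Proof.
rewrite g0Z /subfactor -/nK (bigID (mem A) predT) /=.
have -> : \prod_(j in ~: A) lin (zero j) = \prod_(j | j \notin A) lin (zero j).
  by apply: eq_bigl => j; rewrite inE.
by ring.
Qed.

Lemma subfactor_at0 A : (subfactor A).[0] = 1.
Proof. by rewrite /subfactor hornerM !prod_lin_at0 mulr1. Qed.

Lemma size_subfactor A : size (subfactor A) = (k + #|A|).+1.
Proof.
have [sK _] := size_cofactors.
rewrite /subfactor size_mul ?prod_lin_neq0 //; last exact: zero_neq0.
by rewrite -/nK sK size_prod_lin ?addnS //; exact: zero_neq0.
Qed.

Lemma subfactor_K A i : i \in K -> (subfactor A).[lam i] = 0.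
Proof.
move=> iK; rewrite /subfactor hornerM (_ : _.[lam i] = 0) ?mul0r //.
by apply/eqP; rewrite -rootE root_prod_lin //; apply/existsP; exists i; rewrite iK eqxx.
Qed.

Lemma subfactor_C A i : i \notin K -> (subfactor A).[lam i] != 0.
Proof.
move=> iK; have : g0.[lam i] != 0.
  rewrite g0_lam mulf_neq0 ?oppr_eq0 ?mulf_neq0 ?charpoly_deriv //.
  by move: iK; rewrite inE.
by rewrite -(subfactorM A) hornerM mulf_eq0 negb_or => /andP[].
Qed.

Lemma zeros_le : (2 * k + size Z <= N)%N.
Proof. by have [+ _ _ _] := interior_mul ip0; rewrite -/g0 size_g0. Qed.

Lemma subfactor_interior A mu :
  (forall i, i \notin K -> x i = mu i * (subfactor A).[lam i] ^+ 2) ->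
  interior_pair lam mu (k + #|A|) (subfactor A) (subfactor (~: A)).
Proof.
move=> xA; have cA : (#|A| + #|~: A| = size Z)%N by rewrite cardsC card_ord.
have kA : (k + #|A| + (k + #|~: A|) <= N)%N.
  by rewrite (leq_trans _ zeros_le) // addnACA cA mul2n -addnn.
have kN : (k + #|A| <= N)%N by apply: leq_trans kA; exact: leq_addr.
have sq : (size (subfactor (~: A)) <= (N - (k + #|A|)).+1)%N.
  by rewrite size_subfactor ltnS leq_subRL.
split.
- by split => //; rewrite size_subfactor.
- exact: subfactor_at0.
- exact: subfactor_at0.
- have [_ _ pos _] := interior_mul ip0.
  have := @coef_interior_mul R (k + #|A|) (N - (k + #|A|)) (subfactor A) (subfactor (~: A)).
  by rewrite size_subfactor leqnn => /(_ isT sq) <-; rewrite subfactorM subnKC.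
- move=> i; case: (boolP (i \in K)) => iK.
    by rewrite !subfactor_K // mulr0.
  apply: (mulfI (subfactor_C A iK)); rewrite -hornerM subfactorM g0_lam xA //.
  by ring.
Qed.

Lemma interior_subfactor mu n p q : (forall i, 0 < mu i) -> interior_pair lam mu n p q ->
  (forall i, x i = mu i * p.[lam i] ^+ 2) -> exists A, p = subfactor A.
Proof.
move=> mu_gt0 ip xE'; have [p1 [q1 [Ep _ p10 E]]] := interior_factor mu_gt0 ip xE'.
have nK0 : nK != 0 by exact: prod_lin_neq0.
have nK20 : nK ^+ 2 != 0 by rewrite expf_neq0.
have pq1 : p1 * q1 = \prod_j lin (zero j).
  by apply: (mulfI nK20); rewrite E g0Z.
have [A EA] := dvd_prod_lin zero_neq0 p10 pq1.
by exists A; rewrite Ep EA.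
Qed.

(** Two subsets with equal squares yield interior pairs for the same weights,
    chosen to be [1] on [K]. *)
Lemma subfactor_inj A A' :
  (forall i, i \notin K -> (subfactor A).[lam i] ^+ 2 = (subfactor A').[lam i] ^+ 2) ->
  A = A'.
Proof.
move=> sqE.
pose mu i := if i \in K then 1 else x i / (subfactor A).[lam i] ^+ 2.
have mu_gt0 i : 0 < mu i.
  rewrite /mu; case: ifP => // /negbT iK; rewrite divr_gt0 //.
    by rewrite lt_neqAle x_ge0 andbT eq_sym; move: iK; rewrite inE.
  by rewrite exprn_even_gt0 //= subfactor_C.
have h : interior_pair lam mu (k + #|A|) (subfactor A) (subfactor (~: A)).
  apply: subfactor_interior => i iK; rewrite /mu (negbTE iK) divfK //.
  by rewrite expf_neq0 // subfactor_C.
have h' : interior_pair lam mu (k + #|A'|) (subfactor A') (subfactor (~: A')).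
  apply: subfactor_interior => i iK; rewrite /mu (negbTE iK) -sqE // divfK //.
  by rewrite expf_neq0 // subfactor_C.
have E := interior_unique lam_inj lam0 N0 mu_gt0 h h'.
have nK0 : nK != 0 by exact: prod_lin_neq0.
have {}E : \prod_(j in A) lin (zero j) = \prod_(j in A') lin (zero j).
  exact: (mulfI nK0).
have zinj : injective (fun j : 'I_(size Z) => zero j).
  move=> i j /=; rewrite !(tnth_nth 0) /= => /eqP; rewrite nth_uniq //.
  by move=> /eqP /val_inj.
apply/setP => j; have := congr1 (fun p => root p (zero j)) E => /=.
rewrite !root_prod_lin; try exact: zero_neq0.
have mem B : [exists i in B, zero i == zero j] = (j \in B).
  apply/existsP/idP => [[i' /andP[iB /eqP /zinj <-]] //|jB].
  by exists j; rewrite jB eqxx.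
by rewrite !mem.
Qed.

Lemma green_coef0E : green_coef0 = g0`_N / W`_N.
Proof.
have [sg gz _ _] := interior_mul ip0.
have := sum_residues0 lam_inj lam0 N0 sg; rewrite gz -/g0 => E.
rewrite /green_coef0; apply/eqP; rewrite subr_eq addrC -subr_eq -[X in _ == X]opprK -sumrN.
rewrite eq_sym eqr_oppLR opprB -E eq_sym; apply/eqP; apply: eq_bigr => i _.
by rewrite g0_lam; field; rewrite charpoly_deriv ?lam0.
Qed.

Lemma green_coef1E : green_coef0 = 0 -> green_coef1 = g0`_N.-1 / W`_N.
Proof.
rewrite green_coef0E => /eqP; rewrite mulf_eq0 invr_eq0 (negbTE (charpoly_coefN_neq0 lam0)) orbF.
move=> /eqP gN; have [sg _ _ _] := interior_mul ip0; rewrite -/g0 in sg.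
have sg' : (size g0 <= N)%N.
  apply/leq_sizeP => j; rewrite leq_eqVlt => /predU1P[<-//|Nj].
  by rewrite nth_default // (leq_trans sg).
rewrite -(sum_residues_lam lam_inj lam0 sg') /green_coef1 -sumrN; apply: eq_bigr => i _.
by rewrite g0_lam; field; rewrite charpoly_deriv.
Qed.

(** [green_coef0] and [green_coef1] are the first two coefficients at infinity of
    the Green function [g0 / W], so they tell by how much the degree of [g0] falls
    short of [N]. *)
Lemma zeros_count :
  [/\ green_coef0 = 0 -> green_coef1 = 0 -> (2 * k + 2 <= N)%N /\ size Z = (N - 2 * k - 2)%N,
      green_coef0 = 0 -> green_coef1 <> 0 -> (2 * k + 1 <= N)%N /\ size Z = (N - 2 * k - 1)%N
    & green_coef0 <> 0 -> (2 * k <= N)%N /\ size Z = (N - 2 * k)%N].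
Proof.
have lW := charpoly_coefN_neq0 lam0.
have g_n0 : g0 != 0 by rewrite -size_poly_eq0 size_g0.
have top : g0`_(2 * k + size Z) != 0.
  by have := lead_coef_eq0 g0; rewrite lead_coefE size_g0 /= => ->.
have a0 : (green_coef0 == 0) = (2 * k + size Z < N)%N.
  rewrite green_coef0E mulf_eq0 invr_eq0 (negbTE lW) orbF.
  apply/idP/idP => [/eqP g_N|lt]; last by rewrite nth_default // size_g0.
  rewrite ltn_neqAle zeros_le andbT; apply: contraNneq top => ->.
  by rewrite g_N.
have b0 : green_coef0 = 0 -> (green_coef1 == 0) = (2 * k + size Z < N.-1)%N.
  move=> /[dup] /green_coef1E -> /eqP; rewrite a0 => lt.
  rewrite mulf_eq0 invr_eq0 (negbTE lW) orbF.
  apply/idP/idP => [/eqP g_N|lt']; last by rewrite nth_default // size_g0.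
  rewrite ltn_neqAle -ltnS prednK // lt andbT; apply: contraNneq top => ->.
  by rewrite g_N.
have le := zeros_le; have large := Z_large.
split.
- move=> al be; have := b0 al; rewrite be eqxx => /esym.
  by move: large; move: (#|K|) (size Z) N0 => c d; clear; lia.
- move=> al /eqP be; have := b0 al; rewrite (negbTE be) => /esym/negbT.
  move/eqP: al; rewrite a0.
  by move: (#|K|) (size Z) N0 => c d; clear; lia.
- move=> /eqP; rewrite a0; move: le.
  by move: (#|K|) (size Z) N0 => c d; clear; lia.
Qed.

End Subsets.
End Factorizations.

Local Open Scope classical_set_scope.
Local Open Scope ring_scope.
Local Open Scope complex_scope.

(** * Solutions with prescribed drops of the derivative *)

Section RealODE.
Variable R : realType.
Implicit Types (f g h u : R -> R) (x t : R).

Lemma is_derive_expRhalf x :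
  is_derive x (1 : R) (fun t => expR (t / 2)) (expR (x / 2) / 2).
Proof.
have h : is_derive x (1 : R) (fun t : R => t / 2) (2^-1).
  by apply: is_derive_eq; rewrite !scaler0 add0r /GRing.scale /= mulr1.
have := @is_derive1_comp R expR (fun t => t / 2) x _ _ (is_derive_expR (x / 2)) h.
by rewrite mulrC.
Qed.

Lemma is_derive_expRNhalf x :
  is_derive x (1 : R) (fun t => expR (- t / 2)) (- (expR (- x / 2) / 2)).
Proof.
have h : is_derive x (1 : R) (fun t : R => - t / 2) (- 2^-1).
  by apply: is_derive_eq; rewrite !scaler0 add0r /GRing.scale /= mulrN1.
have := @is_derive1_comp R expR (fun t => - t / 2) x _ _ (is_derive_expR (- x / 2)) h.
by rewrite mulrN.
Qed.

Lemma expR_half_inv x : expR (x / 2) * expR (- x / 2) = 1.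
Proof. by rewrite -expRD mulNr subrr expR0. Qed.

Lemma expR_half_sqr x : expR (x / 2) ^+ 2 = expR x.
Proof. by rewrite -expRM_natl -mulr_natl mulrC divfK ?pnatr_eq0. Qed.

Lemma near_absP x (P : R -> Prop) :
  (\forall t \near x, P t) <-> exists2 e, 0 < e & forall t, `|t - x| < e -> P t.
Proof.
split.
- move=> /nbhs_ballP[e e0 H]; exists e => // t te; apply: H.
  by rewrite /ball /= distrC.
- move=> [e e0 H]; apply/nbhs_ballP; exists e => // t.
  by rewrite /ball /= distrC; exact: H.
Qed.

(** The limits of [u] form a locally constant function on the line, which has
    derivative zero everywhere. *)
Lemma punctured_constant u :
  (forall x, exists c, exists2 e, 0 < e & forall t, `|t - x| < e -> t != x -> u t = c) ->
  exists c, forall x, exists2 e, 0 < e & forall t, `|t - x| < e -> t != x -> u t = c.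
Proof.
move=> H; have [v Hv] := choice H.
have vloc x : is_derive x (1 : R) v 0.
  have [e e0 He] := Hv x.
  apply: (@near_eq_is_derive _ _ _ (cst (v x))).
  apply/near_absP; exists e => // t te; have [->//|tx] := eqVneq t x.
  have [e' e'0 He'] := Hv t.
  (* [t + d] lies in the punctured neighbourhoods of both [t] and [x]. *)
  pose d := Num.min e' (Num.min (e - `|t - x|) `|t - x|) / 2.
  have tx0 : 0 < `|t - x| by rewrite normr_gt0 subr_eq0.
  have m0 : 0 < Num.min e' (Num.min (e - `|t - x|) `|t - x|).
    by rewrite !lt_min e'0 tx0 subr_gt0 te.
  have d0 : 0 < d by rewrite divr_gt0.
  have [d1 d2 d3] : [/\ d < e', d < e - `|t - x| & d < `|t - x|].
    have : d < Num.min e' (Num.min (e - `|t - x|) `|t - x|).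
      by rewrite ltr_pdivrMr // mulrDr mulr1 ltrDl.
    by rewrite !lt_min => /and3P[].
  have E : t + d - x = (t - x) + d by rewrite addrAC.
  rewrite /cst -(He (t + d)); first last.
  - apply: contraTneq d3 => Ex; rewrite -leNgt -Ex opprD addrA subrr sub0r normrN.
    by rewrite gtr0_norm.
  - rewrite E (le_lt_trans (ler_normD _ _)) // [`|d|]gtr0_norm //.
    by rewrite addrC -ltrBrDr.
  apply: He'; first by rewrite addrAC subrr add0r gtr0_norm.
  by rewrite -subr_eq0 addrAC subrr add0r gt_eqF.
exists (v 0) => x; have [e e0 He] := Hv x; exists e => // t te tx.
by rewrite (He t te tx); exact: is_derive_0_is_cst.
Qed.

Lemma zero_derive_interval u a b :
  (forall t, a < t < b -> is_derive t (1 : R) u 0) ->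
  forall s t, a < s < b -> a < t < b -> u s = u t.
Proof.
move=> H s t; wlog st : s t / s <= t.
  by move=> wl sI tI; case: (leP s t) => [|/ltW] st; [|symmetry]; exact: wl.
move=> /andP[as_ sb] /andP[at_ tb].
have [| |c _] := @MVT_segment R u (fun=> 0) s t st.
- move=> x; rewrite in_itv /= => /andP[sx xt]; apply: H.
  by rewrite (lt_trans as_) // (lt_trans xt).
- apply: derivable_within_continuous => x; rewrite in_itv /= => /andP[sx xt].
  have := H x; rewrite (lt_le_trans as_) // (le_lt_trans xt) // => /(_ isT) [] //.
- by rewrite mul0r => /eqP; rewrite subr_eq0 => /eqP.
Qed.


Lemma points_gap (I : finType) (v : I -> R) x :
  exists2 e, 0 < e & forall i, v i != x -> e <= `|v i - x|.
Proof.
exists (\big[Num.min/1]_(i | v i != x) `|v i - x|).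
  apply: (big_ind (fun m : R => 0 < m)) => [//|a b|i].
    by rewrite lt_min => -> ->.
  by rewrite normr_gt0 subr_eq0.
by move=> i ix; rewrite (bigD1 i) //= ge_min lexx.
Qed.

Section Points.
Variables (n : nat) (pt : 'I_n -> R).
Hypothesis pt_inj : injective pt.

Lemma points_left x e : (forall i, pt i != x -> e <= `|pt i - x|) ->
  forall t, x - e < t <= x -> forall i, (pt i < t) = (pt i < x).
Proof.
move=> He t /andP[te tx] i; apply/idP/idP => [h|h]; first exact: lt_le_trans tx.
have := He i; rewrite lt_eqF // => /(_ isT); rewrite ltr0_norm ?subr_lt0 //.
by move=> he; rewrite (le_lt_trans _ te) //; lra.
Qed.

Lemma points_right x e : (forall i, pt i != x -> e <= `|pt i - x|) ->
  forall t, x < t < x + e -> forall i, (pt i < t) = (pt i <= x).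
Proof.
move=> He t /andP[te tx] i; apply/idP/idP => [h|h]; last exact: le_lt_trans te.
rewrite leNgt; apply/negP => h'.
have := He i; rewrite gt_eqF // => /(_ isT); rewrite gtr0_norm ?subr_gt0 //.
by move=> he; move: h tx; lra.
Qed.

Lemma points_off x e : (forall i, pt i != x -> e <= `|pt i - x|) ->
  forall t, `|t - x| < e -> t != x -> forall i, t != pt i.
Proof.
move=> He t te tx i; apply: contraNneq tx => tE; apply/negPn/negP => tx.
by have := He i; rewrite -tE => /(_ tx); rewrite leNgt te.
Qed.

Lemma sum_points_le x (F : 'I_n -> R) i0 : pt i0 = x ->
  \sum_(i < n | pt i <= x) F i = F i0 + \sum_(i < n | pt i < x) F i.
Proof.
move=> E; rewrite (bigD1 i0) ?E //=; congr (_ + _); apply: eq_bigl => i.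
rewrite le_eqVlt; have [->|ii0] := eqVneq i i0; first by rewrite E ltxx andbF.
have : pt i != x by rewrite -E; apply: contra_neq ii0; exact: pt_inj.
by move=> /negbTE ->; rewrite andbT.
Qed.

Lemma sum_points_off x (F : 'I_n -> R) : (forall i, x != pt i) ->
  \sum_(i < n | pt i <= x) F i = \sum_(i < n | pt i < x) F i.
Proof.
move=> E; apply: eq_bigl => i.
by rewrite le_eqVlt eq_sym (negbTE (E i)).
Qed.

Lemma left_limit_const u x e (c l : R) : 0 < e ->
  (forall t, x - e < t < x -> u t = c) -> u t @[t --> x^'-] --> l -> c = l.
Proof.
move=> e0 H ul; have cl : u t @[t --> x^'-] --> c.
  apply: cvg_near_cst; near=> t; apply: H.
  by apply/andP; split; near: t; [apply: nbhs_left_gt; rewrite ltrBlDr ltrDl|exact: nbhs_left_lt].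
exact: cvg_unique cl ul.
Unshelve. all: by end_near. Qed.

Lemma right_limit_const u x e (c l : R) : 0 < e ->
  (forall t, x < t < x + e -> u t = c) -> u t @[t --> x^'+] --> l -> c = l.
Proof.
move=> e0 H ul; have cl : u t @[t --> x^'+] --> c.
  apply: cvg_near_cst; near=> t; apply: H.
  by apply/andP; split; near: t; [exact: nbhs_right_gt|apply: nbhs_right_lt; rewrite ltrDl].
exact: cvg_unique cl ul.
Unshelve. all: by end_near. Qed.

(** Subtracting the jumps leaves a function that is constant on punctured
    neighbourhoods of all points. *)
Lemma step_function u (L Rr : 'I_n -> R) :
  (forall x, (forall i, x != pt i) -> is_derive x (1 : R) u 0) ->
  (forall i, u t @[t --> (pt i)^'-] --> L i) ->
  (forall i, u t @[t --> (pt i)^'+] --> Rr i) ->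
  exists c, forall x, (forall i, x != pt i) ->
    u x = c + \sum_(i < n | pt i < x) (Rr i - L i).
Proof.
move=> du uL uR; pose J i := Rr i - L i.
pose v t := u t - \sum_(i < n | pt i < t) J i.
have loc x : exists c, exists2 e, 0 < e & forall t, `|t - x| < e ->
    (t != x \/ forall i, x != pt i) -> v t = c.
  have [e e0 He] := points_gap pt x.
  have dl t : x - e < t < x -> is_derive t (1 : R) u 0.
    move=> /andP[te tx]; apply: du; apply: (points_off He); last by rewrite lt_eqF.
    by rewrite ltr0_norm ?subr_lt0 //; lra.
  have dr t : x < t < x + e -> is_derive t (1 : R) u 0.
    move=> /andP[tx te]; apply: du; apply: (points_off He); last by rewrite gt_eqF.
    by rewrite gtr0_norm ?subr_gt0 //; lra.
  have Il : x - e < x - e / 2 < x by apply/andP; split; lra.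
  have Ir : x < x + e / 2 < x + e by apply/andP; split; lra.
  have ul t : x - e < t < x -> u t = u (x - e / 2).
    by move=> h; apply: (zero_derive_interval dl).
  have ur t : x < t < x + e -> u t = u (x + e / 2).
    by move=> h; apply: (zero_derive_interval dr).
  have vl t : x - e < t <= x -> v t = u t - \sum_(i < n | pt i < x) J i.
    by move=> h; rewrite /v; congr (_ - _); apply: eq_bigl; exact: points_left He _ h.
  have vr t : x < t < x + e -> v t = u t - \sum_(i < n | pt i <= x) J i.
    by move=> h; rewrite /v; congr (_ - _); apply: eq_bigl; exact: points_right He _ h.
  exists (u (x - e / 2) - \sum_(i < n | pt i < x) J i), e => // t.
  rewrite ltr_distl => /andP[te1 te2] tx.
  have [[i0 Ei]|noi] := pselect (exists i, pt i = x).
    have {}tx : t != x by case: tx => // /(_ i0); rewrite Ei eqxx.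
    have lL : u (x - e / 2) = L i0.
      by apply: (left_limit_const e0 ul); rewrite -Ei; exact: uL.
    have rR : u (x + e / 2) = Rr i0.
      by apply: (right_limit_const e0 ur); rewrite -Ei; exact: uR.
    case: (ltgtP t x) tx => // ht _.
      by rewrite vl ?te1 ?ltW // ul // te1 ht.
    rewrite vr ?ht // ur ?ht // rR lL (sum_points_le _ Ei) /J; ring.
  have {}noi i : x != pt i by apply/eqP => E; apply: noi; exists i.
  have d t' : x - e < t' < x + e -> is_derive t' (1 : R) u 0.
    move=> /andP[h1 h2]; apply: du; have [->|tx'] := eqVneq t' x => //.
    by apply: (points_off He) => //; rewrite ltr_distl h1 h2.
  have uE : u t = u (x - e / 2).
    by apply: (zero_derive_interval d); apply/andP; split; lra.
  case: (leP t x) => ht; first by rewrite vl ?te1 ?ht // uE.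
  by rewrite vr ?ht // uE sum_points_off.
have [c Hc] : exists c, forall x, exists2 e, 0 < e & forall t, `|t - x| < e -> t != x -> v t = c.
  apply: punctured_constant => x; have [c [e e0 H]] := loc x.
  by exists c, e => // t te tx; apply: H => //; left.
exists c => x offx; have [c' [e e0 He]] := loc x; have [e' e'0 He'] := Hc x.
pose d := Num.min e e' / 2.
have m0 : 0 < Num.min e e' by rewrite lt_min e0 e'0.
have d0 : 0 < d by rewrite divr_gt0.
have [d1 d2] : d < e /\ d < e'.
  have : d < Num.min e e' by rewrite ltr_pdivrMr // mulrDr mulr1 ltrDl.
  by rewrite lt_min => /andP[].
have E : x + d - x = d by rewrite addrAC subrr add0r.
have : v x = c.
  rewrite (He x) ?subrr ?normr0 //; last by right.
  rewrite -(He (x + d)) ?E ?gtr0_norm //; last by right.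
  apply: He'; first by rewrite E gtr0_norm.
  by rewrite -subr_eq0 E gt_eqF.
by rewrite /v => <-; rewrite subrK.
Qed.

End Points.

Definition smooth_sol (al be : R) t := al * expR (t / 2) + be * expR (- t / 2).
Definition smooth_der (al be : R) t := (al * expR (t / 2) - be * expR (- t / 2)) / 2.

Lemma is_derive_smooth_sol al be x :
  is_derive x (1 : R) (smooth_sol al be) (smooth_der al be x).
Proof.
have h1 := is_derive_expRhalf x; have h2 := is_derive_expRNhalf x.
have h : is_derive x (1 : R) (smooth_sol al be)
   (al *: (expR (x / 2) / 2) + be *: (- (expR (- x / 2) / 2))).
  exact: is_deriveD.
by apply: is_derive_eq; rewrite /smooth_der /GRing.scale /=; ring.
Qed.

Lemma is_derive_smooth_der al be x :
  is_derive x (1 : R) (smooth_der al be) (smooth_sol al be x / 4).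
Proof.
have E : smooth_der al be = smooth_sol (al / 2) (- be / 2).
  by apply/funext => t; rewrite /smooth_der /smooth_sol; field.
rewrite E; have h := is_derive_smooth_sol (al / 2) (- be / 2) x.
by apply: is_derive_eq; rewrite /smooth_der /smooth_sol; field.
Qed.

Lemma continuous_smooth_sol al be : continuous (smooth_sol al be).
Proof.
move=> x; apply/differentiable_continuous/derivable1_diffP.
by have [] := is_derive_smooth_sol al be x.
Qed.

Lemma continuous_smooth_der al be : continuous (smooth_der al be).
Proof.
move=> x; apply/differentiable_continuous/derivable1_diffP.
by have [] := is_derive_smooth_der al be x.
Qed.

Lemma near_itv a b t (P : R -> Prop) : a < t < b ->
  (forall s, a < s < b -> P s) -> \forall s \near t, P s.
Proof.
move=> tab H; near=> s; apply: H; apply/andP; split; near: s.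
  by apply: lt_nbhsr; case/andP: tab.
by apply: lt_nbhsl; case/andP: tab.
Unshelve. all: by end_near. Qed.

Lemma smooth_interval f a b al be : (forall t, a < t < b -> f t = smooth_sol al be t) ->
  forall t, a < t < b -> is_derive t (1 : R) f (smooth_der al be t)
   /\ is_derive t (1 : R) (derive1 f) (smooth_sol al be t / 4).
Proof.
move=> H; have D t : a < t < b -> is_derive t (1 : R) f (smooth_der al be t).
  move=> tab; apply: (@near_eq_is_derive _ _ _ (smooth_sol al be)).
    by apply: (near_itv tab) => s /H.
  exact: is_derive_smooth_sol.
move=> t tab; split; first exact: D.
apply: (@near_eq_is_derive _ _ _ (smooth_der al be)).
  by apply: (near_itv tab) => s /D [_ <-]; rewrite derive1E.
exact: is_derive_smooth_der.
Qed.

Section Solutions.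
Variables (n : nat) (pt : 'I_n -> R).
Hypothesis pt_inj : injective pt.

Definition real_solution (h : R -> R) (ka : 'I_n -> R) :=
  [/\ continuous h,
    forall x, (forall i, x != pt i) ->
      [/\ derivable h x 1, derivable (derive1 h) x 1 & - derive1 (derive1 h) x + h x / 4 = 0]
   & forall i, exists fl fr, [/\ derive1 h t @[t --> (pt i)^'-] --> (fl : R),
        derive1 h t @[t --> (pt i)^'+] --> (fr : R) & fl = fr + ka i]].

(** General solution: at a point with drop [ka i] the coefficients jump so that
    the value stays and the derivative drops by [ka i]. *)
Definition rsol (A B : R) (ka : 'I_n -> R) t :=
  smooth_sol (A - \sum_(i < n | pt i < t) ka i * expR (- pt i / 2))
             (B + \sum_(i < n | pt i < t) ka i * expR (pt i / 2)) t.

(** For [c = 1] and [c = -1] the left side is the coefficient of [e^{x/2}] or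
    [e^{-x/2}], which has zero derivative off the points. *)
Lemma real_solution_half h ka (e : R -> R) (c : R) : real_solution h ka ->
  (forall x, is_derive x (1 : R) e (- (c / 2) * e x)) -> c ^+ 2 = 1 ->
  exists A, forall x, (forall i, x != pt i) ->
    e x * (h x / 2 + c * derive1 h x) = A - c * \sum_(i < n | pt i < x) ka i * e (pt i).
Proof.
move=> [ch off jump] de c1.
have [L HL] := choice jump; have {HL} [Rr HL] := choice HL.
have ce x : e t @[t --> x] --> e x.
  have : {for x, continuous e}.
    apply/differentiable_continuous/derivable1_diffP.
    by have [] := de x.
  by [].
have hh i : h t / 2 @[t --> pt i] --> h (pt i) / 2.
  by apply: cvgM; [exact: ch|exact: cvg_cst].
have [A HA] : exists A, forall x, (forall i, x != pt i) ->
    e x * (h x / 2 + c * derive1 h x) = A + \sum_(i < n | pt i < x)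
      (e (pt i) * (h (pt i) / 2 + c * Rr i) - e (pt i) * (h (pt i) / 2 + c * L i)).
  apply: (step_function pt_inj
    (u := fun x => e x * (h x / 2 + c * derive1 h x))).
  - move=> x /off[d1 d2 E].
    have h1 : is_derive x (1 : R) h (derive1 h x) by rewrite derive1E; exact: derivableP.
    have h2 : is_derive x (1 : R) (derive1 h) (derive1 (derive1 h) x).
      by rewrite [X in is_derive _ _ _ X]derive1E; exact: derivableP.
    have h4 : is_derive x (1 : R) (fun t => h t / 2 + c * derive1 h t)
       (2^-1 *: derive1 h x + c *: derive1 (derive1 h) x).
      rewrite (_ : (fun t => _) = 2^-1 *: h + c *: (derive1 h)).
        exact: is_deriveD.
      by apply/funext => t; rewrite mulrC.
    have {}E : derive1 (derive1 h) x = h x / 4 by lra.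
    suff E0 : e x *: (2^-1 *: derive1 h x + c *: derive1 (derive1 h) x)
        + (h x / 2 + c * derive1 h x) *: (- (c / 2) * e x) = 0.
      by rewrite -E0; exact: (is_deriveM (de x) h4).
    rewrite /GRing.scale /= E.
    transitivity (e x * derive1 h x / 2 * (1 - c ^+ 2)); first by field.
    by rewrite c1 subrr mulr0.
  - move=> i; have [hl _ _] := HL i; apply: cvgM; first exact: cvg_at_left_filter.
    apply: cvgD; first exact: cvg_at_left_filter (hh i).
    by apply: cvgM => //; exact: cvg_cst.
  - move=> i; have [_ hr _] := HL i; apply: cvgM; first exact: cvg_at_right_filter.
    apply: cvgD; first exact: cvg_at_right_filter (hh i).
    by apply: cvgM => //; exact: cvg_cst.
exists A => x /HA ->; rewrite mulr_sumr -sumrN; congr (_ + _); apply: eq_bigr => i _.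
by have [_ _ ->] := HL i; ring.
Qed.

Lemma rsol_left ka A B x e : (forall i, pt i != x -> e <= `|pt i - x|) ->
  forall t, x - e < t <= x -> rsol A B ka t =
   smooth_sol (A - \sum_(i < n | pt i < x) ka i * expR (- pt i / 2))
              (B + \sum_(i < n | pt i < x) ka i * expR (pt i / 2)) t.
Proof.
move=> He t tx; rewrite /rsol; congr (smooth_sol (_ - _) (_ + _) _);
  by apply: eq_bigl; exact: points_left He _ tx.
Qed.

Lemma rsol_right ka A B x e : (forall i, pt i != x -> e <= `|pt i - x|) ->
  forall t, x < t < x + e -> rsol A B ka t =
   smooth_sol (A - \sum_(i < n | pt i <= x) ka i * expR (- pt i / 2))
              (B + \sum_(i < n | pt i <= x) ka i * expR (pt i / 2)) t.
Proof.
move=> He t tx; rewrite /rsol; congr (smooth_sol (_ - _) (_ + _) _);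
  by apply: eq_bigl; exact: points_right He _ tx.
Qed.

Lemma real_solution_formula h ka : real_solution h ka ->
  exists A B, forall x, h x = rsol A B ka x.
Proof.
move=> sol; have [ch off jump] := sol.
have [||A HA] := @real_solution_half h ka (fun t => expR (- t / 2)) 1 sol.
- move=> x; have h3 := is_derive_expRNhalf x.
  by apply: is_derive_eq; rewrite -mulNr; field.
- exact: expr1n.
have [||B HB] := @real_solution_half h ka (fun t => expR (t / 2)) (-1) sol.
- move=> x; have h3 := is_derive_expRhalf x.
  by apply: is_derive_eq; field.
- by rewrite sqrrN expr1n.
have offE x : (forall i, x != pt i) -> h x = rsol A B ka x.
  move=> ox; have := HA x ox; have := HB x ox; rewrite !(mul1r, mulN1r, opprK).
  rewrite /rsol /smooth_sol => <- <-.
  transitivity (expR (x / 2) * expR (- x / 2) * h x); last by field.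
  by rewrite expR_half_inv mul1r.
exists A, B => x; have [e e0 He] := points_gap pt x.
set al := A - \sum_(i < n | pt i < x) ka i * expR (- pt i / 2).
set be := B + \sum_(i < n | pt i < x) ka i * expR (pt i / 2).
apply/eqP; rewrite -subr_eq0; apply/eqP; apply/esym.
apply: (@left_limit_const (fun t => h t - smooth_sol al be t) x e) => //.
  move=> t /andP[te tx]; rewrite offE; last first.
    apply: (points_off He); last by rewrite lt_eqF.
    by rewrite ltr0_norm ?subr_lt0 //; lra.
  by rewrite (rsol_left _ _ _ He) ?te ?ltW // subrr.
rewrite (rsol_left _ _ _ He); last by apply/andP; split; lra.
apply: cvg_at_left_filter; apply: cvgB; first exact: ch.
exact: continuous_smooth_sol.
Qed.

Lemma real_solution_exists A B ka : real_solution (rsol A B ka) ka.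
Proof.
split.
- move=> x; have [e e0 He] := points_gap pt x.
  set h := rsol A B ka.
  pose al := A - \sum_(i < n | pt i < x) ka i * expR (- pt i / 2).
  pose be := B + \sum_(i < n | pt i < x) ka i * expR (pt i / 2).
  pose al' := A - \sum_(i < n | pt i <= x) ka i * expR (- pt i / 2).
  pose be' := B + \sum_(i < n | pt i <= x) ka i * expR (pt i / 2).
  have hl : h x = smooth_sol al be x.
    by rewrite /h (rsol_left _ _ _ He) //; apply/andP; split; lra.
  have hr : h x = smooth_sol al' be' x.
    rewrite hl; have [[i0 Ei]|noi] := pselect (exists i, pt i = x).
      rewrite /smooth_sol /al' /be' !(sum_points_le pt_inj _ Ei) Ei -/al.
      by rewrite /al /be; ring.
    have {}noi i : x != pt i by apply/eqP => E; apply: noi; exists i.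
    by rewrite /al' /be' !sum_points_off.
  move=> U nU; change (\forall t \near x, U (h t)).
  have nl : \forall t \near x, U (smooth_sol al be t).
    by apply: (continuous_smooth_sol (x := x)); rewrite -hl.
  have nr : \forall t \near x, U (smooth_sol al' be' t).
    by apply: (continuous_smooth_sol (x := x)); rewrite -hr.
  near=> t.
  have te : `|t - x| < e by near: t; apply/near_absP; exists e.
  move: te; rewrite ltr_distl => /andP[te1 te2] /=.
  case: (leP t x) => tx.
    by rewrite /h (rsol_left _ _ _ He) ?te1 //; near: t.
  by rewrite /h (rsol_right _ _ _ He) ?tx //; near: t.
- move=> x ox; have [e e0 He] := points_gap pt x.
  set al := A - \sum_(i < n | pt i < x) ka i * expR (- pt i / 2).
  set be := B + \sum_(i < n | pt i < x) ka i * expR (pt i / 2).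
  have E t : x - e < t < x + e -> rsol A B ka t = smooth_sol al be t.
    move=> /andP[h1 h2]; case: (leP t x) => tx.
      by rewrite (rsol_left _ _ _ He) ?h1.
    by rewrite (rsol_right _ _ _ He) ?tx // !sum_points_off.
  have xI : x - e < x < x + e by apply/andP; split; lra.
  have [[d1 D1] [d2 D2]] := smooth_interval E xI.
  split => //.
  by rewrite [X in - X + _]derive1E D2 E // addNr.
- move=> i; have [e e0 He] := points_gap pt (pt i).
  set al := A - \sum_(j < n | pt j < pt i) ka j * expR (- pt j / 2).
  set be := B + \sum_(j < n | pt j < pt i) ka j * expR (pt j / 2).
  pose al' := A - \sum_(j < n | pt j <= pt i) ka j * expR (- pt j / 2).
  pose be' := B + \sum_(j < n | pt j <= pt i) ka j * expR (pt j / 2).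
  exists (smooth_der al be (pt i)), (smooth_der al' be' (pt i)); split.
  + have E t : pt i - e < t < pt i -> rsol A B ka t = smooth_sol al be t.
      by move=> /andP[h1 h2]; rewrite (rsol_left _ _ _ He) ?h1 // ltW.
    have D t : pt i - e < t < pt i -> derive1 (rsol A B ka) t = smooth_der al be t.
      by move=> ti; have [[_ D1] _] := smooth_interval E ti; rewrite derive1E.
    have : smooth_der al be t @[t --> (pt i)^'-] --> smooth_der al be (pt i).
      by apply: cvg_at_left_filter; exact: continuous_smooth_der.
    apply: cvg_trans; apply: near_eq_cvg; near=> t; rewrite /= D //.
    apply/andP; split; near: t; last exact: nbhs_left_lt.
    by apply: nbhs_left_gt; lra.
  + have E t : pt i < t < pt i + e -> rsol A B ka t = smooth_sol al' be' t.
      by move=> /andP[h1 h2]; rewrite (rsol_right _ _ _ He) ?h1.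
    have D t : pt i < t < pt i + e -> derive1 (rsol A B ka) t = smooth_der al' be' t.
      by move=> ti; have [[_ D1] _] := smooth_interval E ti; rewrite derive1E.
    have : smooth_der al' be' t @[t --> (pt i)^'+] --> smooth_der al' be' (pt i).
      by apply: cvg_at_right_filter; exact: continuous_smooth_der.
    apply: cvg_trans; apply: near_eq_cvg; near=> t; rewrite /= D //.
    apply/andP; split; near: t; first exact: nbhs_right_gt.
    by apply: nbhs_right_lt; lra.
  + rewrite /smooth_der /al' /be' !(sum_points_le pt_inj _ (erefl (pt i))).
    rewrite -/al -/be; have := expR_half_inv (pt i).
    set p := expR (pt i / 2); set q := expR (- pt i / 2) => pq.
    set sa := \sum_(j < n | _) (_ * expR (- _ / 2)) in al *.
    set sb := \sum_(j < n | _) (_ * expR (_ / 2)) in be *.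
    have K : ka i = ka i * (p * q) by rewrite pq mulr1.
    by rewrite /al /be [X in _ = _ + X]K; field.
Unshelve. all: by end_near. Qed.

End Solutions.
End RealODE.

(** * Solutions of the spectral problem *)

Section ComplexODE.
Variables (R : realType) (P : dirac_pair R).
Local Notation n := (npt P).
Implicit Types (z A B : R[i]) (x : R) (f : R -> R[i]).

Lemma pt_inj : injective (pt P).
Proof.
move=> i j E; apply/val_inj; case: (ltngtP i j) => // /pt_incr; rewrite E ltxx //.
Qed.

Lemma pt_le (i j : 'I_n) : (i <= j)%N -> pt P i <= pt P j.
Proof.
rewrite leq_eqVlt => /predU1P[/val_inj ->//|/pt_incr/ltW //].
Qed.

Lemma points_below x : exists2 m, (m <= n)%N & forall i, (pt P i < x) = (i < m)%N.
Proof.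
exists (\max_(i < n | pt P i < x) i.+1); first by apply/bigmax_leqP => i _.
move=> i; apply/idP/idP => [ix|]; first exact: leq_bigmax_cond.
have [[j jx]|no] := pselect (exists j, pt P j < x); last first.
  by rewrite big1 // => j jx; case: no; exists j.
have [|k kx ->] := @eq_bigmax_cond _ [pred i | pt P i < x] (fun i : 'I_n => i.+1).
  by apply/card_gt0P; exists j.
by rewrite ltnS => /pt_le ik; exact: le_lt_trans kx.
Qed.

Definition masses := [seq (expR (pt P i), om P i, vv P i) | i : 'I_n].

Lemma size_masses : size masses = n.
Proof. by rewrite size_map size_enum_ord. Qed.

Lemma nth_masses (i : 'I_n) : nth_mass masses i = (expR (pt P i), om P i, vv P i).
Proof.
rewrite /nth_mass /masses (nth_map i) ?size_enum_ord // nth_ord_enum //.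
Qed.

Lemma take_masses (i : 'I_n) :
  take i.+1 masses = rcons (take i masses) (expR (pt P i), om P i, vv P i).
Proof. by rewrite -nth_masses -take_nth // size_masses. Qed.

Definition cweight z (t : R * R * R) : R[i] := z * t.1.2%:C + z ^+ 2 * t.2%:C.
Definition ccross z s (t : R * R * R) := cross t.1.1%:C (t.1.1^-1)%:C (cweight z t) s.
Definition cchain z s l := foldl (ccross z) s l.

Definition cval (s : R[i] * R[i]) x : R[i] :=
  s.1 * (expR (x / 2))%:C + s.2 * (expR (- x / 2))%:C.

Definition csol A B (ka : 'I_n -> R[i]) x :=
  cval (A - \sum_(i < n | pt P i < x) ka i * (expR (- pt P i / 2))%:C,
        B + \sum_(i < n | pt P i < x) ka i * (expR (pt P i / 2))%:C) x.

Definition partial_state A B (ka : 'I_n -> R[i]) m : R[i] * R[i] :=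
  (A - \sum_(i < n | (i < m)%N) ka i * (expR (- pt P i / 2))%:C,
   B + \sum_(i < n | (i < m)%N) ka i * (expR (pt P i / 2))%:C).

Lemma csol_partial_state A B ka x m : (forall i, (pt P i < x) = (i < m)%N) ->
  csol A B ka x = cval (partial_state A B ka m) x.
Proof.
by move=> below; congr (cval (_ - _, _ + _) _); apply: eq_bigl => j; rewrite below.
Qed.

Lemma pt_below (i j : 'I_n) : (pt P j < pt P i) = (j < i)%N.
Proof.
apply/idP/idP => [h|h]; last exact: pt_incr.
by rewrite ltnNge; apply: contraTN h => /pt_le; rewrite -leNgt.
Qed.

Lemma Re_csol A B ka x : complex.Re (csol A B ka x) =
  rsol (pt P) (complex.Re A) (complex.Re B) (fun i => complex.Re (ka i)) x.
Proof.
rewrite /csol /cval /rsol /smooth_sol /= Re_add !Re_mulC !Re_add Re_opp !Re_sum.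
by congr ((_ - _) * _ + (_ + _) * _); apply: eq_bigr => i _; rewrite Re_mulC.
Qed.

Lemma Im_csol A B ka x : complex.Im (csol A B ka x) =
  rsol (pt P) (complex.Im A) (complex.Im B) (fun i => complex.Im (ka i)) x.
Proof.
rewrite /csol /cval /rsol /smooth_sol /= Im_add !Im_mulC !Im_add Im_opp !Im_sum.
by congr ((_ - _) * _ + (_ + _) * _); apply: eq_bigr => i _; rewrite Im_mulC.
Qed.

Lemma quarterE (u : R[i]) : 4^-1 * u = u * (4^-1)%:C.
Proof. by rewrite mulrC fmorphV rmorph_nat. Qed.

Definition jump_at z f (i : 'I_n) : R[i] :=
  cweight z (expR (pt P i), om P i, vv P i) * f (pt P i).

Lemma jump_atE z f i (fr : R[i]) :
  fr + z * (om P i)%:C * f (pt P i) + z ^+ 2 * (vv P i)%:C * f (pt P i)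
  = fr + jump_at z f i.
Proof. by rewrite -addrA -mulrDl. Qed.

Lemma solution_parts z f : is_solution P z f <->
  real_solution (pt P) (fun t => complex.Re (f t)) (fun i => complex.Re (jump_at z f i))
  /\ real_solution (pt P) (fun t => complex.Im (f t)) (fun i => complex.Im (jump_at z f i)).
Proof.
split.
- move=> [cf off jmp]; split; split.
  + by move=> x; have [] := cf x.
  + move=> x /off[[d1 d2] [d3 d4] E]; split; [exact: d1|exact: d3|].
    have := congr1 (@complex.Re R) E; rewrite quarterE Re_add Re_opp Re_mulC => E'.
    exact: E'.
  + move=> i; have [fl [fr [[l1 l2] [r1 r2] E]]] := jmp i.
    rewrite jump_atE in E; rewrite E in l1 l2.
    exists (complex.Re (fr + jump_at z f i)), (complex.Re fr).
    split; [exact: l1|exact: r1|exact: Re_add].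
  + by move=> x; have [] := cf x.
  + move=> x /off[[d1 d2] [d3 d4] E]; split; [exact: d2|exact: d4|].
    have := congr1 (@complex.Im R) E; rewrite quarterE Im_add Im_opp Im_mulC => E'.
    exact: E'.
  + move=> i; have [fl [fr [[l1 l2] [r1 r2] E]]] := jmp i.
    rewrite jump_atE in E; rewrite E in l1 l2.
    exists (complex.Im (fr + jump_at z f i)), (complex.Im fr).
    split; [exact: l2|exact: r2|exact: Im_add].
- move=> [[c1 o1 j1] [c2 o2 j2]]; split.
  + by move=> x; split; [exact: c1|exact: c2].
  + move=> x ox; have [d1 d2 E1] := o1 x ox; have [d3 d4 E2] := o2 x ox.
    split; [split; [exact: d1|exact: d3]|split; [exact: d2|exact: d4]|apply: complex_ext].
      by rewrite quarterE Re_add Re_opp Re_mulC; exact: E1.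
    by rewrite quarterE Im_add Im_opp Im_mulC; exact: E2.
  + move=> i; have [l1 [r1 [hl1 hr1 E1]]] := j1 i; have [l2 [r2 [hl2 hr2 E2]]] := j2 i.
    exists (l1 +i* l2), (r1 +i* r2).
    split; [split; [exact: hl1|exact: hl2]|split; [exact: hr1|exact: hr2]|].
    rewrite jump_atE; apply: complex_ext; first by rewrite Re_add.
    by rewrite Im_add.
Qed.

Lemma cval_cross_value (s : R[i] * R[i]) x :
  cval s x = (s.1 + ((expR x)^-1)%:C * s.2) * (expR (x / 2))%:C.
Proof.
rewrite /cval mulrDl [_ * s.2]mulrC -mulrA real_complexM; congr (_ + _ * _%:C).
by rewrite -expRN -expRD; congr expR; field.
Qed.

Lemma cross_state z (s : R[i] * R[i]) (i : 'I_n) (k : R[i]) :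
  k = cweight z (expR (pt P i), om P i, vv P i) * cval s (pt P i) ->
  ccross z s (expR (pt P i), om P i, vv P i) =
  (s.1 - k * (expR (- pt P i / 2))%:C, s.2 + k * (expR (pt P i / 2))%:C).
Proof.
move=> ->; rewrite cval_cross_value /ccross /cross /=; set w := cweight _ _.
set F := _ + _; congr (_ - _, _ + _).
  by rewrite -!mulrA real_complexM expR_half_inv mulr1.
by rewrite -!mulrA real_complexM -expr2 expR_half_sqr; ring.
Qed.

(** The drops [ka] enter as data in the explicit formula and are determined by
    the values in the recursion; the two descriptions agree mass by mass. *)
Lemma partial_state_cchain z A B ka :
  (forall i : 'I_n, cchain z (A, B) (take i masses) = partial_state A B ka i ->
     ka i = cweight z (expR (pt P i), om P i, vv P i)
            * cval (partial_state A B ka i) (pt P i)) ->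
  forall m, (m <= n)%N -> cchain z (A, B) (take m masses) = partial_state A B ka m.
Proof.
move=> Hk; elim=> [_|m IH mn].
  by rewrite take0 /partial_state !big_pred0 ?subr0 ?addr0 // => i; rewrite ltn0.
have IHm := IH (ltnW mn); pose i := Ordinal mn.
rewrite (take_masses i) /cchain foldl_rcons -/(cchain _ _ _) IHm.
rewrite (@cross_state z _ i (ka i)); last exact: (Hk i IHm).
have split_sum (F : 'I_n -> R[i]) :
    \sum_(j < n | (j < m.+1)%N) F j = \sum_(j < n | (j < m)%N) F j + F i.
  rewrite (bigD1 i) //= addrC; congr (_ + _); apply: eq_bigl => j.
  by rewrite ltnS [in RHS]ltn_neqAle andbC.
by rewrite /partial_state !split_sum /=; congr (_, _); ring.
Qed.

(** [(A, B)] are the coefficients of [f] to the left of all points. *)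
Definition solves_from z A B f :=
  forall x m, (m <= n)%N -> (forall i, (pt P i < x) = (i < m)%N) ->
    f x = cval (cchain z (A, B) (take m masses)) x.

Lemma solution_from z f : is_solution P z f -> exists A B, solves_from z A B f.
Proof.
move=> /solution_parts [/(real_solution_formula pt_inj)[A1 [B1 H1]]
                        /(real_solution_formula pt_inj)[A2 [B2 H2]]].
exists (A1 +i* A2), (B1 +i* B2).
have Hf x : f x = csol (A1 +i* A2) (B1 +i* B2) (jump_at z f) x.
  by apply: complex_ext; rewrite ?Re_csol ?Im_csol /= ?H1 ?H2.
move=> x m mn below; rewrite (partial_state_cchain (ka := jump_at z f)) //.
  by rewrite Hf; exact: csol_partial_state.
by move=> i _; rewrite {1}/jump_at Hf (csol_partial_state _ _ _ (pt_below i)).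
Qed.

Lemma solution_exists z A B : exists2 f, is_solution P z f & solves_from z A B f.
Proof.
pose ka (i : 'I_n) := cweight z (expR (pt P i), om P i, vv P i)
   * cval (cchain z (A, B) (take i masses)) (pt P i).
pose f := csol A B ka.
have sf : solves_from z A B f.
  move=> x m mn below; rewrite (partial_state_cchain (ka := ka)) //.
    exact: csol_partial_state.
  by move=> i <-.
exists f => //; apply/solution_parts.
have kaE i : ka i = jump_at z f i.
  rewrite /ka /jump_at; congr (_ * _); symmetry; apply: sf; first exact: ltnW.
  exact: pt_below.
split.
- rewrite (_ : (fun t => _) = rsol (pt P) (complex.Re A) (complex.Re B)
    (fun i => complex.Re (ka i))); last by apply/funext => t; rewrite Re_csol.
  rewrite (_ : (fun i => complex.Re (jump_at z f i)) = (fun i => complex.Re (ka i))).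
    exact: real_solution_exists pt_inj _ _ _.
  by apply/funext => i; rewrite kaE.
- rewrite (_ : (fun t => _) = rsol (pt P) (complex.Im A) (complex.Im B)
    (fun i => complex.Im (ka i))); last by apply/funext => t; rewrite Im_csol.
  rewrite (_ : (fun i => complex.Im (jump_at z f i)) = (fun i => complex.Im (ka i))).
    exact: real_solution_exists pt_inj _ _ _.
  by apply/funext => i; rewrite kaE.
Qed.

End ComplexODE.

(** * Eigenvalues and decaying solutions *)

Section Modulus.
Variable R : realType.

Lemma cmodE (z : R[i]) : (cmod z)%:C = `|z|.
Proof. by rewrite /cmod normc_def. Qed.

Lemma cmod_real (r : R) : cmod (r%:C) = `|r|.
Proof. by rewrite /cmod normc_def /= expr0n addr0 sqrtr_sqr. Qed.

Lemma cmod_real_sqr (r : R) : cmod (r%:C) ^+ 2 = r ^+ 2.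
Proof. by rewrite cmod_real -normrX ger0_norm // sqr_ge0. Qed.

Lemma cmod_ge0 (z : R[i]) : 0 <= cmod z.
Proof. by rewrite -lecR cmodE normr_ge0. Qed.

Lemma cmod_eq0 (z : R[i]) : (cmod z == 0) = (z == 0).
Proof. by rewrite -(inj_eq (@complexI R)) cmodE normr_eq0. Qed.

Lemma cmodM (u v : R[i]) : cmod (u * v) = cmod u * cmod v.
Proof. by apply: (@complexI R); rewrite rmorphM /= !cmodE normrM. Qed.

Lemma cmodD (u v : R[i]) : cmod (u + v) <= cmod u + cmod v.
Proof. by rewrite -lecR rmorphD /= !cmodE ler_normD. Qed.

(** [e^{x/2}] is unbounded and dominates [e^{-x/2}]. *)
Lemma bounded_exp_eq0 (al be : R[i]) (x0 M : R) :
  (forall x, x0 < x -> cmod (al * (expR (x / 2))%:C + be * (expR (- x / 2))%:C) <= M) ->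
  al = 0.
Proof.
move=> H; apply/eqP; rewrite -cmod_eq0; apply/negPn/negP => al0.
have c0 : 0 < cmod al by rewrite lt_neqAle eq_sym al0 cmod_ge0.
pose M' := M + cmod be * expR (- x0 / 2).
pose x := `|x0| + 1 + 2 * `|M'| / cmod al.
have pos : 0 <= 2 * `|M'| / cmod al by rewrite divr_ge0 ?mulr_ge0 ?normr_ge0 // ltW.
have xx0 : x0 < x by rewrite /x; have := ler_norm x0; lra.
have x1 : 2 * `|M'| / cmod al < x by rewrite /x; have := normr_ge0 x0; lra.
have le1 : cmod al * expR (x / 2) <= M'.
  have -> : cmod al * expR (x / 2) = cmod (al * (expR (x / 2))%:C).
    by rewrite cmodM cmod_real ger0_norm // expR_ge0.
  have -> : al * (expR (x / 2))%:C = (al * (expR (x / 2))%:C + be * (expR (- x / 2))%:C)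
     + (- be) * (expR (- x / 2))%:C by ring.
  rewrite (le_trans (cmodD _ _)) // lerD ?H //.
  rewrite cmodM cmod_real ger0_norm ?expR_ge0 //.
  have -> : cmod (- be) = cmod be by rewrite -mulN1r cmodM /cmod normrN1 mul1r.
  by rewrite ler_wpM2l ?cmod_ge0 // ler_expR; lra.
have : cmod al * (1 + x / 2) <= M'.
  by rewrite (le_trans _ le1) // ler_wpM2l ?cmod_ge0 // expR_ge1Dx.
apply/negP; rewrite -ltNge.
have : `|M'| < cmod al * (x / 2).
  rewrite -ltr_pdivrMl // mulrC; move: x1; lra.
have := ler_norm M'; rewrite mulrDr mulr1; move: c0.
set u := cmod al * (x / 2); lra.
Qed.

End Modulus.

Section Chain.
Variable R : realType.
Implicit Types (z : R[i]) (l : seq (R * R * R)).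

Definition evC z (p : {poly R}) : R[i] := (toC p).[z].

Lemma evC_wpoly z t : evC z (wpoly t) = cweight z t.
Proof.
rewrite /evC /toC /wpoly expr2 -!mul_polyC rmorphD !rmorphM /= !map_polyC map_polyX.
rewrite hornerD !hornerM !hornerC hornerX /cweight /=.
by rewrite mulrC [X in _ + X]mulrC.
Qed.

Lemma evCD z p q : evC z (p + q) = evC z p + evC z q.
Proof. by rewrite /evC /toC rmorphD hornerD. Qed.

Lemma evCB z p q : evC z (p - q) = evC z p - evC z q.
Proof. by rewrite /evC /toC rmorphB hornerD hornerN. Qed.

Lemma evCM z p q : evC z (p * q) = evC z p * evC z q.
Proof. by rewrite /evC /toC rmorphM hornerM. Qed.

Lemma evCC z (c : R) : evC z c%:P = c%:C.
Proof. by rewrite /evC /toC map_polyC hornerC. Qed.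

Lemma evC1 z : evC z 1 = 1.
Proof. by rewrite /evC /toC rmorph1 hornerC. Qed.

Lemma evC0 z : evC z 0 = 0.
Proof. by rewrite /evC /toC rmorph0 horner0. Qed.

Lemma evC_real (r : R) p : evC r%:C p = (p.[r])%:C.
Proof. by rewrite /evC /toC horner_map. Qed.

Definition evs z (s : {poly R} * {poly R}) := (evC z s.1, evC z s.2).

Lemma evs_pchain z s l : cchain z (evs z s) l = evs z (pchain s l).
Proof.
elim: l s => //= t l IH s; rewrite -IH; congr foldl.
by rewrite /ccross /pcross /cross /evs /= !(evC_wpoly, evCB, evCD, evCM, evCC).
Qed.

Lemma cchain_scale z c s l :
  cchain z (c * s.1, c * s.2) l = (c * (cchain z s l).1, c * (cchain z s l).2).
Proof.
elim: l s => //= t l IH s; rewrite -IH; congr foldl.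
by rewrite /ccross /cross /=; congr (_, _); ring.
Qed.

Lemma cchain_inj z l : positive l -> injective (fun s => cchain z s l).
Proof.
elim: l => [_ s s' E|t l IH /= /andP[t0 lp] s s' E0]; first exact: E.
have {E0}E := IH lp _ _ E0.
have yy : (t.1.1)%:C * (t.1.1^-1)%:C = 1 :> R[i].
  by rewrite real_complexM mulfV // gt_eqF.
by rewrite -(crossK (cweight z t) s yy) -[cross _ _ _ s]/(ccross z s t) E crossK.
Qed.

Lemma rchain_cat s l1 l2 : rchain s (l1 ++ l2) = rchain (rchain s l2) l1.
Proof. exact: foldr_cat. Qed.

Lemma positive_take m l : positive l -> positive (take m l).
Proof. by move=> /allP H; apply/allP => t /mem_take; exact: H. Qed.

Lemma pchain_rchain_take s l m : positive l ->
  pchain (rchain s l) (take m l) = rchain s (drop m l).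
Proof.
move=> lp; rewrite -{1}(cat_take_drop m l) rchain_cat rchainK //.
exact: positive_take.
Qed.

End Chain.

Section Pair.
Variables (R : realType) (P : dirac_pair R).
Local Notation l := (masses P).
Local Notation n := (npt P).

Lemma admissible_masses : admissible l.
Proof.
apply/andP; split.
  apply/(pairwiseP (0, 0, 0)) => i j; rewrite !inE size_masses => il jl ij.
  have := nth_masses (Ordinal il); have := nth_masses (Ordinal jl).
  rewrite /nth_mass /= => -> -> /=; rewrite ltr_expR; exact: pt_incr.
apply/allP => t /mapP[i _ ->] /=.
by rewrite expR_gt0 vv_ge0 weight_gt0.
Qed.

Lemma positive_masses : positive l.
Proof. exact: admissible_positive admissible_masses. Qed.

Definition W_poly : {poly R} := (pchain (1, 0) l).1.
Definition b_poly : {poly R} := (pchain (1, 0) l).2.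

Lemma left_state z m : cchain z (1, 0) (take m l) = evs z (pchain (1, 0) (take m l)).
Proof.
by rewrite -evs_pchain /evs /= evC1 evC0.
Qed.

Lemma right_state z m :
  cchain z (evs z (rchain (0, 1) l)) (take m l) = evs z (rchain (0, 1) (drop m l)).
Proof. by rewrite evs_pchain pchain_rchain_take // positive_masses. Qed.

Definition pt_first : 'I_n := Ordinal (npt_gt0 P).
Lemma last_lt : (n.-1 < n)%N.
Proof. by rewrite ltn_predL npt_gt0. Qed.
Definition pt_last : 'I_n := Ordinal last_lt.

Lemma before_first x : x < pt P pt_first -> forall i, (pt P i < x) = (i < 0)%N.
Proof.
move=> xf i; apply/negbTE; rewrite -leNgt (le_trans (ltW xf)) //.
exact: pt_le.
Qed.

Lemma after_last x : pt P pt_last < x -> forall i, (pt P i < x) = (i < n)%N.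
Proof.
move=> xl i; rewrite ltn_ord; apply: le_lt_trans xl; apply: pt_le => /=.
by rewrite -ltnS prednK ?npt_gt0.
Qed.

Lemma solves_before z A B f : solves_from P z A B f ->
  forall x, x < pt P pt_first -> f x = cval (A, B) x.
Proof. by move=> Hf x xf; rewrite (Hf _ 0%N) ?take0 //; exact: before_first. Qed.

Lemma solves_after z A B f : solves_from P z A B f ->
  forall x, pt P pt_last < x -> f x = cval (cchain z (A, B) l) x.
Proof.
move=> Hf x xl; rewrite (Hf _ n) //; last exact: after_last.
by rewrite -size_masses take_size.
Qed.

Lemma eigenvalueE z : is_eigenvalue P z <-> evC z W_poly = 0.
Proof.
have full : cchain z (1, 0) l = (evC z W_poly, evC z b_poly).
  by rewrite -[l]take_size left_state take_size.
split.
- move=> [f [sf [x1 fx1] [M HM]]]; have [A [B Hf]] := solution_from sf.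
  have B0 : B = 0.
    apply: (@bounded_exp_eq0 R B A (- pt P pt_first) M) => x xl.
    have := HM (- x); rewrite (solves_before Hf); last by lra.
    by rewrite /cval /= opprK addrC.
  have A0 : A != 0.
    apply: contraNneq fx1 => A0; have [m mn below] := points_below P x1.
    rewrite (Hf x1 m mn below) A0 B0.
    have E0 : ((0 : R[i]), (0 : R[i])) =
        (0 * ((1 : R[i]), (0 : R[i])).1, 0 * ((1 : R[i]), (0 : R[i])).2).
      by rewrite !mul0r.
    by rewrite E0 cchain_scale /cval /= !mul0r addr0.
  have : A * evC z W_poly = 0.
    apply: (@bounded_exp_eq0 R _ (A * evC z b_poly) (pt P pt_last) M) => x xl.
    have := HM x; rewrite (solves_after Hf) //.
    have E0 : (A, B) = (A * ((1 : R[i]), (0 : R[i])).1, A * ((1 : R[i]), (0 : R[i])).2).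
      by rewrite mulr1 mulr0 B0.
    by rewrite E0 cchain_scale full.
  by move/eqP; rewrite mulf_eq0 (negbTE A0) => /eqP.
- move=> W0; have [f sf Hf] := solution_exists P z 1 0.
  exists f; split => //.
    exists (pt P pt_first - 1); rewrite (solves_before Hf); last by lra.
    rewrite /cval /= mul0r addr0 mul1r.
    by rewrite fmorph_eq0 gt_eqF // expR_gt0.
  (* Only the first and the last gap are unbounded; there the coefficient of
     the growing exponential vanishes. *)
  pose a m := cmod (cchain z (1, 0) (take m l)).1 * expR (pt P pt_last / 2)
             + cmod (cchain z (1, 0) (take m l)).2 * expR (- pt P pt_first / 2).
  have a0 m : 0 <= a m by rewrite addr_ge0 // mulr_ge0 ?cmod_ge0 // expR_ge0.
  exists (\sum_(m < n.+1) a m) => x.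
  have [m mn below] := points_below P x.
  rewrite (Hf x m mn below); apply: (@le_trans _ _ (a m)); last first.
    by rewrite (bigD1 (Ordinal (mn : (m < n.+1)%N))) //= lerDl sumr_ge0.
  rewrite /cval (le_trans (cmodD _ _)) // !cmodM !cmod_real !ger0_norm ?expR_ge0 //.
  apply: lerD.
    have [mN|mN] := eqVneq m n.
      by rewrite mN -size_masses take_size full W0 /cmod normr0 !mul0r.
    rewrite ler_wpM2l ?cmod_ge0 // ler_expR ler_pM2r ?invr_gt0 //.
    rewrite leNgt; apply/negP => xl; have := below pt_last; rewrite xl /= => /esym.
    rewrite prednK ?npt_gt0 // => nm; case/negP: mN.
    by rewrite eqn_leq mn nm.
  case: (posnP m) => [->|m0].
    by rewrite take0 /= /cmod normr0 !mul0r.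
  rewrite ler_wpM2l ?cmod_ge0 // ler_expR ler_pM2r ?invr_gt0 // lerN2.
  by have := below pt_first; rewrite /= m0 => /ltW.
Qed.

(** A solution equal to [e^{-x/2}] near plus infinity has the coefficients
    [(0, 1)] there, and the coefficients elsewhere are found by crossing the masses
    backwards. *)
Lemma phi_plusE z : forall x m, (m <= n)%N -> (forall i, (pt P i < x) = (i < m)%N) ->
  phi_plus P z x = cval (evs z (rchain (0, 1) (drop m l))) x.
Proof.
rewrite /phi_plus; set S := [set f | _].
have [f0 sf0 Hf0] := solution_exists P z (evs z (rchain (0, 1) l)).1
   (evs z (rchain (0, 1) l)).2.
have fin : cchain z (evs z (rchain (0, 1) l)) l = (0, 1).
  by rewrite -[X in cchain _ _ X]take_size right_state drop_size /evs /= evC1 evC0.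
have S0 : S f0.
  split => //; exists (pt P pt_last); split; first exact: num_real.
  move=> x xl; rewrite (solves_after Hf0) // -surjective_pairing fin /cval /=.
  by rewrite mul0r add0r mul1r.
have [sg Sg] : S (xget (fun=> 0) S) by exact: (xgetPex _ (ex_intro _ f0 S0)).
set g := xget _ S in sg Sg *.
have [A [B Hg]] := solution_from sg.
have E : (A, B) = evs z (rchain (0, 1) l).
  apply: (cchain_inj (z := z) positive_masses); rewrite fin.
  case: Sg => M [_ HM].
  have H x : pt P pt_last < x -> M < x ->
     cval (cchain z (A, B) l) x = (expR (- x / 2))%:C.
    by move=> xl xM; rewrite -(solves_after Hg) // HM.
  case: (cchain z (A, B) l) H => al be H.
  pose x1 := Num.max (pt P pt_last) M + 1.
  have x1l : pt P pt_last < x1 by rewrite /x1 ltr_pwDr // le_max lexx.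
  have x1M : M < x1 by rewrite /x1 ltr_pwDr // le_max lexx orbT.
  have al0 : al = 0.
    apply: (@bounded_exp_eq0 R al (be - 1) x1 0) => x xx1.
    have := H x (lt_trans x1l xx1) (lt_trans x1M xx1); rewrite /cval /= => E.
    rewrite mulrBl mul1r addrA E subrr.
    by rewrite /cmod normr0.
  have := H x1 x1l x1M; rewrite al0 /cval /= mul0r add0r => E.
  congr (_, _); apply: (mulIf _ (etrans E (esym (mul1r _)))).
  by rewrite fmorph_eq0 gt_eqF // expR_gt0.
by move=> x m mn below; rewrite (Hg x m mn below) E right_state.
Qed.

End Pair.

(** * Direct and inverse spectral theorems *)

Section DirectTheorem.
Variables (R : realType) (P : dirac_pair R).
Local Notation l := (masses P).
Local Notation n := (npt P).
Local Notation W := (W_poly P).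
Local Notation b := (b_poly P).

Lemma phi_plus_real (r : R) x m : (m <= n)%N -> (forall i, (pt P i < x) = (i < m)%N) ->
  phi_plus P r%:C x = ((expR (- x / 2)) *
    ((rchain (0, 1) (drop m l)).2 + (expR x)%:P * (rchain (0, 1) (drop m l)).1).[r])%:C.
Proof.
move=> mn below; rewrite (phi_plusE _ mn below) /cval /evs /= !evC_real !real_complexM.
rewrite -rmorphD /= hornerD hornerM hornerC; congr (_%:C).
set C := _.1.[r]; set D := _.2.[r].
have pq := expR_half_inv x; rewrite -[expR x]expR_half_sqr.
set u := expR (x / 2) in pq *; set v := expR (- x / 2) in pq *.
have -> : v * (D + u ^+ 2 * C) = v * D + (u * v) * u * C by ring.
by rewrite pq; ring.
Qed.

Lemma phi_plus_pt (r : R) (i : 'I_n) :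
  cmod (phi_plus P r%:C (pt P i)) ^+ 2 = expR (pt P i) * (right_value l i).[r] ^+ 2.
Proof.
rewrite (phi_plus_real _ (ltnW (ltn_ord i)) (pt_below i)) cmod_real_sqr.
rewrite /right_value /mass_value nth_masses /= !hornerD !hornerM !hornerC.
set C := _.1.[r]; set D := _.2.[r]; rewrite exprMn -expRM_natl.
have -> : 2%:R * (- pt P i / 2) = - pt P i by field.
by rewrite expRN; field; rewrite gt_eqF ?expR_gt0.
Qed.

Lemma gamma2E (r : R) : gamma2 P r =
  \sum_(0 <= i < size l) ((nth_mass l i).1.2 + 2 * r * (nth_mass l i).2)
             * ((nth_mass l i).1.1 * (right_value l i).[r] ^+ 2).
Proof.
rewrite size_masses big_mkord /gamma2 mulr_sumr -big_split /=; apply: eq_bigr => i _.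
by rewrite phi_plus_pt nth_masses /=; ring.
Qed.

Lemma W_poly0 : W.[0] = 1.
Proof. by have := pchain_at0 l (1, 0) => -[-> _]; rewrite hornerC. Qed.

Lemma W_eigen (r : R) : is_eigenvalue P r%:C <-> W.[r] = 0.
Proof.
rewrite eigenvalueE evC_real; split => [/eqP|->//].
by rewrite fmorph_eq0 => /eqP.
Qed.

Variables (N : nat) (lam : 'I_N -> R).
Hypothesis spec : is_spectrum P lam.

Lemma spectrum_inj : injective lam.
Proof.
have [inc _] := spec; move=> i j E; apply/val_inj.
by case: (ltngtP i j) => // /inc; rewrite E ltxx.
Qed.

Lemma spectrum_root i : W.[lam i] = 0.
Proof. by apply/W_eigen; have [_ ->] := spec; exists i. Qed.

Lemma spectrum_neq0 i : lam i != 0.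
Proof.
have := spectrum_root i; case: eqVneq => // ->.
by rewrite W_poly0 => /eqP; rewrite oner_eq0.
Qed.

(** The roots of [W] are the eigenvalues; they are simple since [W'] does not
    vanish there. *)
Lemma W_poly_charpoly : (0 < N)%N -> W = charpoly lam.
Proof.
move=> N0; have [inc sp] := spec.
have Wn0 : W != 0 by apply: contra_eq_neq W_poly0 => ->; rewrite horner0 eq_sym oner_eq0.
have [rs EW] : exists rs, W = lead_coef W *: \prod_(r <- rs) ('X - r%:P).
  apply: real_roots_split => // z /eqP zW.
  have /sp[i ->] : is_eigenvalue P z by apply/eigenvalueE.
  by [].
have rt r : root W r = (r \in rs) by rewrite (horner_split_root Wn0 EW).
have urs : uniq rs.
  apply: uniq_simple_roots => r; rewrite -rt => /eqP Wr.
  have [b0 dW g0] := chain_eigen (admissible_masses P) Wr.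
  have : W^`().[r] != 0.
    rewrite dW mulf_neq0 ?oppr_eq0 //; apply: contraTneq g0 => ->.
    by rewrite mulr0 ltxx.
  by rewrite {1}EW derivZ hornerZ mulf_eq0 negb_or => /andP[].
have rsE : rs =i lamseq lam.
  move=> r; rewrite -rt; apply/idP/idP.
    move=> /eqP Wr; have /sp[i [->]] : is_eigenvalue P r%:C by apply/W_eigen.
    by rewrite map_f ?mem_enum.
  by move=> /mapP[i _ ->]; rewrite rootE spectrum_root.
have sz : size rs = N.
  by rewrite -(size_lamseq lam); apply/perm_size/uniq_perm => //; exact: lamseq_uniq spectrum_inj.
apply: (charpoly_unique spectrum_inj spectrum_neq0).
- by rewrite EW size_scale ?lead_coef_eq0 // size_prod_XsubC sz.
- exact: W_poly0.
- exact: spectrum_root.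
Qed.

Lemma coupling_gt0 i : 0 < lam i * gamma2 P (lam i).
Proof.
by have [_ _] := chain_eigen (admissible_masses P) (spectrum_root i); rewrite -gamma2E.
Qed.

Lemma coupling_deriv i : W^`().[lam i] = - b.[lam i] * gamma2 P (lam i).
Proof.
by have [_ + _] := chain_eigen (admissible_masses P) (spectrum_root i); rewrite -gamma2E.
Qed.

(** [p] and [q] come from the chains on the two sides of [a].  Their proportionality
    at an eigenvalue, with factor [b], becomes the last clause of [interior_pair]
    once [b] is expressed by [W' = - b gamma^2]. *)
Theorem direct_spectral (a : R) : (0 < N)%N ->
  exists m p q,
    interior_pair lam (fun i => expR (- a) / (lam i * gamma2 P (lam i))) m p q
    /\ forall i, cmod (eigenfunction P (lam i) a) ^+ 2 =
         expR (- a) / (lam i * gamma2 P (lam i)) * p.[lam i] ^+ 2.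
Proof.
move=> N0; have [m mn below] := points_below P a.
pose l1 := take m l; pose l2 := drop m l.
have adm := admissible_masses P.
have [a1 a2] : admissible l1 /\ admissible l2.
  move: adm; rewrite /admissible -[l](cat_take_drop m) pairwise_cat all_cat.
  by move=> /andP[/and3P[_ -> ->] /andP[-> ->]].
have p2 := admissible_positive a2.
have x0 : 0 < expR a by exact: expR_gt0.
have h1 t : t \in l1 -> t.1.1 < expR a.
  move=> /(nthP (0, 0, 0)) [j]; rewrite size_take size_masses => il <-.
  have im : (j < m)%N.
    by move: il; case: (ltnP m n) => // nm il; exact: leq_trans il nm.
  have ni : (j < n)%N by apply: leq_trans im mn.
  rewrite nth_take // -/(nth_mass l j) -[j]/(nat_of_ord (Ordinal ni)) nth_masses /=.
  by rewrite ltr_expR below.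
have h2 t : t \in l2 -> expR a <= t.1.1.
  move=> /(nthP (0, 0, 0)) [j]; rewrite size_drop size_masses => il <-.
  have ni : (m + j < n)%N by rewrite -ltn_subRL.
  rewrite nth_drop -/(nth_mass l (m + j)) -[(m + j)%N]/(nat_of_ord (Ordinal ni)).
  by rewrite nth_masses /= ler_expR leNgt below /= -leqNgt leq_addr.
have [d1 [d2 [sW sp sq pos]]] := split_lead a1 a2 x0 h1 h2.
have WE : (rchain (0, 1) l2).2 * (pchain (1, 0) l1).1
   - (rchain (0, 1) l2).1 * (pchain (1, 0) l1).2 = charpoly lam.
  by rewrite -wronskian_split // cat_take_drop -W_poly_charpoly.
rewrite WE in sW pos.
have NE : N = (d1 + d2)%N.
  by apply: succn_inj; rewrite -sW (size_charpoly spectrum_neq0).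
have at0l : ((pchain (1, 0) l1).1.[0], (pchain (1, 0) l1).2.[0]) = (1, 0).
  by rewrite pchain_at0; congr (_, _); [exact: hornerC|exact: horner0].
have at0r : ((rchain (0, 1) l2).1.[0], (rchain (0, 1) l2).2.[0]) = (0, 1).
  by rewrite rchain_at0; congr (_, _); [exact: horner0|exact: hornerC].
have [A0 B0] := at0l; have [C0 D0] := at0r.
exists d2, ((rchain (0, 1) l2).2 + (expR a)%:P * (rchain (0, 1) l2).1),
  ((pchain (1, 0) l1).1 + ((expR a)^-1)%:P * (pchain (1, 0) l1).2); split.
  have Nd : (N - d2 = d1)%N by rewrite NE addnK.
  split.
  - by rewrite Nd; split => //; rewrite NE leq_addl.
  - by rewrite hornerD hornerM C0 D0 mulr0 addr0.
  - by rewrite hornerD hornerM A0 B0 mulr0 addr0.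
  - by rewrite Nd {2}NE.
  - move=> i; have [] := @eigen_proportional _ l1 l2 (lam i) p2.
      by rewrite cat_take_drop; exact: spectrum_root.
    rewrite cat_take_drop -/b !hornerD !hornerM !hornerC => -> ->.
    have dW := coupling_deriv i; rewrite W_poly_charpoly // in dW.
    have g0 := coupling_gt0 i.
    have gn0 : gamma2 P (lam i) != 0.
      by apply: contraTneq g0 => ->; rewrite mulr0 ltxx.
    rewrite dW expRN; field.
    by rewrite spectrum_neq0 gn0 gt_eqF.
move=> i; rewrite /eigenfunction (phi_plus_real _ mn below) -/l2.
rewrite -fmorphV real_complexM cmod_real_sqr !exprMn exprVn sqr_sqrtr; last first.
  by rewrite ltW // coupling_gt0.
rewrite -expRM_natl; have -> : 2%:R * (- a / 2) = - a by field.
by rewrite mulrAC.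
Qed.

End DirectTheorem.

Section InverseTheorem.
Variables (R : realType).

Lemma pair_of_masses (l : seq (R * R * R)) : admissible l -> (0 < size l)%N ->
  exists P : dirac_pair R, masses P = l.
Proof.
move=> adm l0; have [pw al] := andP adm.
have lp (i : 'I_(size l)) : [&& 0 < (nth_mass l i).1.1, 0 <= (nth_mass l i).2
     & 0 < `|(nth_mass l i).1.2| + (nth_mass l i).2].
  by apply: (allP al); rewrite mem_nth.
pose x (i : 'I_(size l)) := ln (nth_mass l i).1.1.
have xinc (i j : 'I_(size l)) : (i < j)%N -> x i < x j.
  move=> ij; rewrite /x ltr_ln ?posrE.
  - by have /(_ i j) := pairwiseP (0, 0, 0) pw; rewrite !inE !ltn_ord; apply.
  - by have /and3P[] := lp i.
  - by have /and3P[] := lp j.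
have v0 (i : 'I_(size l)) : 0 <= (nth_mass l i).2 by have /and3P[] := lp i.
have w0 (i : 'I_(size l)) : 0 < `|(nth_mass l i).1.2| + (nth_mass l i).2.
  by have /and3P[] := lp i.
exists (DiracPair l0 xinc v0 w0).
apply: (@eq_from_nth _ (0, 0, 0)); first by rewrite size_masses.
move=> i; rewrite size_masses /= => il.
have := @nth_masses _ (DiracPair l0 xinc v0 w0) (Ordinal il).
rewrite /nth_mass /= => ->; rewrite /x lnK; last by rewrite posrE; have /and3P[] := lp (Ordinal il).
by rewrite /nth_mass; case: (nth _ _ _) => [[u v] w].
Qed.

(** By the formula [W' = - b gamma^2] the spectral data prescribe [b] at the
    eigenvalues, and [b] vanishes at [0]; interpolation gives the input of the
    inverse problem for chains. *)
Theorem inverse_spectral N (lam s : 'I_N -> R) : (0 < N)%N ->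
  (forall i j : 'I_N, (i < j)%N -> lam i < lam j) ->
  (forall i, lam i != 0) -> (forall i, 0 < s i) ->
  exists P : dirac_pair R, is_spectrum P lam
    /\ forall i, lam i * gamma2 P (lam i) = s i.
Proof.
move=> N0 inc lam0 s0.
have inj : injective lam.
  move=> i j E; apply/val_inj.
  by case: (ltngtP i j) => // /inc; rewrite E ltxx.
pose W := charpoly lam; pose c := W`_N.
have sW : size W = N.+1 by exact: size_charpoly.
have EW : W = c *: \prod_(r <- lamseq lam) ('X - r%:P).
  by rewrite /c /W charpoly_coefN // -charpoly_split.
pose b := - ('X * \sum_(i < N) (s i)^-1 *: cofactor_at c (lamseq lam) (lam i)).
have mem i : lam i \in lamseq lam by rewrite map_f ?mem_enum.
have bl i : b.[lam i] = - (lam i * W^`().[lam i] / s i).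
  rewrite /b hornerN hornerM hornerX horner_sum (bigD1 i) //= big1 => [|j ji].
    by rewrite addr0 hornerZ cofactor_at_self // -EW; congr (- _); ring.
  by rewrite hornerZ cofactor_at_other ?mulr0 // (inj_eq inj) eq_sym.
have W0 : W.[0] = 1 by exact: charpoly0.
have b0 : b.[0] = 0 by rewrite /b hornerN hornerM hornerX mul0r oppr0.
have sb : (size b <= size W)%N.
  rewrite /b size_polyN sW mulrC; set S := \sum_(i < N) _.
  have [->|Sn0] := eqVneq S 0; first by rewrite mul0r size_poly0.
  rewrite size_mulX // ltnS (leq_trans (size_sum _ _ _)) //.
  apply/bigmax_leqP => i _; rewrite (leq_trans (size_scale_leq _ _)) //.
  rewrite (leq_trans (size_scale_leq _ _)) // size_prod_XsubC size_rem //.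
  by rewrite size_lamseq prednK.
have lW : lead_coef W = c by rewrite charpoly_lead.
have neg r : root W r -> r * b.[r] * W^`().[r] < 0.
  rewrite charpoly_root // => /mapP[i _ ->]; rewrite bl.
  rewrite (_ : _ * _ * _ = - ((lam i * W^`().[lam i]) ^+ 2 / s i)); last by ring.
  rewrite oppr_lt0 divr_gt0 // exprn_even_gt0 //= mulf_neq0 //.
  exact: charpoly_deriv.
have [|l [cl adm _]] := @inverse_chain R N W b (lamseq lam) sW W0 b0 sb (lamseq_uniq inj) _ neg.
  by rewrite lW.
have l0 : (0 < size l)%N.
  rewrite lt0n; apply/negP => /eqP /size0nil l0; move: cl; rewrite l0 => -[W1 _].
  by move: sW; rewrite -W1 size_poly1 => -[E]; rewrite -E in N0.
have [P EP] := pair_of_masses adm l0.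
have WP : W_poly P = W by rewrite /W_poly EP cl.
have bP : b_poly P = b by rewrite /b_poly EP cl.
have sp : is_spectrum P lam.
  split => // z; rewrite eigenvalueE WP; split.
    rewrite /evC EW /toC -mul_polyC rmorphM rmorph_prod /= map_polyC hornerM hornerC.
    move=> /eqP; rewrite mulf_eq0 fmorph_eq0 (negbTE (charpoly_coefN_neq0 lam0)) /=.
    rewrite horner_prod prodf_seq_eq0 => /hasP[r /mapP[i _ ->]] /=.
    rewrite rmorphB /= map_polyX map_polyC hornerD hornerN hornerX hornerC subr_eq0.
    by move=> /eqP ->; exists i.
  by move=> [i ->]; rewrite evC_real charpoly_lam.
exists P; split => // i.
have := coupling_deriv sp i; rewrite WP bP bl => E.
have d0 := charpoly_deriv inj lam0 i; rewrite -/W in d0.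
have sn0 : s i != 0 by rewrite gt_eqF.
have : lam i * gamma2 P (lam i) * W^`().[lam i] = s i * W^`().[lam i].
  by rewrite {2}E; field.
exact: mulIf.
Qed.

End InverseTheorem.

(** * Slices: fixed coordinates and free positive ones *)

Section MatrixContinuity.
Variables (R : realType) (T : topologicalType) (m n : nat).

Lemma continuous_mx (f : T -> 'M[R]_(m, n)) :
  (forall i j, continuous (fun x => f x i j)) -> continuous f.
Proof.
move=> H x U [Q HQ QU]; change (\forall t \near x, U (f t)).
have : \forall t \near x, forall i j, Q i j (f t i j).
  by apply: filter_forall => i; apply: filter_forall => j; exact: (H i j x _ (HQ i j)).
by apply: filterS => t Ht; apply: QU.
Qed.

Lemma open_positive : open [set t : 'M[R]_(m, n) | forall i j, 0 < t i j].
Proof.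
rewrite openE => t Ht; exists (fun _ _ => [set x : R | 0 < x]).
  by move=> i j; exact: (lt_nbhsr (Ht i j)).
by move=> s Hs i j; exact: Hs.
Qed.

End MatrixContinuity.

Section Slices.
Variables (R : realType) (N : nat) (L : 'rV[R]_N) (K : {set 'I_N}).
Variables (T : finType) (c : T -> 'I_N -> R).
Hypothesis c_inj : forall A B, (forall i, i \notin K -> c A i = c B i) -> A = B.

Definition slice A : set 'rV[R]_(N + N) :=
  [set s | exists r : 'rV[R]_N, [/\ s = row_mx L r,
     forall i, i \notin K -> r 0 i = c A i & forall i, i \in K -> 0 < r 0 i]].

Definition slices : set 'rV[R]_(N + N) := \bigcup_A slice A.

Lemma slice_convex A s t (u : R) : slice A s -> slice A t -> 0 <= u <= 1 ->
  slice A (s + u *: (t - s)).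
Proof.
move=> [r [-> rC rK]] [r' [-> rC' rK']] /andP[u0 u1].
exists (r + u *: (r' - r)); split.
- by rewrite opp_row_mx add_row_mx subrr scale_row_mx scaler0 add_row_mx addr0.
- by move=> i iK; rewrite !mxE rC // rC' // subrr mulr0 addr0.
- move=> i iK; rewrite !mxE.
  have h := rK i iK; have h' := rK' i iK.
  have -> : r 0 i + u * (r' 0 i - r 0 i) = (1 - u) * r 0 i + u * r' 0 i by ring.
  have [->|un0] := eqVneq u 0; first by rewrite subr0 mul1r mul0r addr0.
  apply: ltr_wpDl; first by rewrite mulr_ge0 ?subr_ge0 // ltW.
  by rewrite mulr_gt0 // lt_neqAle eq_sym un0.
Qed.

Definition slice_point A : 'rV[R]_(N + N) :=
  row_mx L (\row_i if i \in K then 1 else c A i).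

Lemma slice_nonempty A : slice A (slice_point A).
Proof.
exists (\row_i if i \in K then 1 else c A i); split => // i iK; rewrite mxE.
  by rewrite (negbTE iK).
by rewrite iK ltr01.
Qed.

Lemma slice_connected A : connected (slice A).
Proof.
pose s0 := slice_point A.
(* A convex set is a union of segments from one of its points. *)
pose seg t : set 'rV[R]_(N + N) := (fun u : R => s0 + u *: (t - s0)) @` `[0, 1].
have -> : slice A = \bigcup_(t in slice A) seg t.
  apply/seteqP; split => [t At|t [t' At' [u]]].
    exists t => //; exists 1; first by rewrite /= in_itv /= ler01 lexx.
    by rewrite scale1r addrC subrK.
  rewrite /= in_itv /= => u01 <-; apply: slice_convex => //.
  exact: slice_nonempty.
apply: bigcup_connected.
  exists s0 => t At; exists 0; first by rewrite /= in_itv /= lexx ler01.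
  by rewrite scale0r addr0.
move=> t At; apply: connected_continuous_connected; first exact: segment_connected.
apply: continuous_subspaceT; apply: continuous_mx => i j x.
rewrite (_ : (fun u : R => _) = (fun u : R => s0 i j + u * (t - s0) i j)); last first.
  by apply/funext => u; rewrite !mxE.
by apply: cvgD; [exact: cvg_cst|apply: cvgM; [exact: cvg_id|exact: cvg_cst]].
Qed.

(** A connected set of reals is an interval. *)
Lemma connected_finite_values (I : finType) (v : I -> R) (E : set R) :
  connected E -> (forall x, E x -> exists i, x = v i) -> forall x y, E x -> E y -> x = y.
Proof.
move=> /connected_intervalP itvE fin.
suff lt x y : E x -> E y -> ~ x < y.
  by move=> x y Ex Ey; case: (ltgtP x y) => // h; case: (lt _ _ _ _ h).
move=> Ex Ey xy.
have [e e0 ev] := points_gap v x.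
pose d := Num.min e (y - x) / 2.
have m0 : 0 < Num.min e (y - x) by rewrite lt_min e0 subr_gt0.
have d0 : 0 < d by rewrite divr_gt0.
have [de dy] : d < e /\ d < y - x.
  have : d < Num.min e (y - x) by rewrite ltr_pdivrMr // mulrDr mulr1 ltrDl.
  by rewrite lt_min => /andP[].
have [|i Ei] := fin (x + d).
  by apply: (itvE x y) => //; apply/andP; split; lra.
have : v i != x by rewrite -Ei gt_eqF //; lra.
by move/ev; rewrite -Ei addrAC subrr add0r gtr0_norm // leNgt de.
Qed.

Lemma slice_sub A : slice A `<=` slices.
Proof. by move=> s As; exists A. Qed.

(** On a connected subset each coordinate outside [K] is constant, because it
    takes values in a finite set; these coordinates determine [A]. *)
Lemma slice_component A s : slice A s -> connected_component slices s = slice A.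
Proof.
move=> As; apply/seteqP; split; last first.
  exact: connected_component_max As (@slice_sub A) (@slice_connected A).
move=> t Ct; have [B _ Bt] := connected_component_sub Ct.
suff -> : A = B by [].
have cC := @component_connected _ slices s.
have Cs : connected_component slices s s.
  by apply: connected_component_refl; exact: slice_sub As.
apply: c_inj => i iK.
have [r [Er rC _]] := As; have [r' [Er' rC' _]] := Bt.
rewrite -rC // -rC' //.
pose f (u : 'rV[R]_(N + N)) := u 0 (rshift N i).
have cf : continuous f by exact: coord_continuous.
have fE : connected (f @` connected_component slices s).
  by apply: connected_continuous_connected cC _; exact: continuous_subspaceT.
have -> : r 0 i = f s by rewrite /f Er row_mxEr.
have -> : r' 0 i = f t by rewrite /f Er' row_mxEr.
apply: (connected_finite_values (v := fun D : T => c D i) fE); last 2 first.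
- by exists s.
- by exists t.
move=> x [u Cu <-]; have [D _ [ru [Eu uC _]]] := connected_component_sub Cu.
by exists D; rewrite /f Eu row_mxEr uC.
Qed.

Lemma slice_inj : injective slice.
Proof.
move=> A B E; have := slice_nonempty A; rewrite E => -[r [/eq_row_mx[_ <-] rC _]].
by apply: c_inj => i iK; rewrite -rC // mxE (negbTE iK).
Qed.

Lemma components_card :
  ([set connected_component slices s | s in slices] #= `I_#|T|)%card.
Proof.
have -> : [set connected_component slices s | s in slices] = range slice.
  apply/seteqP; split => [C [s [A _ As] <-]|C [A _ <-]].
    by exists A => //; rewrite (slice_component As).
  exists (slice_point A); first exact: slice_sub (slice_nonempty A).
  exact: slice_component (slice_nonempty A).
have -> : `I_#|T| = range (fun A : T => enum_rank A : nat).
  apply/seteqP; split => [j /= jT|j [A _ <-]]; last exact: ltn_ord.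
  by exists (enum_val (Ordinal jT)) => //; rewrite enum_valK.
apply: (card_eq_trans (inj_card_eq _)).
  by move=> A B _ _; exact: slice_inj.
rewrite card_eq_sym; apply: inj_card_eq => A B _ _ /val_inj.
exact: enum_rank_inj.
Qed.

Lemma slice_manifold A : is_manifold #|K| (slice A).
Proof.
move=> p Ap.
pose f (s : 'rV[R]_(N + N)) : 'rV[R]_#|K| := \row_j s 0 (rshift N (enum_val j)).
pose g (t : 'rV[R]_#|K|) : 'rV[R]_(N + N) := row_mx L
  (\row_i if [pick j | enum_val j == i] is Some j then t 0 j else c A i).
exists setT, [set t : 'rV[R]_#|K| | forall i j, 0 < t i j], f, g.
have pickK i (iK : i \in K) :
    exists2 j, [pick j : 'I_#|K| | enum_val j == i] = Some j & enum_val j = i.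
  case: pickP => [j /eqP ji|no]; first by exists j.
  by have := no (enum_rank_in iK i); rewrite enum_rankK_in // eqxx.
have pickN i : i \notin K -> [pick j : 'I_#|K| | enum_val j == i] = None.
  by move=> iK; case: pickP => // j /eqP ji; move: iK; rewrite -ji enum_valP.
have pickE (j0 : 'I_#|K|) : [pick j : 'I_#|K| | enum_val j == enum_val j0] = Some j0.
  case: pickP => [j /eqP /enum_val_inj -> //|no].
  by have := no j0; rewrite eqxx.
have gf x : slice A x -> g (f x) = x.
  move=> [r [-> rC _]]; rewrite /g; congr row_mx; apply/rowP => i; rewrite mxE.
  case: (boolP (i \in K)) => iK.
    have [j -> ji] := pickK i iK; by rewrite mxE row_mxEr ji.
  by rewrite pickN // rC.
split; first by split; [exact: openT| |exact: open_positive].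
split.
- split.
  + move=> s [[r [-> _ rK]] _] i j /=; rewrite mxE row_mxEr.
    by apply: rK; exact: enum_valP.
  + move=> s t; rewrite !inE => -[As _] [At _] E.
    by rewrite -(gf s As) E gf.
  + move=> t Ht /=; exists (g t); last first.
      by apply/rowP => j; rewrite mxE /g row_mxEr mxE pickE.
    split => //; exists (\row_i if [pick j | enum_val j == i] is Some j then t 0 j else c A i).
    split => // i iK; rewrite mxE; first by rewrite pickN.
    by have [j -> _] := pickK i iK.
- by move=> x [Ax _]; exact: gf.
- apply: continuous_subspaceT; apply: continuous_mx => i j.
  rewrite (_ : (fun x => _) = (fun x : 'rV[R]_(N + N) => x 0 (rshift N (enum_val j)))).
    exact: coord_continuous.
  by apply/funext => x; rewrite mxE.
- apply: continuous_subspaceT; apply: continuous_mx => i j.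
  rewrite (ord1 i) -(splitK j); case: (fintype.split j) => j' /=.
    rewrite (_ : (fun x => _) = (fun=> L 0 j')); first exact: cst_continuous.
    by apply/funext => x; rewrite /g row_mxEl.
  case E : [pick j0 : 'I_#|K| | enum_val j0 == j'] => [j0|].
    rewrite (_ : (fun x => _) = (fun x : 'rV[R]_#|K| => x 0 j0)).
      exact: coord_continuous.
    by apply/funext => x; rewrite /g row_mxEr mxE E.
  rewrite (_ : (fun x => _) = (fun=> c A j')); first exact: cst_continuous.
  by apply/funext => x; rewrite /g row_mxEr mxE E.
Qed.

Theorem slices_manifold_collection : is_manifold_collection #|T| #|K| slices.
Proof.
split; first exact: components_card.
move=> s [A _ As]; rewrite (slice_component As); exact: slice_manifold.
Qed.

End Slices.

(** * Pairs with the same interior data *)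

Section IsospectralData.
Variables (R : realType) (a : R) (N : nat) (lam : 'I_N -> R) (phi : 'I_N -> R[i]).

Lemma spectrum_unique (P : dirac_pair R) (lam' : 'I_N -> R) :
  is_spectrum P lam -> is_spectrum P lam' -> lam = lam'.
Proof.
move=> [inc sp] [inc' sp'].
have srt (f : 'I_N -> R) : (forall i j : 'I_N, (i < j)%N -> f i < f j) ->
    sorted <%O [seq f i | i <- enum 'I_N].
  move=> finc; rewrite sorted_map.
  have : sorted ltn [seq val i | i <- enum 'I_N] by rewrite val_enum_ord iota_ltn_sorted.
  by rewrite sorted_map; apply: sub_sorted => i j; exact: finc.
have img : [seq lam i | i <- enum 'I_N] = [seq lam' i | i <- enum 'I_N].
  apply: (lt_sorted_eq (srt _ inc) (srt _ inc')) => r; apply/mapP/mapP => -[j _ ->].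
    have /sp' [j' [E]] : is_eigenvalue P (lam j)%:C by apply/sp; exists j.
    by exists j'; rewrite ?mem_enum.
  have /sp [j' [E]] : is_eigenvalue P (lam' j)%:C by apply/sp'; exists j.
  by exists j'; rewrite ?mem_enum.
apply/funext => i; have := congr1 (fun s => nth 0 s i) img.
have nthE (f : 'I_N -> R) : nth 0 [seq f j | j <- enum 'I_N] i = f i.
  by rewrite (nth_map i) ?size_enum_ord ?nth_ord_enum.
by rewrite !nthE.
Qed.

Hypothesis hdata : exists P : dirac_pair R, is_interior_data P a lam phi.
Hypothesis N0 : (0 < N)%N.
Local Notation amp := (fun i => cmod (phi i) ^+ 2).
Local Notation K := [set i | amp i == 0]%SET.

Lemma card_K : #|K| = #|[pred i | phi i == 0]|.
Proof.
apply: eq_card => i; rewrite !inE sqrf_eq0; exact: cmod_eq0.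
Qed.

(** The value of [lam_i gamma_i^2] that the right factor [p] forces at an
    eigenvalue whose eigenfunction does not vanish at [a]. *)
Definition forced_weight (p : {poly R}) i : R := expR (- a) * p.[lam i] ^+ 2 / amp i.

(** Measures with the given interior data correspond to subsets of the zeros in
    [Z] together with free positive weights on [K].  From measures to subsets, the
    polynomial [p] of the measures is a subfactor.  From subsets to measures, the
    inverse theorem applies to the forced weights, and uniqueness of interior pairs
    identifies the polynomial [p] of the measures found. *)
Lemma isospectral_slices : exists Z : seq R,
  let f (A : {set 'I_(size Z)}) := forced_weight (subfactor lam amp A) in
  [/\ forall A B, (forall i, i \notin K -> f A i = f B i) -> A = B,
      isospectral_data a lam phi = slices (\row_i lam i) K f
    & [/\ green_coef0 amp = 0 -> green_coef1 lam amp = 0 ->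
            (2 * #|K| + 2 <= N)%N /\ size Z = (N - 2 * #|K| - 2)%N,
          green_coef0 amp = 0 -> green_coef1 lam amp <> 0 ->
            (2 * #|K| + 1 <= N)%N /\ size Z = (N - 2 * #|K| - 1)%N
        & green_coef0 amp <> 0 -> (2 * #|K| <= N)%N /\ size Z = (N - 2 * #|K|)%N]].
Proof.
have [P [spP phiE]] := hdata.
have lam_inj := spectrum_inj spP; have lam0 := spectrum_neq0 spP.
have [inc _] := spP.
have ea : 0 < expR (- a) by exact: expR_gt0.
pose mu0 i := expR (- a) / (lam i * gamma2 P (lam i)).
have mu0_gt0 i : 0 < mu0 i by rewrite divr_gt0 // (coupling_gt0 spP).
have [n0 [p0 [q0 [ip0 x0]]]] := direct_spectral spP a N0.
have xE i : amp i = mu0 i * p0.[lam i] ^+ 2 by rewrite phiE x0.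
have [Z [uZ Z0 g0Z large]] := zeros_between lam_inj lam0 mu0_gt0 ip0 xE.
exists Z => f.
have x_pos i : i \notin K -> 0 < amp i.
  by rewrite inE => xi; rewrite lt_neqAle eq_sym xi sqr_ge0.
have f_pos A i : i \notin K -> 0 < f A i.
  move=> iK; rewrite /f /forced_weight divr_gt0 ?x_pos // mulr_gt0 //.
  by rewrite exprn_even_gt0 //= (subfactor_C lam_inj lam0 ip0 xE g0Z).
have fE A i : i \notin K -> (subfactor lam amp A).[lam i] ^+ 2 = f A i * amp i / expR (- a).
  move=> iK; rewrite /f /forced_weight divfK ?gt_eqF ?x_pos //.
  by rewrite mulrC mulKf // gt_eqF.
split.
- move=> A B fAB; apply: (subfactor_inj lam_inj lam0 N0 mu0_gt0 ip0 xE uZ Z0 g0Z) => i iK.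
  by rewrite !fE // fAB.
- apply/seteqP; split => s.
  + move=> [Q [lam' [phi' [[spQ phiQ] same]]] [lam'' [spQ'' ->]]].
    have lamE : lam' = lam by apply/funext => i; have [] := same i.
    rewrite {lam'}lamE in spQ phiQ same.
    rewrite -(spectrum_unique spQ spQ'').
    have [m [p [q [ip y]]]] := direct_spectral spQ a N0.
    pose mu i := expR (- a) / (lam i * gamma2 Q (lam i)).
    have cpl i : 0 < lam i * gamma2 Q (lam i) by exact: coupling_gt0 spQ i.
    have mu_gt0 i : 0 < mu i by rewrite divr_gt0.
    have xQ i : amp i = mu i * p.[lam i] ^+ 2 by rewrite -y -phiQ; have [_ ->] := same i.
    have [A EA] := interior_subfactor lam_inj lam0 ip0 xE Z0 g0Z mu_gt0 ip xQ.
    exists A => //; exists (\row_i (lam i * gamma2 Q (lam i))); split => //.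
      move=> i iK; rewrite mxE /f /forced_weight -EA.
      have := x_pos i iK; rewrite xQ => xp.
      have pn0 : p.[lam i] != 0 by apply: contraTneq xp => ->; rewrite expr0n mulr0 ltxx.
      rewrite /mu; field; rewrite pn0 /=.
      have := cpl i; rewrite lt_neqAle eq_sym mulf_eq0 negb_or => /andP[/andP[-> ->] _].
      by rewrite gt_eqF.
    by move=> i _; rewrite mxE.
  + move=> [A _ [r [-> rC rK]]].
    have r_pos i : 0 < r 0 i.
      by case: (boolP (i \in K)) => iK; [exact: rK|rewrite rC // f_pos].
    have [Q [spQ gQ]] := inverse_spectral N0 inc lam0 r_pos.
    have [m [p [q [ip y]]]] := direct_spectral spQ a N0.
    pose mu i := expR (- a) / r 0 i.
    have mu_gt0 i : 0 < mu i by rewrite divr_gt0.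
    have muE : (fun i => expR (- a) / (lam i * gamma2 Q (lam i))) = mu.
      by apply/funext => i; rewrite gQ.
    rewrite muE in ip.
    have xA i : i \notin K -> amp i = mu i * (subfactor lam amp A).[lam i] ^+ 2.
      move=> iK; rewrite fE // /mu rC //; field.
      by rewrite !gt_eqF // f_pos.
    have ipA := subfactor_interior lam_inj lam0 ip0 xE Z0 g0Z xA.
    have EA := interior_unique lam_inj lam0 N0 mu_gt0 ip ipA.
    exists Q; last first.
      exists lam; split => //; congr row_mx; apply/rowP => i.
      by rewrite !mxE gQ.
    exists lam, (fun i => eigenfunction Q (lam i) a); split; first by split.
    move=> i; split => //.
    have sqE : cmod (eigenfunction Q (lam i) a) ^+ 2 = cmod (phi i) ^+ 2.
      rewrite y gQ EA; case: (boolP (i \in K)) => iK; last by rewrite -/(mu i) -xA.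
      by rewrite subfactor_K // expr0n mulr0; move: iK; rewrite inE => /eqP ->.
    by apply/eqP; rewrite -(eqrXn2 (n := 2)) ?cmod_ge0 // sqE.
- exact: (zeros_count lam_inj lam0 N0 ip0 xE Z0 g0Z large).
Qed.

End IsospectralData.

Lemma positive_values_infinite (R : realType) (T : Type) (F : T -> R) (S : set T) :
  (forall r : R, 0 < r -> exists2 t, S t & F t = r) -> infinite_set S.
Proof.
move=> H fS; have fF := finite_image F fS.
have fN : finite_set (range (fun n : nat => n.+1%:R : R)).
  apply: sub_finite_set fF => r [n _ <-].
  by have [t St Ft] := H n.+1%:R (ltr0Sn _ _); exists t.
have cE : (range (fun n : nat => n.+1%:R : R) #= [set: nat])%card.
  by apply: inj_card_eq => m n _ _ /eqP; rewrite eqr_nat => /eqP [].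
by apply: infinite_nat; rewrite -(eq_finite_set cE).
Qed.

Unset Implicit Arguments.

(* The inequalities on 2 * k only say that the (truncated) exponents are the
   intended integers. *)
Theorem theorem4p9 (R : realType) (a : R) (N k : nat)
    (lam : 'I_N -> R) (phi : 'I_N -> R[i])
    (hdata : exists P : dirac_pair R, is_interior_data P a lam phi)
    (hk : #|[pred i | phi i == 0]| = k) (hk1 : (1 <= k)%N) :
  infinite_set (isospectral_pairs a lam phi)
  /\ [/\ interior_alpha phi = 0 -> interior_beta lam phi = 0 ->
           (2 * k + 2 <= N)%N
           /\ is_manifold_collection (2 ^ (N - 2 * k - 2)) k
                (isospectral_data a lam phi),
         interior_alpha phi = 0 -> interior_beta lam phi <> 0 ->
           (2 * k + 1 <= N)%N
           /\ is_manifold_collection (2 ^ (N - 2 * k - 1)) k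
                (isospectral_data a lam phi)
       & interior_alpha phi <> 0 ->
           (2 * k <= N)%N
           /\ is_manifold_collection (2 ^ (N - 2 * k)) k
                (isospectral_data a lam phi)].
Proof.
have N0 : (0 < N)%N.
  by rewrite (leq_trans hk1) // -hk -[leqRHS]card_ord max_card.
have [Z [f_inj dataE [c1 c2 c3]]] := isospectral_slices hdata N0.
have coll := slices_manifold_collection (\row_i lam i) f_inj.
have cardZ : #|{set 'I_(size Z)}| = (2 ^ size Z)%N.
  by rewrite -[LHS]cardsT -finset.powersetT card_powerset cardsT card_ord.
rewrite card_K hk in c1 c2 c3; rewrite -dataE card_K hk cardZ in coll.
split; last first.
  split => [a0 b0|a0 b0|a0].
  - by have [h <-] := c1 a0 b0.
  - by have [h <-] := c2 a0 b0.
  - by have [h <-] := c3 a0.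
have [i iK] : exists i, i \in [set i | cmod (phi i) ^+ 2 == 0]%SET.
  by apply/card_gt0P; rewrite card_K hk.
(* A free coordinate of the spectral data takes all positive values. *)
pose F (Q : dirac_pair R) : R := (xget 0 [set s | is_spectral_data (N := N) Q s]) 0 (rshift N i).
refine (@positive_values_infinite R _ F _ _) => r r0.
pose w := \row_j (if j == i then r else if j \in [set i | cmod (phi i) ^+ 2 == 0]%SET
  then 1 else forced_weight a lam phi (subfactor lam (fun i => cmod (phi i) ^+ 2)
    (finset.set0 : {set 'I_(size Z)})) j).
have : isospectral_data a lam phi (row_mx (\row_i lam i) w).
  rewrite dataE; exists finset.set0 => //; exists w; split => // j jK; rewrite mxE.
    by case: eqVneq jK => [->|_ /negbTE ->] //; rewrite iK.
  by rewrite jK; case: ifP.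
move=> [Q QP Qs]; exists Q => //; rewrite /F.
have /(xgetPex 0) /= : exists s, is_spectral_data (N := N) Q s by exists (row_mx (\row_i lam i) w).
move: (xget _ _) => s [lam1 [sp1 ->]].
have [lam2 [sp2 E]] := Qs; rewrite (spectrum_unique sp1 sp2) -E row_mxEr mxE eqxx.
by [].
Qed.
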